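(* Let $(W_1,S_1)$ and $(W_2,S_2)$ be two Coxeter systems, each of which is doubly laced or dihedral, with identity elements $e_1$ and $e_2$, and let $H_1\subseteq S_1$ and $H_2\subseteq S_2$. Let $v_1\in W_1^{H_1}$ and $v_2\in W_2^{H_2}$ be such that there exists a poset isomorphism $\psi$ from $[e_1,v_1]$ to $[e_2,v_2]$ which restricts to a poset isomorphism from $[e_1,v_1]^{H_1}$ to $[e_2,v_2]^{H_2}$. Let $x\in\{-1,q\}$. Then, for all $u,w\in[e_1,v_1]^{H_1}$, $$P_{u,w}^{H_1,x}(q)=P_{\psi(u),\psi(w)}^{H_2,x}(q)$$ (equivalently, $R_{u,w}^{H_1,x}(q)=R_{\psi(u),\psi(w)}^{H_2,x}(q)$ for all $u,w\in[e_1,v_1]^{H_1}$).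
   Context: A Coxeter system $(W,S)$ with Coxeter matrix entries $m(s,s')$ is doubly laced if $m(s,s')\le 4$ for all $s,s'\in S$; it is dihedral if it has rank $2$, i.e. $|S|=2$. The group $W$ is partially ordered by Bruhat order $\le$, with $\ell$ the length function. $D_L(w)=\{s\in S:\ell(sw)<\ell(w)\}$ and $D_R(w)=\{s\in S:\ell(ws)<\ell(w)\}$. For $u,v\in W$, $[u,v]=\{z\in W:u\le z\le v\}$. For $H\subseteq S$, $W^H=\{w\in W: D_R(w)\subseteq S\setminus H\}$ (minimal coset representatives), ordered by the restriction of Bruhat order, and $[u,v]^H=\{z\in W^H: u\le z\le v\}$ for $u,v\in W^H$. Parabolic $R$-polynomials: for $x\in\{-1,q\}$, $\{R^{H,x}_{u,v}(q)\}_{u,v\in W^H}\subseteq\mathbb Z[q]$ is the unique family of polynomials such that for all $u,v\in W^H$: (1) $R^{H,x}_{u,v}(q)=0$ if $u\not\le v$; (2) $R^{H,x}_{u,u}(q)=1$; (3) if $u<v$ and $s\in D_L(v)$, then $R^{H,x}_{u,v}(q)$ equals $R^{H,x}_{su,sv}(q)$ if $s\in D_L(u)$; equals $(q-1)R^{H,x}_{u,sv}(q)+qR^{H,x}_{su,sv}(q)$ if $s\notin D_L(u)$ and $su\in W^H$; equals $(q-1-x)R^{H,x}_{u,sv}(q)$ if $s\notin D_L(u)$ and $su\notin W^H$. Parabolic Kazhdan--Lusztig polynomials: $\{P^{H,x}_{u,v}(q)\}_{u,v\in W^H}\subseteq\mathbb Z[q]$ is the unique family such that for all $u,v\in W^H$: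 (1) $P^{H,x}_{u,v}(q)=0$ if $u\not\le v$; (2) $P^{H,x}_{u,u}(q)=1$; (3) $\deg P^{H,x}_{u,v}(q)\le\frac12(\ell(v)-\ell(u)-1)$ if $u<v$; (4) $q^{\ell(v)-\ell(u)}P^{H,x}_{u,v}(1/q)=\sum_{z\in[u,v]^H}R^{H,x}_{u,z}(q)P^{H,x}_{z,v}(q)$. *)

(* Defs.v *)
From Stdlib Require Export Relation_Operators.
From HB Require Import structures.
From mathcomp Require Export all_boot all_order all_algebra.
From mathcomp Require Export boolp classical_sets functions fsbigop.

Set Implicit Arguments.
Unset Strict Implicit.
Unset Printing Implicit Defensive.

Import GRing.Theory.

Local Open Scope classical_set_scope.
Local Open Scope group_scope.

(* Coxeter systems: S is a possibly infinite set of elements of the possibly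
   infinite group W. The Coxeter matrix is a function m : W -> W -> option nat
   of which only the values on S matter; None stands for infinity. *)

Definition is_coxeter_matrix (W : Type) (S : set W) (m : W -> W -> option nat)
    : Prop :=
  [/\ forall s, S s -> m s s = Some 1%N,
      forall s t, S s -> S t -> m s t = m t s &
      forall s t n, S s -> S t -> s <> t -> m s t = Some n -> (2 <= n)%N].

Definition word_in (W : groupType) (S : set W) (a : seq W) : Prop :=
  forall s, s \in a -> S s.

Definition word_prod (W : groupType) (a : seq W) : W := \prod_(s <- a) s.

(* Insertion of a relator (s t)^(m(s,t)), with m(s,t) finite, into a word. *)
Inductive relator_step (W : groupType) (S : set W) (m : W -> W -> option nat)
    : seq W -> seq W -> Prop :=
  RelatorStep a b s t n : S s -> S t -> m s t = Some n ->
    relator_step S m (a ++ b) (a ++ flatten (nseq n [:: s; t]) ++ b).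

(* W = < S | (s t)^(m(s,t)) = 1 for all s, t in S with m(s,t) finite >.
   As m(s,s) = 1, the relators include the squares of the generators, so that
   inverse letters are not needed and the group presentation is the monoid
   presentation by the congruence generated by the relators. *)
Definition coxeter_system (W : groupType) (S : set W)
    (m : W -> W -> option nat) : Prop :=
  [/\ is_coxeter_matrix S m,
      forall w : W, exists2 a, word_in S a & word_prod a = w &
      forall a b, word_in S a -> word_in S b ->
        (word_prod a = word_prod b <->
         clos_refl_sym_trans _ (relator_step S m) a b)].

Definition doubly_laced (W : groupType) (S : set W)
    (m : W -> W -> option nat) : Prop :=
  forall s t, S s -> S t -> exists2 n, m s t = Some n & (n <= 4)%N.

Definition dihedral (W : groupType) (S : set W) : Prop :=
  exists s t, s <> t /\ S = [set s; t].

Section CoxeterCombinatorics.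
Variables (W : groupType) (S : set W).

Definition has_word_of_size (w : W) (n : nat) : Prop :=
  exists a, [/\ word_in S a, size a = n & word_prod a = w].

(* The default value 0 is never used when S generates W. *)
Definition length (w : W) : nat :=
  xget 0%N [set n | has_word_of_size w n /\
                    forall k, has_word_of_size w k -> (n <= k)%N].

Definition left_descents (w : W) : set W :=
  [set s | S s /\ (length (s * w) < length w)%N].

Definition right_descents (w : W) : set W :=
  [set s | S s /\ (length (w * s) < length w)%N].

Definition reflection (t : W) : Prop :=
  exists w s, S s /\ t = w * s * w^-1.

Definition bruhat_step (u v : W) : Prop :=
  exists2 t, reflection t & v = u * t /\ (length u < length v)%N.

Definition bruhat_le : W -> W -> Prop := clos_refl_trans W bruhat_step.

Definition bruhat_lt (u v : W) : Prop := bruhat_le u v /\ u <> v.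

Definition bruhat_interval (u v : W) : set W :=
  [set z | bruhat_le u z /\ bruhat_le z v].

Definition min_coset_reps (H : set W) : set W :=
  [set w | right_descents w `<=` S `\` H].

Definition parabolic_interval (H : set W) (u v : W) : set W :=
  bruhat_interval u v `&` min_coset_reps H.

End CoxeterCombinatorics.

Definition poset_iso (T U : Type) (leT : T -> T -> Prop) (leU : U -> U -> Prop)
    (A : set T) (B : set U) (f : T -> U) : Prop :=
  set_bij A B f /\ forall a b, A a -> A b -> (leT a b <-> leU (f a) (f b)).

Local Open Scope ring_scope.

Notation tofrac := (@FracField.tofrac _).

Section ParabolicPolynomials.
Variables (W : groupType) (S : set W) (H : set W) (x : {poly int}).

(* The variable q is 'X. Only the values of the family at pairs of elements of
   min_coset_reps S H are constrained. *)
Definition parabolic_R_family (R : W -> W -> {poly int}) : Prop :=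
  forall u v, min_coset_reps S H u -> min_coset_reps S H v ->
  [/\ ~ bruhat_le S u v -> R u v = 0,
      R u u = 1 &
      bruhat_lt S u v -> forall s, left_descents S v s ->
      [/\ left_descents S u s -> R u v = R (s * u)%g (s * v)%g,
          ~ left_descents S u s -> min_coset_reps S H (s * u)%g ->
            R u v = ('X - 1) * R u (s * v)%g + 'X * R (s * u)%g (s * v)%g &
          ~ left_descents S u s -> ~ min_coset_reps S H (s * u)%g ->
            R u v = ('X - 1 - x) * R u (s * v)%g]].

Definition q_frac : {fraction {poly int}} := tofrac 'X.

(* p(1/q), as an element of the fraction field of Z[q]. *)
Definition eval_inv_q (p : {poly int}) : {fraction {poly int}} :=
  (map_poly intr p).[q_frac^-1].

(* The sum over the interval is a sum over a set, equal to the usual one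
   because lower Bruhat intervals are finite. *)
Definition parabolic_KL_family (R P : W -> W -> {poly int}) : Prop :=
  forall u v, min_coset_reps S H u -> min_coset_reps S H v ->
  [/\ ~ bruhat_le S u v -> P u v = 0,
      P u u = 1,
      bruhat_lt S u v ->
        (2 * (size (P u v)).-1 <= length S v - length S u - 1)%N &
      q_frac ^ ((length S v)%:Z - (length S u)%:Z)
        * eval_inv_q (P u v)
      = tofrac (\sum_(z \in parabolic_interval S H u v) R u z * P z v)].

End ParabolicPolynomials.

(* Main.v *)
(* By Deodhar, R^{H,x}_{u,v} is the sum of (-x)^(l(z)-l(u)) R_{z,v} over the
   z <= v such that u is the largest element of W^H below z; this set of z is
   determined by the posets [e,v] and [e,v]^H, so it suffices to show that the
   ordinary R-polynomials of a lower interval are invariants of the poset.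
   Left multiplication by a descent of v is a special matching of [e,v], and an
   isomorphism carries it to a special matching that need not be a
   multiplication.  Hence the main point is that the recursion for R holds along
   every special matching M of [e,w].  By induction on l(w), the recursions along
   M and along a multiplication N with N(w) <> M(w) agree as soon as the
   operators of M and N satisfy the braid relation of length K, where 2K is the
   size of the <M,N>-orbit of w, and this holds if every orbit has size 2 or 2K.
   In the doubly laced case, an orbit of size 2k > 2 whose top is in no dihedral
   parabolic subgroup can be pushed down, with the same k, to a third coatom of
   its top; if N is left multiplication by r, this rests on the fact that certain
   elements rising under r are determined by a common lower bound (rising_unique),
   proved by a rank-two computation in a geometric representation and with Dyer's
   canonical generators of reflection subgroups.  So all orbits can be compared
   with orbits in dihedral parabolic subgroups, where k <= 4 and a count of
   letters in reduced words rules out two different values.  In a dihedral group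
   R_{v,w} depends only on l(w) - l(v). *)

(* The obstacle is that M is known only through the order: each of its orbits with N is a 2k-gon,
   but nothing in the definition relates the k of different orbits. When a top is replaced by a
   coatom off its orbit, the covering axiom alone gives k <= k'; the reverse inequality is not
   order-theoretic, and this is why reflections and roots enter. As m(s,t) <= 4, a non-symmetric
   integral Cartan matrix replaces the form with cosines, so the geometry stays over the rationals,
   at the price of keeping roots and coroots apart. Orbits of size 2 are harmless for every K,
   because M and N coincide on them. Two matchings with the same value at w are not compared
   directly: both are compared with a third one that has another value at w. Since the
   multiplication chosen at w is on the left, a right multiplication is available for this, and
   inversion in the group carries the orbit count over to it. The step from R to P is the uniqueness
   argument for Kazhdan-Lusztig polynomials: the difference of two candidates is self-dual, but of
   degree below half of what self-duality requires. *)
Require Import Defs.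
From mathcomp Require Import cardinality zify ring lra.
Import Order.TTheory GRing.Theory Num.Theory.

Set Implicit Arguments.
Unset Strict Implicit.
Unset Printing Implicit Defensive.

Local Open Scope classical_set_scope.
Local Open Scope group_scope.

(** * Length and reflections *)

Section Presentation.
Variables (W : groupType) (S : set W) (m : W -> W -> option nat).
Hypothesis cox : coxeter_system S m.

Lemma word_prod_nil : word_prod [::] = 1 :> W.
Proof. by rewrite /word_prod big_nil. Qed.

Lemma word_prod_cons (s : W) a : word_prod (s :: a) = s * word_prod a.
Proof. by rewrite /word_prod big_cons. Qed.

Lemma word_prod_cat (a b : seq W) : word_prod (a ++ b) = word_prod a * word_prod b.
Proof. by rewrite /word_prod big_cat. Qed.

Lemma word_in_cons (s : W) a : word_in S (s :: a) <-> S s /\ word_in S a.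
Proof.
split=> [h|[h1 h2] t]; last by rewrite inE => /orP[/eqP->|/h2].
split=> [|t ta]; first by apply: h; rewrite inE eqxx.
by apply: h; rewrite inE ta orbT.
Qed.

Lemma word_in_cat (a b : seq W) : word_in S (a ++ b) <-> word_in S a /\ word_in S b.
Proof.
split=> [h|[h1 h2] t]; last by rewrite mem_cat => /orP[/h1|/h2].
by split=> t ta; apply: h; rewrite mem_cat ta ?orbT.
Qed.

Lemma word_in_nil : word_in S [::].
Proof. by []. Qed.

(** Inserting a relator does not change [foldr f], and the presentation links any two words with
    equal product by such insertions. The sign, the inversion cocycle and the geometric
    representation are all obtained from this universal property. *)
Lemma coxeter_action (X : Type) (f : W -> X -> X) :
  (forall s t n, S s -> S t -> m s t = Some n ->
     forall x, iter n (f s \o f t) x = x) ->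
  exists F : W -> X -> X,
    (forall x, F 1 x = x) /\ (forall s w x, S s -> F (s * w) x = f s (F w x)).
Proof.
move=> frel; have [_ gen pres] := cox.
have step a b : relator_step S m a b -> forall x, foldr f x a = foldr f x b.
  case=> {}a {}b s t n Ss St mst x; rewrite !foldr_cat; congr foldr.
  rewrite -[LHS](frel _ _ _ Ss St mst); elim: n {mst} => //= n IHn.
  by rewrite IHn.
have clos a b : word_in S a -> word_in S b -> word_prod a = word_prod b ->
    forall x, foldr f x a = foldr f x b.
  move=> Sa Sb /(pres _ _ Sa Sb); elim=> [c d|//|c d _ IH x|c d e _ IH1 _ IH2 x].
  - exact: step.
  - by rewrite IH.
  - by rewrite IH1.
pose wd w := sval (cid2 (gen w)).
have wdS w : word_in S (wd w) by rewrite /wd; case: (cid2 _).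
have wdP w : word_prod (wd w) = w by rewrite /wd; case: (cid2 _).
exists (fun w x => foldr f x (wd w)); split=> [x|s w x Ss].
  by rewrite (clos _ [::]) // wdP word_prod_nil.
rewrite (clos _ (s :: wd w)) ?wdP ?word_prod_cons ?wdP //.
by apply/word_in_cons.
Qed.

Lemma coxeter_rel s t n : S s -> S t -> m s t = Some n -> (s * t) ^+ n = 1.
Proof.
move=> Ss St mst; have [_ _ pres] := cox.
have Sn : word_in S (flatten (nseq n [:: s; t])).
  elim: n {mst} => //= n IHn; do 2 (apply/word_in_cons; split=> //).
have : word_prod [::] = word_prod (flatten (nseq n [:: s; t])).
  apply/pres => //; apply: Relation_Operators.rst_step.
  by have := RelatorStep [::] [::] Ss St mst; rewrite /= cats0.
rewrite word_prod_nil => ->.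
elim: n {mst Sn} => [|n IHn]; first by rewrite word_prod_nil.
by rewrite expgS IHn /= !word_prod_cons mulgA.
Qed.

Lemma coxeter_sqr s : S s -> s * s = 1.
Proof.
move=> Ss; have [[mss _ _] _ _] := cox.
by have := coxeter_rel Ss Ss (mss _ Ss); rewrite expg1.
Qed.

(** Letting every generator negate a boolean is a well-defined action, as relators have even length,
    and no generator acts trivially in it. *)
Lemma coxeter_ne1 s : S s -> s <> 1.
Proof.
move=> Ss s1; have [|F [F1 FS]] := @coxeter_action bool (fun _ => negb).
  move=> p q n _ _ _ x; rewrite -[RHS]/x; elim: n => //= n ->; by rewrite negbK.
by have := FS _ 1 true Ss; rewrite mulg1 s1 F1.
Qed.

End Presentation.

(** The matrix is hidden under an existential so that the combinatorics of the group does not carry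
    it along; the doubly laced sections fix a matrix again. *)
Record coxSystem := CoxSystem {
  cx_group : groupType;
  cx_gens : set cx_group;
  cx_presented : exists m, coxeter_system cx_gens m }.

Section Length.
Variable C : coxSystem.
Local Notation W := (cx_group C).
Local Notation S := (@cx_gens C).
Local Notation len := (length S).
Implicit Types s t u v w x y z : W.

(* [mulgA] and [invgM] leave unfolded structures in the goal, which [lia] does not
   recognize. *)
Lemma mulwA (x y z : W) : x * (y * z) = x * y * z.
Proof. exact: mulgA. Qed.

Lemma invwM (x y : W) : (x * y)^-1 = y^-1 * x^-1.
Proof. exact: invgM. Qed.

Lemma simple_sqr s : S s -> s * s = 1.
Proof. by have [m hm] := cx_presented C; apply: coxeter_sqr hm _. Qed.

Lemma simpleV s : S s -> s^-1 = s.
Proof. by move=> Ss; apply: mulg1_eq; apply: simple_sqr. Qed.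

Lemma simpleK s w : S s -> s * (s * w) = w.
Proof. by move=> Ss; rewrite mulgA simple_sqr // mul1g. Qed.

Lemma simpleKr s w : S s -> w * s * s = w.
Proof. by move=> Ss; rewrite -mulgA simple_sqr // mulg1. Qed.

Lemma lenP w : exists a, [/\ word_in S a, size a = len w & word_prod a = w].
Proof.
have [m [_ gen _]] := cx_presented C; have [a Sa aw] := gen w.
have ex : exists n, `[< has_word_of_size S w n >].
  by exists (size a); apply/asboolP; exists a.
have [n /asboolP nw nmin] := find_ex_minn ex.
have := @xgetPex _ 0%N [set n | has_word_of_size S w n /\
  forall k, has_word_of_size S w k -> (n <= k)%N].
case; last by move=> wl _; exact: wl.
by exists n; split=> // k kw; apply/nmin/asboolP.
Qed.

Lemma len_le a : word_in S a -> (len (word_prod a) <= size a)%N.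
Proof.
move=> Sa; set w := word_prod a; have [b [Sb _ bw]] := lenP w.
have ex : exists n, `[< has_word_of_size S w n >].
  by exists (size a); apply/asboolP; exists a.
have [n /asboolP nw nmin] := find_ex_minn ex.
have := @xgetPex _ 0%N [set n | has_word_of_size S w n /\
  forall k, has_word_of_size S w k -> (n <= k)%N].
case; last by move=> _; apply; exists a.
by exists n; split=> // k kw; apply/nmin/asboolP.
Qed.

Lemma len1 : len 1 = 0%N.
Proof.
by apply/eqP; rewrite -leqn0 -(word_prod_nil W); apply: len_le; exact: word_in_nil.
Qed.

Lemma len0 w : len w = 0%N -> w = 1.
Proof. by have [a [_ <- <-]] := lenP w => /size0nil ->; rewrite word_prod_nil. Qed.

Lemma word_ind (P : W -> Prop) :
  P 1 -> (forall s w, S s -> P w -> P (s * w)) -> forall w, P w.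
Proof.
move=> P1 PS w; have [a [Sa _ <-]] := lenP w.
elim: a Sa => [|s a IH /word_in_cons[Ss Sa]]; first by rewrite word_prod_nil.
by rewrite word_prod_cons; apply: PS => //; apply: IH.
Qed.

Lemma len_parity : exists F : W -> bool,
  (forall u v, F (u * v) = F u (+) F v) /\ (forall w, F w = odd (len w)).
Proof.
have [m hm] := cx_presented C.
have [|F [F1 FS]] := @coxeter_action _ _ _ hm bool (fun _ => negb).
  move=> p q n _ _ _ x; rewrite -[RHS]/x; elim: n => //= n ->; by rewrite negbK.
have Fx w (x : bool) : F w x = x (+) F w false.
  elim/word_ind: w x => [|s w Ss IH] x; first by rewrite !F1 addbF.
  by rewrite !FS // IH; case: x; case: (F w _).
exists (F^~ false); split=> [u v|w] /=.
  elim/word_ind: u => [|s w Ss IH]; first by rewrite mul1g F1.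
  by rewrite -mulgA FS // FS // IH addNb.
have [a [Sa <- <-]] := lenP w.
elim: a Sa => [|s a IH /word_in_cons[Ss Sa]]; first by rewrite word_prod_nil F1.
by rewrite word_prod_cons FS //= IH.
Qed.

Lemma odd_lenM u v : odd (len (u * v)) = odd (len u) (+) odd (len v).
Proof. by have [F [FM FE]] := len_parity; rewrite -!FE FM. Qed.

Lemma len_simple s : S s -> len s = 1%N.
Proof.
move=> Ss; have Ss1 : word_in S [:: s] by move=> t; rewrite inE => /eqP->.
have := len_le Ss1; rewrite word_prod_cons word_prod_nil mulg1.
case: (len s) (@len0 s) => [/(_ erefl) s1|[]//].
by have [m hm] := cx_presented C; have := coxeter_ne1 hm Ss s1.
Qed.

Lemma lenV_le w : (len w^-1 <= len w)%N.
Proof.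
have [a [Sa <- <-]] := lenP w; rewrite -(size_rev a).
have -> : (word_prod a)^-1 = word_prod (rev a).
  elim: a Sa => [|s a IH /word_in_cons[Ss Sa]].
    by rewrite /rev /= word_prod_nil invg1.
  rewrite rev_cons -cats1 word_prod_cat !word_prod_cons word_prod_nil mulg1.
  by rewrite invgM IH // simpleV.
by apply: len_le => s; rewrite mem_rev; apply: Sa.
Qed.

Lemma lenV w : len w^-1 = len w.
Proof. by apply/eqP; rewrite eqn_leq lenV_le -{1}(invgK w) lenV_le. Qed.

Lemma len_mulS_le s w : S s -> (len (s * w) <= (len w).+1)%N.
Proof.
move=> Ss; have [a [Sa <- <-]] := lenP w.
by rewrite -word_prod_cons -/(size (s :: a)); apply/len_le/word_in_cons.
Qed.

Lemma len_mulS s w : S s -> len (s * w) = (len w).+1 \/ len w = (len (s * w)).+1.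
Proof.
move=> Ss; have := len_mulS_le w Ss.
have := len_mulS_le (s * w) Ss; rewrite simpleK // => h1 h2.
have : odd (len (s * w)) != odd (len w).
  by rewrite odd_lenM len_simple //=; case: (odd _).
move: h1 h2; rewrite leq_eqVlt => /orP[/eqP->|]; first by right.
rewrite ltnS leq_eqVlt => h1; rewrite leq_eqVlt => /orP[/eqP->|]; first by left.
rewrite ltnS => h2; case/orP: h1 => [/eqP->|h1]; first by rewrite eqxx.
by have := leq_ltn_trans h2 h1; rewrite ltnn.
Qed.

Lemma len_mulSr s w : S s -> len (w * s) = (len w).+1 \/ len w = (len (w * s)).+1.
Proof.
by move=> Ss; have := len_mulS w^-1 Ss; rewrite -(simpleV Ss) -invgM !lenV simpleV.
Qed.

Lemma exists_left_descent w : w <> 1 -> exists2 s, S s & (len (s * w) < len w)%N.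
Proof.
have [[|s a] [Sa sa aw]] := lenP w; first by rewrite -aw word_prod_nil.
move=> _; move/word_in_cons: (Sa) => [Ss Sa'].
exists s => //; rewrite -sa -aw word_prod_cons simpleK //.
by rewrite /= ltnS; apply: len_le.
Qed.

End Length.

Section Inversions.
Variable C : coxSystem.
Local Notation W := (cx_group C).
Local Notation S := (@cx_gens C).
Local Notation len := (length S).
Implicit Types s t u v w x y z : W.

(* Tits' signed permutation of conjugates; the sign cocycle records whether a
   reflection is a (right) inversion. *)
Lemma inversion_cocycle : exists N : W -> W -> bool,
  [/\ forall x, N 1 x = false,
      forall s x, S s -> N s x = (x == s) &
      forall u w x, N (u * w) x = N w x (+) N u (w * x * w^-1)].
Proof.
have [m hm] := cx_presented C.
pose f (s : W) (p : W * bool) := (s * p.1 * s, p.2 (+) (p.1 == s)).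
have frel s t n : S s -> S t -> m s t = Some n ->
    forall p, iter n (f s \o f t) p = p.
  move=> Ss St mst [x e]; have gn := coxeter_rel hm Ss St mst.
  have ss := simple_sqr Ss; have tt := simple_sqr St.
  set g := s * t in gn.
  have gV : g^-1 = t * s by rewrite invgM !simpleV.
  have tg k : t * g ^+ k = g ^- k * t.
    elim: k => [|k IH]; first by rewrite invg1 mulg1 mul1g.
    have tgE : t * g = g^-1 * t by rewrite gV /g mulgA.
    by rewrite expgSr mulgA IH -mulgA tgE mulgA -invgM -expgS -expgSr.
  (* [c N] is the parity of the number of j < N with x = g^(-j) t. One application of [f s \o f t]
     adds the indices 2k and 2k + 1, and over 2n indices every reflection is counted twice because
     g^n = 1. *)
  pose c N := \big[addb/false]_(0 <= j < N) (x == g ^- j * t).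
  have it k : iter k (f s \o f t) (x, e) = (g ^+ k * x * g ^- k, e (+) c k.*2).
    elim: k => [|k IH]; first by rewrite /c big_geq // addbF invg1 mulg1 mul1g.
    rewrite iterS IH /= /f /=; congr pair.
      by rewrite expgS invgM gV /g !mulgA.
    rewrite doubleS /c !big_nat_recr //= -!/(c _) -!addbA; congr (_ (+) (_ (+) _)).
    have e1 (y : W) : (g ^+ k * x * g ^- k == y) = (x == g ^- k * y * g ^+ k).
      apply/eqP/eqP => [<-|->]; first by rewrite !mulgA mulVg mul1g mulgVK.
      by rewrite !mulgA mulgV mul1g mulgK.
    congr (_ (+) _).
      by rewrite e1 -mulgA tg mulgA -invgM -expgnDr addnn.
    have e2 (y : W) : (t * y * t == s) = (y == t * s * t).
      apply/eqP/eqP => [<-|->]; first by rewrite !mulgA tt mul1g -mulgA tt mulg1.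
      by rewrite !mulgA tt mul1g -mulgA tt mulg1.
    rewrite e2 e1 -!mulgA tg [t * (s * _)]mulgA -[t * s]gV !mulgA.
    by rewrite -!invgM -expgS -expgnDr addnS addnn.
  rewrite it gn invg1 mulg1 mul1g -addnn /c.
  have -> : \big[addb/false]_(0 <= j < n + n) (x == g ^- j * t) = false.
    rewrite (big_cat_nat _ (n := n)) ?leq_addr //=.
    have -> : \big[addb/false]_(n <= j < n + n) (x == g ^- j * t) =
              \big[addb/false]_(0 <= j < n) (x == g ^- j * t).
      rewrite -{1}[n]add0n big_addn addnK; apply: eq_bigr => j _.
      by rewrite addnC expgnDr gn mul1g.
    by rewrite addbb.
  by rewrite addbF.
have [F [F1 FS]] := coxeter_action hm frel.
have Fx w : forall x e, F w (x, e) = (w * x * w^-1, e (+) (F w (x, false)).2).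
  elim/word_ind: w => [|s w Ss IH] x e; first by rewrite !F1 invg1 mulg1 mul1g addbF.
  have Eb : F w (x, false) = (w * x * w^-1, (F w (x, false)).2) by rewrite {1}IH.
  rewrite (FS _ _ (x, e)) // (FS _ _ (x, false)) // (IH x e) Eb /f /= invgM.
  by rewrite (simpleV Ss) !mulgA addbA.
have FM u w p : F (u * w) p = F u (F w p).
  elim/word_ind: u => [|s u Ss IH]; first by rewrite mul1g F1.
  by rewrite -mulgA FS // [in LHS]FS // IH.
exists (fun w x => (F w (x, false)).2); split=> [x|s x Ss|u w x].
- by rewrite F1.
- by rewrite -[s]mulg1 FS // F1 /f /= mulg1.
- have -> : F (u * w) (x, false) = F u (w * x * w^-1, (F w (x, false)).2).
    by rewrite FM {1}Fx.
  by rewrite (Fx u _ (F w (x, false)).2).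
Qed.

End Inversions.

Section Exchange.
Variable C : coxSystem.
Local Notation W := (cx_group C).
Local Notation S := (@cx_gens C).
Local Notation len := (length S).
Implicit Types s t u v w x y z : W.
Local Notation refl := (reflection S).

(** For a reflection t this means l(wt) < l(w) ([inversionP]). As a cocycle, unlike a comparison of
    lengths, it can be computed for products. *)
Definition inversion (w t : W) : bool :=
  sval (cid (inversion_cocycle C)) w t.

Lemma inversion1 t : inversion 1 t = false.
Proof. by rewrite /inversion; case: cid => N [/= h1 _ _]; apply: h1. Qed.

Lemma inversionS s t : S s -> inversion s t = (t == s).
Proof. by rewrite /inversion; case: cid => N [/= _ h2 _]; apply: h2. Qed.

Lemma inversionM u w t :
  inversion (u * w) t = inversion w t (+) inversion u (w * t * w^-1).
Proof. by rewrite /inversion; case: cid => N [/= _ _ h3]; apply: h3. Qed.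

Lemma refl_simple s : S s -> refl s.
Proof. by move=> Ss; exists 1, s; rewrite mul1g invg1 mulg1. Qed.

Lemma refl_conj u t : refl t -> refl (u * t * u^-1).
Proof.
by move=> [w [s [Ss ->]]]; exists (u * w), s; rewrite invgM !mulgA.
Qed.

Lemma refl_conjV u t : refl t -> refl (u^-1 * t * u).
Proof. by move=> /(refl_conj u^-1); rewrite invgK. Qed.

Lemma refl_sqr t : refl t -> t * t = 1.
Proof.
move=> [w [s [Ss ->]]]; rewrite -!mulgA mulKg (mulgA s).
by rewrite simple_sqr // mul1g mulgV.
Qed.

Lemma reflV t : refl t -> t^-1 = t.
Proof. by move=> /refl_sqr /mulg1_eq. Qed.

Lemma reflK t w : refl t -> w * t * t = w.
Proof. by move=> tr; rewrite -mulgA refl_sqr // mulg1. Qed.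

Lemma inversionV u t : inversion u^-1 (u * t * u^-1) = inversion u t.
Proof.
have := inversionM u^-1 u t; rewrite mulVg inversion1.
by case: (inversion u t); case: (inversion _ _).
Qed.

Lemma inversion_refl t : refl t -> inversion t t.
Proof.
move=> [w [s [Ss ->]]]; rewrite inversionM inversionV invgK.
have -> : w^-1 * (w * s * w^-1) * w = s by rewrite -!mulgA mulKg mulVg mulg1.
rewrite inversionM (inversionS _ Ss) eqxx simpleV // simple_sqr // mul1g.
by case: (inversion w s).
Qed.

Lemma oddRefl t : refl t -> odd (len t).
Proof.
move=> [w [s [Ss ->]]]; rewrite !odd_lenM lenV (len_simple Ss) /=.
by case: (odd _).
Qed.

Lemma len_reflNeq w t : refl t -> len (w * t) != len w.
Proof.
move=> /oddRefl ot; apply/eqP => e; have := odd_lenM w t.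
by rewrite e ot; case: (odd _).
Qed.

(** Along the word the cocycle is a sum with one term for each letter, so some letter, conjugated by
    the product of the letters to its right, equals t; multiplying by t cancels it. *)
Lemma inversion_delete a t : word_in S a -> inversion (word_prod a) t ->
  exists b s c, a = b ++ s :: c /\ word_prod a * t = word_prod (b ++ c).
Proof.
elim: a => [|s a IH]; first by rewrite word_prod_nil inversion1.
move=> /word_in_cons[Ss Sa]; rewrite word_prod_cons inversionM (inversionS _ Ss).
case: (boolP (inversion _ t)) => [/(IH Sa)[b [s' [c [-> E]]]] _|_ /= /eqP E].
  by exists (s :: b), s', c; rewrite /= word_prod_cons -E mulgA.
exists [::], s, a; split=> //=.
have -> : t = (word_prod a)^-1 * s * word_prod a.
  by rewrite -E !mulgA mulVg mul1g mulgVK.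
by rewrite !mulgA mulgK simple_sqr // mul1g.
Qed.

(** As t is an inversion of itself, it is an inversion of exactly one of w and wt; deletion applied
    to that one shows which is longer. *)
Lemma inversionP w t : refl t -> inversion w t = (len (w * t) < len w)%N.
Proof.
move=> tr; have h w' : inversion w' t -> (len (w' * t) < len w')%N.
  have [a [Sa <- <-]] := lenP w' => /(inversion_delete Sa)[b [s [c [ab ->]]]].
  rewrite ab; have -> : size (b ++ s :: c) = (size (b ++ c)).+1.
    by rewrite !size_cat addnS.
  rewrite ltnS; apply: len_le; move: Sa; rewrite ab => /word_in_cat[Sb].
  by move=> /word_in_cons[_ Sc]; apply/word_in_cat.
apply/idP/idP; first exact: h.
apply: contraTT => nw; rewrite -leqNgt ltnW //.
rewrite -{1}(reflK w tr); apply: h.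
by rewrite inversionM inversion_refl // reflV // reflK // (negbTE nw).
Qed.

Lemma strong_exchange a t : word_in S a -> refl t ->
    (len (word_prod a * t) < len (word_prod a))%N ->
  exists b s c, a = b ++ s :: c /\ word_prod a * t = word_prod (b ++ c).
Proof. by move=> Sa tr; rewrite -inversionP //; apply: inversion_delete. Qed.

End Exchange.

(** * Bruhat order *)

Section Bruhat.
Variable C : coxSystem.
Local Notation W := (cx_group C).
Local Notation S := (@cx_gens C).
Local Notation len := (length S).
Implicit Types s t u v w x y z : W.
Local Notation refl := (reflection S).
Local Notation "u <=b v" := (bruhat_le S u v) (at level 70).

Lemma len_desc s w : S s -> (len (s * w) < len w)%N -> len w = (len (s * w)).+1.
Proof. by move=> /(@len_mulS C s w) [->|//]; rewrite ltnNge leqnSn. Qed.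

Lemma len_asc s w : S s -> ~~ (len (s * w) < len w)%N -> len (s * w) = (len w).+1.
Proof. by move=> /(@len_mulS C s w) [//|->]; rewrite ltnSn. Qed.

Lemma len_mul_lt s w : S s -> (len w < len (s * w))%N = ~~ (len (s * w) < len w)%N.
Proof.
by move=> /(@len_mulS C s w) [->|->]; rewrite ltnSn ltnNge leqnSn.
Qed.

Lemma bruhat_refl u : u <=b u.
Proof. exact: rt_refl. Qed.

Lemma bruhat_trans v u w : u <=b v -> v <=b w -> u <=b w.
Proof. exact: rt_trans. Qed.

Lemma bruhat_mulr u t : refl t -> (len u < len (u * t))%N -> u <=b u * t.
Proof. by move=> tr ut; apply: rt_step; exists t. Qed.

Lemma bruhat_mull u t : refl t -> (len u < len (t * u))%N -> u <=b t * u.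
Proof.
move=> tr ut; have -> : t * u = u * (u^-1 * t * u) by rewrite !mulwA mulgV mul1g.
apply: bruhat_mulr; first exact: refl_conjV.
by rewrite !mulwA mulgV mul1g.
Qed.

Lemma bruhat_descl s w : S s -> (len (s * w) < len w)%N -> s * w <=b w.
Proof.
move=> Ss sw; rewrite -{2}(simpleK w Ss); apply: bruhat_mull.
  exact: refl_simple.
by rewrite simpleK.
Qed.

Lemma bruhat_ascl s w : S s -> (len w < len (s * w))%N -> w <=b s * w.
Proof. by move=> Ss; apply: bruhat_mull; apply: refl_simple. Qed.

Lemma bruhat_eq_or_lt u v : u <=b v -> u = v \/ (len u < len v)%N.
Proof.
elim=> {u v} [u v [t _ [_ ?]]|u|u x v _ IH1 _ IH2]; [by right|by left|].
case: IH1 => [->//|h1]; case: IH2 => [<-|h2]; right=> //.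
exact: ltn_trans h1 h2.
Qed.

Lemma bruhat_len u v : u <=b v -> (len u <= len v)%N.
Proof. by move=> /bruhat_eq_or_lt[->//|/ltnW]. Qed.

Lemma bruhat_len_eq u v : u <=b v -> (len v <= len u)%N -> u = v.
Proof. by move=> /bruhat_eq_or_lt[->//|]; rewrite ltnNge => /negbTE->. Qed.

Lemma bruhat_anti u v : u <=b v -> v <=b u -> u = v.
Proof. by move=> uv /bruhat_len; apply: bruhat_len_eq. Qed.

Lemma bruhatV u v : u <=b v -> u^-1 <=b v^-1.
Proof.
elim=> {u v} [u v [t tr [-> ut]]|u|u x v _ IH1 _ IH2]; last exact: bruhat_trans IH2.
  rewrite invwM (reflV tr); apply: bruhat_mull => //.
  by rewrite -[in X in (_ < X)%N](reflV tr) -invwM !lenV.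
exact: bruhat_refl.
Qed.

(** The cocycle isolates the only exception to monotonicity: if s reverses the step from u to ut,
    then t is an inversion of su but not of u, which forces utu^-1 = s, that is su = ut. All lifting
    properties below come from this lemma and the next. *)
Lemma bruhat_zl s u v : S s -> u <=b v -> s * u <=b v \/ s * u <=b s * v.
Proof.
move=> Ss; elim=> {u v} [u v [t tr [-> ut]]|u|u x v ux IH1 xv IH2].
- have [lt|] := boolP (len (s * u) < len (s * u * t))%N.
    by right; rewrite [s * (u * t)]mulwA; apply: bruhat_mulr.
  rewrite -leqNgt leq_eqVlt (negbTE (len_reflNeq _ tr)) /= => lt.
  left; suff -> : s * u = u * t by exact: bruhat_refl.
  have : inversion (s * u) t by rewrite inversionP.
  rewrite inversionM inversionP // ltnNge (ltnW ut) inversionS // => /eqP <-.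
  by rewrite mulgVK.
- by right; apply: bruhat_refl.
- case: IH1 => h1; first by left; apply: bruhat_trans xv.
  by case: IH2 => h2; [left|right]; apply: bruhat_trans h2.
Qed.

Lemma bruhat_zr s u v : S s -> u <=b v -> u <=b s * v \/ s * u <=b s * v.
Proof.
move=> Ss; elim=> {u v} [u v [t tr [-> ut]]|u|u x v ux IH1 xv IH2].
- have [lt|] := boolP (len (s * u) < len (s * u * t))%N.
    by right; rewrite [s * (u * t)]mulwA; apply: bruhat_mulr.
  rewrite -leqNgt leq_eqVlt (negbTE (len_reflNeq _ tr)) /= => lt.
  left; suff <- : s * u = u * t by rewrite simpleK //; exact: bruhat_refl.
  have : inversion (s * u) t by rewrite inversionP.
  rewrite inversionM inversionP // ltnNge (ltnW ut) inversionS // => /eqP <-.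
  by rewrite mulgVK.
- by right; apply: bruhat_refl.
- case: IH2 => h2; first by left; apply: bruhat_trans h2.
  by case: IH1 => h1; [left|right]; apply: bruhat_trans h2.
Qed.

Lemma lift_descl s u v : S s -> u <=b v -> (len (s * v) < len v)%N -> s * u <=b v.
Proof.
move=> Ss uv sv; case: (bruhat_zl Ss uv) => // h.
exact: bruhat_trans h (bruhat_descl Ss sv).
Qed.

Lemma lift_ascl s u v : S s -> u <=b v -> (len u < len (s * u))%N -> u <=b s * v.
Proof.
move=> Ss uv su; case: (bruhat_zr Ss uv) => // h.
exact: bruhat_trans (bruhat_ascl Ss su) h.
Qed.

Lemma lift_bothl s u v : S s -> u <=b v -> (len (s * u) < len u)%N -> s * u <=b s * v.
Proof.
move=> Ss uv su; case: (bruhat_zr Ss uv) => // h.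
exact: bruhat_trans (bruhat_descl Ss su) h.
Qed.

Lemma lift_monol s u v : S s -> u <=b v -> (len v < len (s * v))%N -> s * u <=b s * v.
Proof.
move=> Ss uv sv; case: (bruhat_zl Ss uv) => // h.
exact: bruhat_trans h (bruhat_ascl Ss sv).
Qed.

Lemma bruhat1 w : 1 <=b w.
Proof.
move: {2}(len w) (leqnn (len w)) => n; elim: n w => [|n IH] w.
  by rewrite leqn0 => /eqP/len0->; exact: bruhat_refl.
have [->|/eqP/exists_left_descent[s Ss sw]] := eqVneq w 1.
  by move=> _; exact: bruhat_refl.
move=> wn; apply: bruhat_trans (bruhat_descl Ss sw); apply: IH.
by rewrite -ltnS; apply: leq_trans wn.
Qed.

Lemma len_mulr_inv s w : S s -> len (w * s) = len (s * w^-1).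
Proof. by move=> Ss; rewrite -(lenV (w * s)) invwM (simpleV Ss). Qed.

Lemma lift_descr s u v : S s -> u <=b v -> (len (v * s) < len v)%N -> u * s <=b v.
Proof.
move=> Ss /bruhatV uv; rewrite len_mulr_inv // -(lenV v) => sv.
by have /bruhatV := lift_descl Ss uv sv; rewrite invwM !invgK simpleV.
Qed.

Lemma lift_ascr s u v : S s -> u <=b v -> (len u < len (u * s))%N -> u <=b v * s.
Proof.
move=> Ss /bruhatV uv; rewrite len_mulr_inv // -(lenV u) => su.
by have /bruhatV := lift_ascl Ss uv su; rewrite invwM !invgK simpleV.
Qed.

(** A Bruhat step may raise the length by any odd number, so gradedness is a theorem. Take a left
    descent s of v. If su > u, the coatom is sv. Otherwise induction gives a coatom z of sv above
    su, and then sv or sz lies above u. *)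
Lemma exists_coatom u v : u <=b v -> u <> v ->
  exists z, [/\ u <=b z, z <=b v & len v = (len z).+1].
Proof.
move: {2}(len v) (leqnn (len v)) => n; elim: n u v => [|n IH] u v.
  rewrite leqn0 => /eqP v0 uv; case; have := bruhat_len uv.
  by rewrite v0 leqn0 => /eqP/len0->; rewrite (len0 v0).
move=> vn uv nuv; have v1 : v <> 1.
  move=> v1; apply: nuv; rewrite v1 in uv *.
  by have := bruhat_len uv; rewrite len1 leqn0 => /eqP/len0.
have [s Ss sv] := exists_left_descent v1; have lv := len_desc Ss sv.
have svv := bruhat_descl Ss sv.
have [su|su] := boolP (len (s * u) < len u)%N; last first.
  exists (s * v); split=> //; apply: lift_ascl => //.
  by rewrite len_mul_lt.
have [||z [uz zv lz]] := IH _ _ _ (lift_bothl Ss uv su).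
- by rewrite -ltnS -lv.
- by move=> e; apply: nuv; rewrite -(simpleK u Ss) e simpleK.
have [sz|sz] := boolP (len (s * z) < len z)%N.
  exists (s * v); split=> //; apply: bruhat_trans zv.
  by rewrite -(simpleK u Ss); apply: lift_descl.
exists (s * z); split.
- rewrite -(simpleK u Ss); apply: lift_monol => //.
  by rewrite len_mul_lt.
- by apply: lift_descl => //; apply: bruhat_trans svv.
- by rewrite lv lz len_asc.
Qed.

Lemma exists_atom u v : u <=b v -> u <> v ->
  exists z, [/\ u <=b z, z <=b v & len z = (len u).+1].
Proof.
move: {2}(len v) (leqnn (len v)) => n; elim: n v => [|n IH] v.
  rewrite leqn0 => /eqP v0 uv; case; have := bruhat_len uv.
  by rewrite v0 leqn0 => /eqP/len0->; rewrite (len0 v0).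
move=> vn uv nuv; have [z [uz zv lz]] := exists_coatom uv nuv.
have [e|/eqP nuz] := eqVneq u z.
  by exists v; split=> //; [exact: bruhat_refl|rewrite lz e].
have [|y [uy yz ly]] := IH z _ uz nuz; first by rewrite -ltnS -lz.
by exists y; split=> //; apply: bruhat_trans zv.
Qed.

Lemma cover_refl u v : u <=b v -> len v = (len u).+1 -> exists2 t, refl t & v = u * t.
Proof.
elim=> {u v} [u v [t tr [-> _]]|u /n_Sn//|u x v ux IH1 xv IH2 e]; first by exists t.
case: (bruhat_eq_or_lt ux) => [E|h1]; first by rewrite E in e *; apply: IH2.
case: (bruhat_eq_or_lt xv) => [E|h2]; first by rewrite -E in e *; apply: IH1.
by have := leq_ltn_trans h1 h2; rewrite e ltnn.
Qed.

Lemma interval_finite w : finite_set [set u | u <=b w].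
Proof.
move: {2}(len w) (leqnn (len w)) => n; elim: n w => [|n IH] w.
  rewrite leqn0 => /eqP/len0->; apply: (@sub_finite_set _ _ [set 1]) => // u /= u1.
  by have := bruhat_len u1; rewrite len1 leqn0 => /eqP/len0.
have [->|/eqP/exists_left_descent[s Ss sw]] := eqVneq w 1.
  by move=> _; apply: IH; rewrite len1.
move=> wn; have fs : finite_set [set u | u <=b s * w].
  by apply: IH; rewrite -ltnS; apply: leq_trans wn.
apply: (@sub_finite_set _ _ ([set u | u <=b s * w] `|` [set s * u | u in [set u | u <=b s * w]])).
  move=> u /= uw; case: (bruhat_zr Ss uw) => h; first by left.
  by right; exists (s * u) => //; rewrite simpleK.
by rewrite finite_setU; split=> //; apply: finite_image.
Qed.

(** Take a left descent s of v. If su > u, the two elements are sv and su. Otherwise they come from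
    [su,sv] through multiplication by s, with sv taking the place of u when u is one of the two
    found there. *)
Lemma bruhat_thin u v : u <=b v -> len v = (len u).+2 ->
  exists y z, [/\ y <> z, u <=b y, y <=b v, u <=b z & z <=b v]
    /\ len y = (len u).+1 /\ len z = (len u).+1.
Proof.
move: {2}(len v) (leqnn (len v)) => n; elim: n u v => [|n IH] u v.
  by rewrite leqn0 => /eqP-> _ /eqP.
move=> vn uv luv; have v1 : v <> 1 by move=> v1; move: luv; rewrite v1 len1.
have [s Ss sv] := exists_left_descent v1; have lv := len_desc Ss sv.
have svv := bruhat_descl Ss sv.
have lsv : len (s * v) = (len u).+1 by move: luv; rewrite lv => -[].
have [su|su] := boolP (len (s * u) < len u)%N; last first.
  have su' : (len u < len (s * u))%N by rewrite len_mul_lt.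
  exists (s * v), (s * u); split; split=> //.
  - by move=> /(congr1 (fun x => s * x)); rewrite /= !simpleK // => e; move: luv; rewrite e; lia.
  - exact: lift_ascl.
  - exact: bruhat_ascl.
  - exact: lift_descl.
  - exact: len_asc.
have lsu := len_desc Ss su.
have [||y [z [[nyz uy yv uz zv] [ly lz]]]] := IH _ _ _ (lift_bothl Ss uv su).
- by rewrite -ltnS -lv.
- by rewrite lsv lsu.
have up x : s * u <=b x -> x <=b s * v -> len x = (len (s * u)).+1 ->
    x = u \/ [/\ u <=b s * x, s * x <=b v, len (s * x) = (len u).+1 & ~~ (len (s * x) < len x)%N].
  move=> ux xv lx; have [sx|sx] := boolP (len (s * x) < len x)%N.
    left; apply/esym/bruhat_len_eq; last by rewrite lx lsu.
    by rewrite -(simpleK u Ss); apply: lift_descl.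
  right; split=> //.
  - rewrite -(simpleK u Ss); apply: lift_monol => //; by rewrite len_mul_lt.
  - by apply: lift_descl => //; apply: bruhat_trans svv.
  - by rewrite len_asc // lx lsu.
have other x : ~~ (len (s * x) < len x)%N -> s * v <> s * x.
  move=> sx /(congr1 (fun x => s * x)); rewrite /= !simpleK // => e; move: sv.
  by rewrite e (negbTE sx).
case: (up y uy yv ly) => [yu|[uy' yv' ly' sy]]; case: (up z uz zv lz) => [zu|[uz' zv' lz' sz]].
- by case: nyz; rewrite yu zu.
- exists (s * v), (s * z); split; split=> //; first exact: other.
  by rewrite -yu.
- exists (s * v), (s * y); split; split=> //; first exact: other.
  by rewrite -zu.
- exists (s * y), (s * z); split; split=> //.
  by move=> /(congr1 (fun x => s * x)); rewrite /= !simpleK.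
Qed.

End Bruhat.

(** * Subwords, dihedral parabolic subgroups and coatoms *)

Section Subwords.
Variable C : coxSystem.
Local Notation W := (cx_group C).
Local Notation S := (@cx_gens C).
Local Notation len := (length S).
Implicit Types s t u v w x y z : W.
Local Notation refl := (reflection S).
Local Notation "u <=b v" := (bruhat_le S u v) (at level 70).

Lemma word_in_subseq (T : set W) a b : subseq b a -> word_in T a -> word_in T b.
Proof. by move=> /mem_subseq ba Ta s /ba /Ta. Qed.

Lemma exists_reduced a : word_in S a ->
  exists b, [/\ subseq b a, word_prod b = word_prod a & size b = len (word_prod a)].
Proof.
elim: a => [_|s a IH]; first by exists [::]; rewrite word_prod_nil len1.
move=> /word_in_cons[Ss Sa]; have [b [ba bp bs]] := IH Sa.
have Sb := word_in_subseq ba Sa; rewrite word_prod_cons -bp in bs *.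
have [lt|ge] := boolP (len (s * word_prod b) < len (word_prod b))%N; last first.
  exists (s :: b); rewrite /= eqxx word_prod_cons len_asc //; split=> //.
  by rewrite bs.
have E : s * word_prod b = word_prod b * ((word_prod b)^-1 * s * word_prod b).
  by rewrite !mulwA mulgV mul1g.
rewrite E in lt.
have [|c [x [d [bE pE]]]] := strong_exchange Sb _ lt.
  exact/refl_conjV/refl_simple.
exists (c ++ d); rewrite E; split=> //.
  apply: subseq_trans (subseq_cons _ _); apply: subseq_trans ba.
  by rewrite bE; apply: cat_subseq => //; apply: subseq_cons.
rewrite -E in lt *; have := len_desc Ss lt.
by rewrite -bs bE !size_cat /= addnS => -[].
Qed.

Lemma subword u v a : u <=b v -> word_in S a -> word_prod a = v ->
  exists b, [/\ subseq b a, word_prod b = u & size b = len u].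
Proof.
move=> uv; elim: uv a => {u v} [u v [t tr [-> ut]]|u|u x v _ IH1 _ IH2] a Sa av.
- have lt : (len (word_prod a * t) < len (word_prod a))%N by rewrite av reflK.
  have [c [x [d [aE pE]]]] := strong_exchange Sa tr lt.
  have sa : subseq (c ++ d) a.
    by rewrite aE; apply: cat_subseq => //; apply: subseq_cons.
  have [b [bs bp sb]] := exists_reduced (word_in_subseq sa Sa).
  exists b; rewrite bp -pE av reflK // in sb *; split=> //.
  exact: subseq_trans sa.
- by rewrite -av; apply: exists_reduced.
- have [b [ba bx _]] := IH2 _ Sa av.
  have [c [cb cu cs]] := IH1 _ (word_in_subseq ba Sa) bx.
  by exists c; split=> //; apply: subseq_trans ba.
Qed.

(** For simple s and t this is the standard parabolic subgroup that they generate. The case s = t is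
    allowed, and excluded where the rank matters ([dihedral_top_same]). *)
Definition dih (s t w : W) : Prop :=
  exists a, word_in [set s; t] a /\ word_prod a = w.

Lemma dih1 s t : dih s t 1.
Proof. by exists [::]; rewrite word_prod_nil; split. Qed.

Lemma dihC s t w : dih s t w -> dih t s w.
Proof. by move=> [a [ha aw]]; exists a; split=> // x /ha [] /= ->; [right|left]. Qed.

Lemma dih_mull s t w : dih s t w -> dih s t (s * w).
Proof.
move=> [a [ha aw]]; exists (s :: a); rewrite word_prod_cons aw; split=> //.
by apply/word_in_cons; split=> //; left.
Qed.

Lemma dih_mulr s t w : dih s t w -> dih s t (t * w).
Proof. by move=> /dihC/dih_mull/dihC. Qed.

Lemma dihS s t a : S s -> S t -> word_in [set s; t] a -> word_in S a.
Proof. by move=> Ss St ha x /ha [] /= ->. Qed.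

Lemma dih_reduced s t w : S s -> S t -> dih s t w ->
  exists a, [/\ word_in [set s; t] a, word_prod a = w & size a = len w].
Proof.
move=> Ss St [a [ha aw]]; have [b [ba bp bs]] := exists_reduced (dihS Ss St ha).
by exists b; rewrite bp bs aw; split=> //; apply: word_in_subseq ha.
Qed.

Lemma dih_down s t u v : S s -> S t -> u <=b v -> dih s t v -> dih s t u.
Proof.
move=> Ss St uv [a [ha av]].
have [b [ba bu _]] := subword uv (dihS Ss St ha) av.
by exists b; split=> //; apply: word_in_subseq ha.
Qed.

Lemma dih_simple s t p : S s -> S t -> S p -> dih s t p -> p = s \/ p = t.
Proof.
move=> Ss St Sp /(dih_reduced Ss St)[a [ha ap]]; rewrite len_simple //.
case: a ha ap => [|x [|//]] ha; first by [].
rewrite word_prod_cons word_prod_nil mulg1 => <- _.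
by apply: ha; rewrite inE eqxx.
Qed.

Lemma desc_mulr (x p c : W) : S x -> S p -> (len (c * p) < len c)%N ->
  (len (x * (c * p)) < len (c * p))%N -> (len (x * c) < len c)%N.
Proof.
move=> Sx Sp h1 h2; have := len_mulSr (x * c) Sp; rewrite -mulwA; lia.
Qed.

Lemma desc_mull (x p c : W) : S x -> S p -> (len (p * c) < len c)%N ->
  (len (p * c * x) < len (p * c))%N -> (len (c * x) < len c)%N.
Proof.
move=> Sx Sp h1 h2; have := len_mulS (c * x) Sp; rewrite mulwA; lia.
Qed.

Lemma len_descr s w : S s -> (len (w * s) < len w)%N -> len w = (len (w * s)).+1.
Proof. by move=> /(@len_mulSr C s w) [->|//]; lia. Qed.

Lemma exists_right_descent w : w <> 1 -> exists2 s, S s & (len (w * s) < len w)%N.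
Proof.
move=> w1; have [|s Ss sw] := @exists_left_descent C w^-1.
  by move=> e; apply: w1; rewrite -[w]invgK e invg1.
by exists s => //; rewrite len_mulr_inv // -(lenV w).
Qed.

Lemma bruhat_descr s w : S s -> (len (w * s) < len w)%N -> w * s <=b w.
Proof.
move=> Ss sw; rewrite -{2}(simpleKr w Ss); apply: bruhat_mulr.
  exact: refl_simple.
by rewrite simpleKr.
Qed.

(** The two equations show that s c1 and t c2 satisfy the same hypotheses with s and t exchanged,
    unique descents included; so the first letters of c1 and c2 alternate between s and t all the
    way down. *)
Lemma twin_dih n s t p p' c1 c2 : S s -> S t -> S p -> S p' ->
  len c1 = n -> len c2 = n -> c1 * p = t * c2 -> c2 * p' = s * c1 ->
  (forall x, S x -> (len (x * c1) < len c1)%N -> x = s) ->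
  (forall x, S x -> (len (x * c2) < len c2)%N -> x = t) ->
  (forall x, S x -> (len (c1 * x) < len c1)%N -> x = p) ->
  (forall x, S x -> (len (c2 * x) < len c2)%N -> x = p') ->
  dih s t c1 /\ dih s t c2.
Proof.
elim: n s t c1 c2 => [|n IH] s t c1 c2 Ss St Sp Sp' l1 l2 e1 e2 L1 L2 R1 R2.
  by rewrite (len0 l1) (len0 l2); split; apply: dih1.
have n1 : c1 <> 1 by move=> e; move: l1; rewrite e len1.
have n2 : c2 <> 1 by move=> e; move: l2; rewrite e len1.
have s1 : (len (s * c1) < len c1)%N.
  by have [x Sx hx] := exists_left_descent n1; rewrite -(L1 x Sx hx).
have t2 : (len (t * c2) < len c2)%N.
  by have [x Sx hx] := exists_left_descent n2; rewrite -(L2 x Sx hx).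
have p1 : (len (c1 * p) < len c1)%N.
  by have [x Sx hx] := exists_right_descent n1; rewrite -(R1 x Sx hx).
have p2 : (len (c2 * p') < len c2)%N.
  by have [x Sx hx] := exists_right_descent n2; rewrite -(R2 x Sx hx).
have [||||||||h1 h2] := IH t s (s * c1) (t * c2) St Ss Sp Sp'.
- by have := len_desc Ss s1; lia.
- by have := len_desc St t2; lia.
- by rewrite -mulwA e1.
- by rewrite -mulwA e2.
- by move=> x Sx; rewrite -e2 => h; apply: L2 => //; apply: desc_mulr h.
- by move=> x Sx; rewrite -e1 => h; apply: L1 => //; apply: desc_mulr h.
- by move=> x Sx h; apply: R1 => //; apply: desc_mull h.
- by move=> x Sx h; apply: R2 => //; apply: desc_mull h.
by split; [rewrite -(simpleK c1 Ss)|rewrite -(simpleK c2 St)];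
  [apply: dih_mull | apply: dih_mulr]; apply: dihC.
Qed.

(* Two distinct elements with the same coatoms have disjoint descent sets, which
   forces each set to be a singleton and the two elements to be intertwined. *)
Lemma same_coatoms_dih c1 c2 : c1 <> c2 -> len c1 = len c2 ->
  (forall z, len c1 = (len z).+1 -> (z <=b c1 <-> z <=b c2)) ->
  exists s t, [/\ S s, S t, dih s t c1 & dih s t c2].
Proof.
move=> ne e co.
have n1 : c1 <> 1.
  by move=> h; apply: ne; move: e; rewrite h len1 => /esym/len0.
have n2 : c2 <> 1.
  by move=> h; apply: ne; move: e; rewrite h len1 => /len0.
have co' z : len c1 = (len z).+1 -> z <=b c1 -> z <=b c2 by move=> /co[].
have co'' z : len c1 = (len z).+1 -> z <=b c2 -> z <=b c1 by move=> /co[].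
have disjL x : S x -> (len (x * c1) < len c1)%N -> (len (x * c2) < len c2)%N -> False.
  move=> Sx h1 h2; apply/ne/bruhat_len_eq; last by rewrite e.
  rewrite -(simpleK c1 Sx); apply: lift_descl => //; apply: co'; first exact: len_desc.
  exact: bruhat_descl.
have disjR x : S x -> (len (c1 * x) < len c1)%N -> (len (c2 * x) < len c2)%N -> False.
  move=> Sx h1 h2; apply/ne/bruhat_len_eq; last by rewrite e.
  rewrite -(simpleKr c1 Sx); apply: lift_descr => //; apply: co'; first exact: len_descr.
  exact: bruhat_descr.
have E1 t p : S t -> S p -> (len (t * c2) < len c2)%N -> (len (c1 * p) < len c1)%N ->
    c1 * p = t * c2.
  move=> St Sp ht hp; have lp := len_descr Sp hp; have lt := len_desc St ht.
  apply: bruhat_len_eq; last by lia.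
  apply: lift_ascl => //; first by apply: co' => //; apply: bruhat_descr.
  rewrite len_mul_lt //; apply/negP => h; apply: (disjL t St) => //.
  exact: desc_mulr h.
have E2 t p : S t -> S p -> (len (t * c1) < len c1)%N -> (len (c2 * p) < len c2)%N ->
    c2 * p = t * c1.
  move=> St Sp ht hp; have lp := len_descr Sp hp; have lt := len_desc St ht.
  apply: bruhat_len_eq; last by lia.
  apply: lift_ascl => //; first by apply: co'' => //; [lia|apply: bruhat_descr].
  rewrite len_mul_lt //; apply/negP => h; apply: (disjL t St) => //.
  exact: desc_mulr h.
have [s Ss s1] := exists_left_descent n1; have [t St t2] := exists_left_descent n2.
have [p Sp p1] := exists_right_descent n1; have [p' Sp' p2] := exists_right_descent n2.
have [||||||||h1 h2] := @twin_dih (len c1) s t p p' c1 c2 Ss St Sp Sp'.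
- by [].
- by [].
- exact: E1.
- exact: E2.
- by move=> x Sx hx; apply: (mulIg c1); rewrite -(E2 s p') // -(E2 x p').
- by move=> x Sx hx; apply: (mulIg c2); rewrite -(E1 t p) // -(E1 x p).
- by move=> x Sx hx; apply: (mulgI c1); rewrite (E1 t p) // (E1 t x).
- by move=> x Sx hx; apply: (mulgI c2); rewrite (E2 s p') // (E2 s x).
by exists s, t.
Qed.

(** If a and b were the only coatoms, thinness would put every element two levels below w under
    both. Then a and b have the same coatoms and lie in one dihedral parabolic subgroup, which also
    contains w = r(rw) for a left descent r, since r and rw lie below coatoms. *)
Lemma third_coatom w c1 c2 : (1 < len w)%N ->
  (forall s t, S s -> S t -> ~ dih s t w) ->
  exists c, [/\ c <=b w, len w = (len c).+1, c <> c1 & c <> c2].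
Proof.
move=> w2 nd; apply: contrapT => no.
have w1 : w <> 1 by move=> e; move: w2; rewrite e len1.
have [y0 [_ y0w ly0]] := exists_coatom (bruhat1 w) (nesym w1).
have [z0 [_ z0y lz0]] : exists z, [/\ 1 <=b z, z <=b y0 & len y0 = (len z).+1].
  by apply: exists_coatom; [apply: bruhat1|move=> e; move: ly0; rewrite -e len1; lia].
have [|a [b [[nab _ aw _ bw] [la lb]]]] := bruhat_thin (bruhat_trans z0y y0w).
  by rewrite ly0 lz0.
have {la} la : len w = (len a).+1 by rewrite ly0 lz0 la.
have {lb} lb : len w = (len b).+1 by rewrite ly0 lz0 lb.
have only c : c <=b w -> len w = (len c).+1 -> c = a \/ c = b.
  move=> cw lc; apply: contrapT => /not_orP[ca cb].
  apply: no; have [/eqP e1|n1] := boolP (a == c1 :> W); last first.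
    have [/eqP e2|n2] := boolP (a == c2 :> W); last first.
      by exists a; split=> //; apply/eqP.
    have [/eqP e3|n3] := boolP (b == c1 :> W).
      by exists c; split=> //; rewrite -?e2 -?e3.
    by exists b; split=> //; [apply/eqP|rewrite -e2 => /esym].
  have [/eqP e3|n3] := boolP (b == c2 :> W).
    by exists c; split=> //; rewrite -?e1 -?e3.
  by exists b; split=> //; [rewrite -e1 => /esym|apply/eqP].
have both z : z <=b w -> len w = (len z).+2 -> z <=b a /\ z <=b b.
  move=> zw lz; have [a' [b' [[nab' za aw' zb bw'] [la' lb']]]] := bruhat_thin zw lz.
  have ha : a' = a \/ a' = b by apply: only => //; rewrite la'.
  have hb : b' = a \/ b' = b by apply: only => //; rewrite lb'.
  case: ha nab' za => ->; case: hb zb => -> //.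
have [||s [t [Ss St das dbs]]] := @same_coatoms_dih a b nab.
- by move: la; rewrite lb => -[].
- move=> z lz; split=> za.
    by have [] := both z (bruhat_trans za aw); rewrite ?la ?lz.
  by have [] := both z (bruhat_trans za bw); rewrite ?la ?lz.
have [r Sr rw] := exists_left_descent w1.
have rb : r <=b w by rewrite -[r]mulg1; apply: lift_descl => //; apply: bruhat1.
have rnw : r <> w by move=> e; move: w2; rewrite -e len_simple.
have drt x : x = a \/ x = b -> dih s t x by case=> ->.
have [x [rx xw lx]] := exists_coatom rb rnw.
have rst : r = s \/ r = t.
  by apply: dih_simple => //; apply: dih_down rx _ => //; apply/drt/only.
apply: (nd s t) => //; rewrite -(simpleK w Sr).
have : dih s t (r * w).
  by apply/drt/only; [apply: bruhat_descl|apply: len_desc].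
by case: rst => ->; [apply: dih_mull|apply: dih_mulr].
Qed.

End Subwords.

(** * Reflection subgroups and the geometric representation *)

Section ReflectionSubgroups.
Variable C : coxSystem.
Local Notation W := (cx_group C).
Local Notation S := (@cx_gens C).
Local Notation len := (length S).
Implicit Types s t u w x y : W.
Local Notation refl := (reflection S).
Local Notation "u <=b v" := (bruhat_le S u v) (at level 70).

Definition conj_closed (D : set W) : Prop :=
  forall t u, D t -> D u -> D (u * t * u).

(* Dyer's canonical generators of the subgroup generated by D. *)
Definition canonical (D : set W) : set W :=
  [set t | D t /\ forall u, D u -> inversion t u -> u = t].

(** Induction on the conjugator w = r w'. If r is in D, it is a canonical generator and conjugation
    by r stays inside D. Otherwise conjugation by r carries D to D', and canonical generators of D'
    back to those of D, because r is the only inversion of r. The parity of the number of factors is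
    kept for [odd_word_refl]. *)
Lemma canonical_generate n (w s : W) (D : set W) :
  S s -> D `<=` refl -> conj_closed D -> (len w <= n)%N -> D (w * s * w^-1) ->
  exists a, [/\ word_in (canonical D) a, odd (size a) & word_prod a = w * s * w^-1].
Proof.
elim: n w D => [|n IH] w D Ss Dr Dc.
  rewrite leqn0 => /eqP/len0->; rewrite mul1g invg1 mulg1 => Ds.
  exists [:: s]; rewrite word_prod_cons word_prod_nil mulg1; split=> // x.
  rewrite inE => /eqP->; split=> // u Du; rewrite inversionS // => /eqP //.
have [->|/eqP w1] := eqVneq w 1; first by move=> _; apply: IH; rewrite ?len1.
have [r Sr rw] := exists_left_descent w1; have lw := len_desc Sr rw => wn Dt.
set w' := r * w in rw lw; have wE : w = r * w' by rewrite simpleK.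
have tE : w * s * w^-1 = r * (w' * s * w'^-1) * r.
  by rewrite wE invwM (simpleV Sr) !mulwA.
have w'n : (len w' <= n)%N by rewrite -ltnS -lw.
have [Dr'|nDr] := pselect (D r).
  have cr : canonical D r.
    by split=> // u Du; rewrite inversionS // => /eqP.
  have [|a [aD oa aE]] := IH w' D Ss Dr Dc w'n.
    have := Dc _ _ Dt Dr'; rewrite tE !mulwA simple_sqr // mul1g.
    by rewrite -!mulwA simple_sqr // mulg1 !mulwA.
  exists (r :: rcons a r); rewrite tE -aE; split.
  - apply/word_in_cons; split=> //; rewrite -cats1; apply/word_in_cat; split=> //.
    by move=> x; rewrite inE => /eqP->.
  - by rewrite /= size_rcons /= negbK.
  - by rewrite word_prod_cons -cats1 word_prod_cat word_prod_cons word_prod_nil mulg1 mulwA.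
pose D' := [set u | D (r * u * r)].
have conjK u : r * (r * u * r) * r = u.
  by rewrite !mulwA simple_sqr // mul1g simpleKr.
have conjM u v x : r * (u * v * x) * r = (r * u * r) * (r * v * r) * (r * x * r).
  by rewrite !mulwA !simpleKr.
have D'r : D' `<=` refl.
  move=> u /Dr; have := @refl_conj C r (r * u * r).
  by rewrite (simpleV Sr) conjK.
have D'c : conj_closed D' by move=> t u tD uD; rewrite /D' /= conjM; apply: Dc.
have canD u : canonical D' u -> canonical D (r * u * r).
  move=> [Du uc]; split=> // x Dx; rewrite -mulwA inversionM inversionM.
  have rV : (r : W)^-1 = r by apply: simpleV.
  have -> : u * r * x * (u * r)^-1 = u * (r * x * r) * u^-1.
    by rewrite invwM rV !mulwA.
  rewrite !(inversionS _ Sr) rV.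
  have -> : (x == r) = false by apply/eqP => xr; apply: nDr; rewrite -xr.
  have D'x : D' (r * x * r) by rewrite /D' /= conjK.
  have uV : u^-1 = u by apply/reflV/D'r.
  rewrite /=; case: eqP => [uxr|_].
    case: nDr; have := D'c _ _ D'x Du; rewrite uV in uxr.
    by rewrite uxr /D' /= simple_sqr // mul1g.
  by rewrite addbF => /(uc _ D'x) <-; rewrite [RHS]mulwA conjK.
have [|a [aD oa aE]] := IH w' D' Ss D'r D'c w'n; first by rewrite /D' /= -tE.
exists [seq r * x * r | x <- a]; split.
- by move=> _ /mapP[x xa ->]; apply/canD/aD.
- by rewrite size_map.
rewrite tE -aE; elim: a {aD oa aE} => [|x a IHa] /=.
  by rewrite !word_prod_nil mulg1 simple_sqr.
by rewrite !word_prod_cons IHa !mulwA simpleKr.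
Qed.

(* Such a product is a conjugate of p or of q. *)
Lemma odd_word_refl (p q : W) a : refl p -> refl q -> word_in [set p; q] a ->
  odd (size a) -> refl (word_prod a).
Proof.
move=> pr qr; have pp := refl_sqr pr; have qq := refl_sqr qr.
pose od (z : W) := exists k, z = (p * q) ^+ k * p \/ z = (q * p) ^+ k * q.
pose ev (z : W) := exists k, z = (p * q) ^+ k \/ z = (q * p) ^+ k.
have shift (x y : W) k : x * (y * x) ^+ k = (x * y) ^+ k * x.
  by elim: k => [|k IH]; [rewrite !expg0 mulg1 mul1g|rewrite expgSr mulwA IH expgSr !mulwA].
have evod (x y : W) k : x * x = 1 -> x * (x * y) ^+ k.+1 = (y * x) ^+ k * y.
  by move=> xx; rewrite expgS !mulwA xx mul1g shift.
have odev (x y : W) k : x * x = 1 -> x * ((x * y) ^+ k.+1 * x) = (y * x) ^+ k.+1.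
  by move=> xx; rewrite mulwA evod // expgSr !mulwA.
have odod k : refl ((p * q) ^+ k * p) /\ refl ((q * p) ^+ k * q).
  elim: k => [|k [h1 h2]]; first by rewrite !expg0 !mul1g.
  split.
    by have := refl_conj p h2; rewrite (reflV pr) mulwA shift expgSr !mulwA.
  by have := refl_conj q h1; rewrite (reflV qr) mulwA shift expgSr !mulwA.
have pe z : ev z -> od (p * z).
  move=> [[|k] [->|->]]; try by exists 0%N; left; rewrite !expg0 mulg1 mul1g.
    by exists k; right; rewrite evod.
  by exists k.+1; left; rewrite shift.
have qe z : ev z -> od (q * z).
  move=> [[|k] [->|->]]; try by exists 0%N; right; rewrite !expg0 mulg1 mul1g.
    by exists k.+1; right; rewrite shift.
  by exists k; left; rewrite evod.
have po z : od z -> ev (p * z).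
  move=> [[|k] [->|->]].
  - by exists 0%N; left; rewrite expg0 mul1g pp.
  - by exists 1%N; left; rewrite expg0 mul1g expg1.
  - by exists k.+1; right; rewrite odev.
  - by exists k.+2; left; rewrite mulwA shift [RHS]expgSr !mulwA.
have qo z : od z -> ev (q * z).
  move=> [[|k] [->|->]].
  - by exists 1%N; right; rewrite expg0 mul1g expg1.
  - by exists 0%N; left; rewrite expg0 mul1g qq.
  - by exists k.+2; right; rewrite mulwA shift [RHS]expgSr !mulwA.
  - by exists k.+1; left; rewrite odev.
suff H : word_in [set p; q] a -> if odd (size a) then od (word_prod a) else ev (word_prod a).
  by move=> /H; case: ifP => // _ [k [->|->]] _; have [] := odod k.
elim: a => [_|x a IH]; first by exists 0%N; left; rewrite word_prod_nil.
move=> /word_in_cons[xpq /IH]; rewrite word_prod_cons /=.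
by case: (odd _) => /= h; case: xpq => ->; auto.
Qed.

End ReflectionSubgroups.

(** * A geometric representation over the rationals *)

Section Geometry.
Variable C : coxSystem.
Local Notation W := (cx_group C).
Local Notation S := (@cx_gens C).
Local Notation len := (length S).
Implicit Types s t u w : W.
Local Notation refl := (reflection S).
Local Notation "u <=b v" := (bruhat_le S u v) (at level 70).
Variable m : W -> W -> option nat.
Hypotheses (hm : coxeter_system S m) (dl : doubly_laced S m).

(* A generalized Cartan matrix; for m(s,t) = 4 the choice operator decides which
   of A(s,t), A(t,s) is -1 and which is -2. *)
Definition cartan (s t : W) : rat :=
  if s == t then 2%R else
  match m s t with
  | Some 3 => (-1)%R
  | Some 4 => if choose (pred2 s t) s == s then (-1)%R else (-2)%R
  | _ => 0%R
  end.

Lemma cartan_pair s t : S s -> S t -> s <> t ->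
  exists n, [/\ m s t = Some n, (2 <= n <= 4)%N &
    let a := cartan s t in let b := cartan t s in
    [\/ [/\ n = 2%N, a = 0%R & b = 0%R], [/\ n = 3%N, a = (-1)%R & b = (-1)%R],
        [/\ n = 4%N, a = (-1)%R & b = (-2)%R] | [/\ n = 4%N, a = (-2)%R & b = (-1)%R]]].
Proof.
move=> Ss St st; have [[_ msym mge] _ _] := hm.
have [n mst n4] := dl Ss St; have n2 := mge _ _ _ Ss St st mst.
exists n; split=> //; first by rewrite n2.
have st' : (s == t) = false by apply/eqP.
have ts' : (t == s) = false by rewrite eq_sym.
rewrite /cartan st' ts' -(msym _ _ Ss St) mst.
have ch : choose (pred2 t s) t = choose (pred2 s t) s.
  rewrite (@choose_id _ (pred2 t s) t s) /= ?eqxx ?orbT //.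
  by apply: eq_choose => x /=; rewrite orbC.
have := @chooseP _ (pred2 s t) s; rewrite ch /= eqxx => /(_ isT).
case: n n2 n4 {mst} => [|[|[|[|[|//]]]]] // _ _.
- by constructor 1.
- by constructor 2.
move=> /orP[/eqP->|/eqP->]; rewrite eqxx ?st' ?ts'.
- by constructor 3.
- by constructor 4.
Qed.

Local Notation V := (W * bool -> rat).
(** The coordinates of a vector are its pairings with the simple roots ([true]) and its formal
    coefficients on the simple coroots ([false]). The second family keeps the simple coroots
    independent even if the Cartan matrix is singular. *)
Definition coroot (s : W) : V :=
  fun k => if k.2 then cartan s k.1 else ((k.1 == s)%:R)%R.

Definition simple_act (s : W) (v : V) : V :=
  fun k => (v k - v (s, true) * coroot s k)%R.

Definition comb (v : V) (s t : W) (p q : rat) : V :=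
  fun k => (v k + p * coroot s k + q * coroot t k)%R.

Lemma corootss s : coroot s (s, true) = 2%R.
Proof. by rewrite /coroot /= /cartan eqxx. Qed.

Lemma simple_act_combl v s t p q : simple_act s (comb v s t p q) =
  comb v s t (- p - v (s, true) - q * cartan t s)%R q.
Proof.
apply/funext => k; rewrite /simple_act /comb corootss.
rewrite [coroot t (s, true)]/coroot /=; ring.
Qed.

Lemma simple_act_combr v s t p q : simple_act t (comb v s t p q) =
  comb v s t p (- q - v (t, true) - p * cartan s t)%R.
Proof.
apply/funext => k; rewrite /simple_act /comb corootss.
rewrite [coroot s (t, true)]/coroot /=; ring.
Qed.

(** s and t move v only inside v plus the span of their two coroots, so each relation becomes a
    computation with two coefficients. *)
Lemma simple_act_rel s t n : S s -> S t -> m s t = Some n ->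
  forall v, iter n (simple_act s \o simple_act t) v = v.
Proof.
move=> Ss St mst v.
have vE : v = comb v s t 0 0 by apply/funext => k; rewrite /comb; ring.
have [st|/eqP st] := eqVneq s t.
  have [[mss _ _] _ _] := hm; move: mst; rewrite -st mss // => -[<-] /=.
  apply/funext => k; rewrite /simple_act corootss; ring.
have [n' [mst' _]] := cartan_pair Ss St st.
have -> : n' = n by move: mst'; rewrite mst => -[].
case=> -[-> ea eb]; rewrite [in LHS]vE /= !(simple_act_combl, simple_act_combr) ea eb;
  by apply/funext => k; rewrite /comb; ring.
Qed.

Lemma geom_exists : exists F : W -> V -> V,
  (forall v, F 1 v = v) /\ (forall s w v, S s -> F (s * w) v = simple_act s (F w v)).
Proof. exact: (coxeter_action hm simple_act_rel). Qed.

Definition geom : W -> V -> V := sval (cid geom_exists).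

Lemma geom1 v : geom 1 v = v.
Proof. by rewrite /geom; case: cid => F [/= h _]; apply: h. Qed.

Lemma geomS s w v : S s -> geom (s * w) v = simple_act s (geom w v).
Proof. by rewrite /geom; case: cid => F [/= _ h]; apply: h. Qed.

Lemma geom_simple s v : S s -> geom s v = simple_act s v.
Proof. by move=> Ss; rewrite -{1}[s]mulg1 geomS // geom1. Qed.

Lemma geomM u w v : geom (u * w) v = geom u (geom w v).
Proof.
elim/word_ind: u => [|s u Ss IH]; first by rewrite mul1g geom1.
by rewrite -mulwA geomS // IH geomS.
Qed.

Lemma geomK u v : geom u^-1 (geom u v) = v.
Proof. by rewrite -geomM mulVg geom1. Qed.

Lemma geomVK u v : geom u (geom u^-1 v) = v.
Proof. by rewrite -geomM mulgV geom1. Qed.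

Lemma geom_lin w (a : rat) (x y : V) k :
  geom w (fun k => x k + a * y k)%R k = (geom w x k + a * geom w y k)%R.
Proof.
elim/word_ind: w k => [|s w Ss IH] k; first by rewrite !geom1.
by rewrite !geomS // /simple_act !IH; ring.
Qed.

Lemma geom_scale w (a : rat) (x : V) k :
  geom w (fun k => a * x k)%R k = (a * geom w x k)%R.
Proof.
elim/word_ind: w k => [|s w Ss IH] k; first by rewrite !geom1.
by rewrite !geomS // /simple_act !IH; ring.
Qed.

Definition rho : V := fun k => if k.2 then 1%R else 0%R.

(** Positivity on both sides: of the root obtained by applying w to the simple root of s, tested at
    [rho], and of the corresponding coroot, read off its coefficients. The first detects inversions
    ([froot_sign]), the second separates reflections ([vroot_inj]). *)
Definition posroot (w s : W) : Prop :=
  (0 < geom w^-1 rho (s, true))%R /\ forall u, (0 <= geom w (coroot s) (u, false))%R.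

(** As the Cartan matrix is not symmetric, coroot and root have separate coefficients: p, q for the
    coroot and p', q' for the root. *)
Lemma posroot_comb w s t u (p q p' q' : rat) :
  geom u (coroot s) = comb (fun=> 0%R) s t p q ->
  (forall y, geom u^-1 y (s, true) = p' * y (s, true) + q' * y (t, true))%R ->
  (0 <= p)%R -> (0 <= q)%R -> (0 <= p')%R -> (0 <= q')%R -> (0 < p' + q')%R ->
  posroot w s -> posroot w t -> posroot (w * u) s.
Proof.
move=> e1 e2 p0 q0 p0' q0' pq0 [s1 s2] [t1 t2]; split.
  rewrite invwM geomM e2.
  have A := mulr_ge0 p0' (ltW s1); have B := mulr_ge0 q0' (ltW t1).
  have [p1|p1] := ltP 0%R p'; first by have := mulr_gt0 p1 s1; lra.
  have q1 : (0 < q')%R by lra.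
  by have := mulr_gt0 q1 t1; lra.
move=> x; rewrite geomM e1 /comb.
have -> : geom w (fun k => 0 + p * coroot s k + q * coroot t k)%R (x, false) =
    (p * geom w (coroot s) (x, false) + q * geom w (coroot t) (x, false))%R.
  by rewrite geom_lin; congr (_ + _)%R; under eq_fun do rewrite add0r; rewrite geom_scale.
by apply: addr_ge0; apply: mulr_ge0.
Qed.

Lemma len_mulr_le s w : S s -> (len (w * s) <= (len w).+1)%N.
Proof. by move=> Ss; have := len_mulSr w Ss; lia. Qed.

Lemma braid_half s t n (x y : W) : S s -> S t -> (s * t) ^+ n = 1 ->
  (s * t) ^+ n = x * y -> x = y^-1.
Proof. by move=> Ss St -> /esym/mulg1_eq; move=> <-; rewrite invgK. Qed.

Lemma coroot_comb s t : coroot s = comb (fun=> 0%R) s t 1 0.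
Proof. by apply/funext => k; rewrite /comb; ring. Qed.

(** Letters t, s, t are stripped from the right end of w until neither s nor t is a right descent of
    the rest. As m(s,t) <= 4 and ws > w, the stripped part is t, st or tst. It sends the root of s
    to a nonnegative combination of the roots of s and t, and these stay positive under the rest by
    induction. *)
Lemma geom_positive n w s : S s -> (len w <= n)%N ->
  (len w < len (w * s))%N -> posroot w s.
Proof.
elim: n w s => [|n IH] w s Ss.
  rewrite leqn0 => /eqP/len0-> _; split; first by rewrite invg1 geom1 /rho.
  by move=> u; rewrite geom1 /coroot /=; case: eqP.
have [->|/eqP w1] := eqVneq w 1.
  by move=> _ _; split; [rewrite invg1 geom1 /rho|move=> u; rewrite geom1 /coroot /=; case: eqP].
move=> wn ws; have [t St wt] := exists_right_descent w1.
have st : s <> t by move=> e; move: ws; rewrite e ltnNge (ltnW wt).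
have [N [mst _ cases]] := cartan_pair Ss St st.
have rel := coxeter_rel hm Ss St mst.
have IHv v : (len v <= n)%N -> (len v < len (v * s))%N ->
    (len v < len (v * t))%N -> posroot v s /\ posroot v t.
  by move=> vn vs vt; split; apply: IH.
have lt_of (v x : W) : S x -> ~~ (len (v * x) < len v)%N -> (len v < len (v * x))%N.
  by move=> Sx; have := len_mulSr v Sx; lia.
have act1 y : geom t^-1 y (s, true) = (1 * y (s, true) + - cartan t s * y (t, true))%R.
  by rewrite (simpleV St) geom_simple // /simple_act /coroot /=; ring.
have e1 : geom t (coroot s) = comb (fun=> 0%R) s t 1 (- cartan s t).
  rewrite geom_simple // (coroot_comb s t) simple_act_combr.
  by apply/funext => k; rewrite /comb; ring.
have sg : (cartan s t <= 0)%R /\ (cartan t s <= 0)%R.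
  by case: cases => -[_ -> ->]; split; lra.
have lw1 := len_descr St wt; set w2 := w * t in wt lw1.
have wE1 : w = w2 * t by rewrite /w2 simpleKr.
have [h1|h1] := boolP (len (w2 * s) < len w2)%N; last first.
  rewrite wE1; have [|||p1 p2] := IHv w2; [lia|exact: lt_of|by rewrite -wE1; lia|].
  by apply: (posroot_comb e1 act1) => //; lra.
have lw2 := len_descr Ss h1; set w3 := w2 * s in h1 lw2.
have wE2 : w = w3 * (s * t) by rewrite mulwA /w3 simpleKr.
have w3s : (len w3 < len (w3 * s))%N by rewrite /w3 simpleKr //; lia.
have [n2|n2] := eqVneq N 2%N.
  have stts : s * t = t * s.
    have h := @braid_half s t N (s * t) (s * t) Ss St rel.
    by rewrite h ?n2 ?expg2 // invwM !simpleV.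
  have wsE : w * s = w3 * t by rewrite wE2 stts -!mulwA simple_sqr // mulg1.
  by have := len_mulr_le w3 St; rewrite -wsE; lia.
have act2 y : geom (s * t)^-1 y (s, true) =
    ((cartan s t * cartan t s - 1) * y (s, true) + - cartan t s * y (t, true))%R.
  rewrite invwM geomM (simpleV St) (simpleV Ss) !geom_simple // /simple_act.
  by rewrite !corootss /coroot /=; ring.
have e2 : geom (s * t) (coroot s) =
    comb (fun=> 0%R) s t (cartan s t * cartan t s - 1)%R (- cartan s t)%R.
  rewrite geomM e1 geom_simple // simple_act_combl.
  by apply/funext => k; rewrite /comb; ring.
have [h2|h2] := boolP (len (w3 * t) < len w3)%N; last first.
  rewrite wE2; have [|||p1 p2] := IHv w3; [lia|done|exact: lt_of|].
  by case: cases n2 => -[-> ea eb] // _; apply: (posroot_comb e2 act2) => //;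
    rewrite ?ea ?eb; lra.
have lw3 := len_descr St h2; set w4 := w3 * t in h2 lw3.
have wE3 : w = w4 * (t * s * t).
  by rewrite wE2 /w4 !mulwA simpleKr.
have w4t : (len w4 < len (w4 * t))%N by rewrite /w4 simpleKr //; lia.
have [n3|n3] := eqVneq N 3%N.
  have h : t * s * t = s * t * s.
    rewrite (@braid_half s t N (s * t * s) (t * s * t) Ss St rel).
      by rewrite !invwM !simpleV // mulwA.
    by rewrite n3 !expgS expg0 mulg1 !mulwA.
  have wsE : w * s = w4 * s * t by rewrite wE3 h !mulwA simpleKr.
  by have := len_mulr_le (w4 * s) St; have := len_mulr_le w4 Ss; rewrite -wsE; lia.
have n4 : N = 4%N by case: cases n2 n3 => -[-> _ _].
have [h3|h3] := boolP (len (w4 * s) < len w4)%N.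
  have lw4 := len_descr Ss h3; set w5 := w4 * s in h3 lw4.
  have h : s * t * (s * t) = t * s * (t * s).
    rewrite {1}(@braid_half s t N (s * t * (s * t)) (s * t * (s * t)) Ss St rel).
      by rewrite !invwM !simpleV.
    by rewrite n4 !expgS expg0 mulg1 !mulwA.
  have wsE : w * s = w5 * t * s * t.
    transitivity (w5 * (s * t * (s * t)) * s); last by rewrite h !mulwA simpleKr.
    by rewrite wE3 /w5 !mulwA simpleKr.
  have := len_mulr_le (w5 * t * s) St; have := len_mulr_le (w5 * t) Ss.
  by have := len_mulr_le w5 St; rewrite -wsE; lia.
have ab2 : (cartan s t * cartan t s = 2)%R.
  by case: cases n2 n3 => -[-> ea eb] // _ _; rewrite ea eb; ring.
have act3 y : geom (t * s * t)^-1 y (s, true) = (1 * y (s, true) + 0 * y (t, true))%R.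
  have -> : (t * s * t)^-1 = (s * t)^-1 * t by rewrite !invwM !simpleV // mulwA.
  rewrite geomM act2 geom_simple // /simple_act corootss /coroot /= ab2.
  have -> : (- cartan t s * (y (t, true) - y (t, true) * 2) = cartan t s * y (t, true))%R.
    by ring.
  by ring.
have e3 : geom (t * s * t) (coroot s) = comb (fun=> 0%R) s t 1 0.
  rewrite -mulwA geomM e2 geom_simple // simple_act_combr ab2.
  apply/funext => k; rewrite /comb.
  have -> : (- - cartan s t - 0 - (2 - 1) * cartan s t = 0)%R by ring.
  by ring.
rewrite wE3; have [|||p1 p2] := IHv w4; [lia|exact: lt_of|done|].
by apply: (posroot_comb e3 act3) => //; lra.
Qed.

End Geometry.

(** * Roots of reflections and planes of roots *)

Section Planes.
Variable C : coxSystem.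
Local Notation W := (cx_group C).
Local Notation S := (@cx_gens C).
Local Notation len := (length S).
Implicit Types s t u w : W.
Local Notation refl := (reflection S).
Local Notation "u <=b v" := (bruhat_le S u v) (at level 70).
Variable m : W -> W -> option nat.
Hypotheses (hm : coxeter_system S m) (dl : doubly_laced S m).
Local Notation V := (W * bool -> rat).
Local Notation coroot := (coroot m).
Local Notation geom := (geom hm dl).

Lemma refl_rep t : refl t -> exists p : W * W,
  [/\ S p.2, t = p.1 * p.2 * p.1^-1 & (len p.1 < len (p.1 * p.2))%N].
Proof.
move=> [w [s [Ss tE]]]; have [lt|ge] := boolP (len w < len (w * s))%N.
  by exists (w, s).
exists (w * s, s); split=> //=.
  by rewrite tE invwM (simpleV Ss) !mulwA !simpleKr.
by rewrite simpleKr //; have := len_mulSr w Ss; lia.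
Qed.

(** Among the expressions w s w^-1 of t one with ws > w is chosen, so that [froot t], the root of t
    as a linear form, and [vroot t], its coroot, are the positive ones. *)
Definition base t : W * W := xget (1, 1) [set p : W * W |
  [/\ S p.2, t = p.1 * p.2 * p.1^-1 & (len p.1 < len (p.1 * p.2))%N]].

Lemma baseP t : refl t -> [/\ S (base t).2, t = (base t).1 * (base t).2 * (base t).1^-1 &
  (len (base t).1 < len ((base t).1 * (base t).2))%N].
Proof. by move=> /refl_rep h; have := xgetPex (1, 1) h. Qed.

Definition froot t (v : V) : rat := geom (base t).1^-1 v ((base t).2, true).
Definition vroot t : V := geom (base t).1 (coroot (base t).2).

Lemma geom_refl t v k : refl t -> geom t v k = (v k - froot t v * vroot t k)%R.
Proof.
move=> /baseP[]; rewrite /froot /vroot; move: (base t).1 (base t).2 => w s Ss -> _.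
rewrite !geomM (geom_simple _ _ _ Ss); set x := geom w^-1 v.
have -> : simple_act m s x = (fun k => x k + (- x (s, true)) * coroot s k)%R.
  by apply/funext => j; rewrite /simple_act; ring.
by rewrite geom_lin /x geomVK; ring.
Qed.

Lemma froot_vroot t : refl t -> froot t (vroot t) = 2%R.
Proof. by move=> /baseP[Ss _ _]; rewrite /froot /vroot geomK corootss. Qed.

Lemma froot_lin t (a : rat) (x y : V) :
  froot t (fun k => x k + a * y k)%R = (froot t x + a * froot t y)%R.
Proof. by rewrite /froot geom_lin. Qed.

Lemma froot_refl t u v : refl u ->
  froot t (geom u v) = (froot t v - froot u v * froot t (vroot u))%R.
Proof.
move=> ru; have -> : geom u v = (fun k => v k + (- froot u v) * vroot u k)%R.
  by apply/funext => k; rewrite geom_refl //; ring.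
by rewrite froot_lin; ring.
Qed.

(** The quantity is the value at [rho] of the image under u of the root of t: the inversions of u
    are the reflections whose positive root u makes negative. *)
Lemma froot_sign t u : refl t ->
  if inversion u t then (froot t (geom u^-1 (@rho C)) < 0)%R
  else (0 < froot t (geom u^-1 (@rho C)))%R.
Proof.
move=> /baseP[]; rewrite /froot; move: (base t).1 (base t).2 => w s Ss -> ws.
rewrite -geomM -invwM.
have sr : refl s by apply: refl_simple.
have iE : inversion (u * w) s = inversion u (w * s * w^-1).
  by rewrite inversionM inversionP // ltnNge (ltnW ws).
rewrite -iE inversionP //; set x := u * w; case: ifP => h.
  have [] := geom_positive hm dl Ss (leqnn (len (x * s))) _.
    by rewrite simpleKr.
  move=> h1 _; move: h1.
  by rewrite invwM (simpleV Ss) geomM (geom_simple _ _ _ Ss) /simple_act corootss; lra.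
have [|h1 _] := geom_positive hm dl Ss (leqnn (len x)); last by [].
by have := len_mulSr x Ss; lia.
Qed.

Lemma vroot_sign s w u : S s ->
  if inversion w s then (geom w (coroot s) (u, false) <= 0)%R
  else (0 <= geom w (coroot s) (u, false))%R.
Proof.
move=> Ss; have sr : refl s by apply: refl_simple.
rewrite inversionP //; case: ifP => h.
  have [] := geom_positive hm dl Ss (leqnn (len (w * s))) _.
    by rewrite simpleKr.
  move=> _ /(_ u); rewrite geomM (geom_simple _ _ _ Ss).
  have -> : simple_act m s (coroot s) = (fun k => (-1) * coroot s k)%R.
    by apply/funext => k; rewrite /simple_act corootss; ring.
  by rewrite geom_scale; lra.
have [|_ h1] := geom_positive hm dl Ss (leqnn (len w)); last by [].
by have := len_mulSr w Ss; lia.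
Qed.

(** With x = w'^-1 w, the elements x and s'x send the coroot of s to opposite multiples of the
    coroot of s'. So exactly one of them inverts s, and by the cocycle rule this happens only if x s
    x^-1 = s'. *)
Lemma vroot_inj t t' c : refl t -> refl t' ->
  (forall k, vroot t k = c * vroot t' k)%R -> t = t'.
Proof.
move=> /baseP[]; rewrite /vroot; move: (base t).1 (base t).2 => w s Ss -> _.
move=> /baseP[]; move: (base t').1 (base t').2 => w' s' Ss' -> _ E.
set x := w'^-1 * w.
have Ex : geom x (coroot s) = (fun k => c * coroot s' k)%R.
  rewrite /x geomM (_ : geom w (coroot s) = fun k => c * geom w' (coroot s') k)%R.
    by apply/funext => k; rewrite geom_scale geomK.
  by apply/funext => k; apply: E.
have c0 : c != 0%R.
  apply/eqP => c0; have := geomK hm dl x (coroot s); rewrite Ex c0 => /(congr1 (@^~ (s, true))).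
  by rewrite geom_scale mul0r corootss => /eqP; rewrite eq_sym pnatr_eq0.
have Esx : geom (s' * x) (coroot s) = (fun k => (- c) * coroot s' k)%R.
  rewrite geomM Ex (geom_simple _ _ _ Ss'); apply/funext => k.
  by rewrite /simple_act corootss; ring.
have h1 := vroot_sign x s' Ss; have h2 := vroot_sign (s' * x) s' Ss.
rewrite Ex in h1; rewrite Esx in h2.
have e1 : coroot s' (s', false) = 1%R by rewrite /coroot /= eqxx.
rewrite e1 !mulr1 inversionM (inversionS _ Ss') in h1 h2.
have xs : x * s * x^-1 = s'.
  apply/eqP; move: h1 h2; case: eqP => // _; rewrite addbF.
  case: ifP => _ h1 h2; case/eqP: c0; lra.
by rewrite -xs /x invwM invgK !mulwA mulgK mulgV mul1g.
Qed.

Lemma vroot_neq0 t : refl t -> exists k, vroot t k != 0%R.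
Proof.
move=> rt; apply: contrapT => h; have := froot_vroot rt.
have -> : vroot t = (fun k => vroot t k + (-1) * vroot t k)%R.
  apply/funext => k; have [/eqP->|n0] := boolP (vroot t k == 0%R); first by ring.
  by case: h; exists k.
by rewrite froot_lin; lra.
Qed.

(** Write v - t2 t1 v in two ways. On one side it is a combination of the coroots of t1 and t2 in
    which the form of t1 is a coefficient. These coroots are independent by [vroot_inj], so Cramer's
    rule with a nonzero minor d expresses that form through those of t3 and t4. *)
Lemma planar t1 t2 t3 t4 : refl t1 -> refl t2 -> refl t3 -> refl t4 ->
  t2 * t1 = t4 * t3 -> t1 <> t2 ->
  exists p q : rat, forall v, froot t1 v = (p * froot t3 v + q * froot t4 v)%R.
Proof.
move=> r1 r2 r3 r4 E ne.
have eqk v k : (froot t1 v * vroot t1 k + froot t2 (geom t1 v) * vroot t2 k =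
   froot t3 v * vroot t3 k + (froot t4 v - froot t3 v * froot t4 (vroot t3)) * vroot t4 k)%R.
  have := congr1 (fun x => geom x v k) E.
  rewrite !geomM !(geom_refl _ _ r2) !(geom_refl _ _ r4) !(geom_refl _ _ r1) !(geom_refl _ _ r3).
  by rewrite (froot_refl t4 _ r3) => h; lra.
have [[k1 [k2 D]]|no] := pselect (exists k1 k2,
    vroot t1 k1 * vroot t2 k2 - vroot t1 k2 * vroot t2 k1 != 0)%R; last first.
  case: ne; have [k1 k1n] := vroot_neq0 r2.
  apply: (@vroot_inj _ _ (vroot t1 k1 / vroot t2 k1)%R) => // k.
  have [/eqP h|h] := boolP (vroot t1 k1 * vroot t2 k - vroot t1 k * vroot t2 k1 == 0)%R.
    by apply: (mulIf k1n); rewrite mulrAC divfK //; lra.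
  by case: no; exists k1, k.
set d := (_ - _)%R in D.
pose c3 := (vroot t3 k1 * vroot t2 k2 - vroot t3 k2 * vroot t2 k1)%R.
pose c4 := (vroot t4 k1 * vroot t2 k2 - vroot t4 k2 * vroot t2 k1)%R.
exists ((c3 - froot t4 (vroot t3) * c4) / d)%R, (c4 / d)%R => v.
have h1 := eqk v k1; have h2 := eqk v k2.
have {h1 h2} H : (froot t1 v * d = (froot t3 v * c3 +
    (froot t4 v - froot t3 v * froot t4 (vroot t3)) * c4))%R.
  rewrite /d /c3 /c4; have := congr1 (fun z => z * vroot t2 k2)%R h1.
  by have := congr1 (fun z => z * vroot t2 k1)%R h2; move=> /= a b; lra.
by apply: (mulIf D); rewrite H; field.
Qed.

Definition plane t1 t2 : set W := [set t | refl t /\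
  exists p q : rat, forall v, froot t v = (p * froot t1 v + q * froot t2 v)%R].

Lemma froot_conj t u : refl t -> refl u ->
  exists c : rat, forall v, froot (u * t * u) v = (c * froot t (geom u v))%R.
Proof.
move=> rt ru; have rc : refl (u * t * u).
  by have := refl_conj u rt; rewrite reflV.
have [k kn] := vroot_neq0 rc.
exists (geom u (vroot t) k / vroot (u * t * u) k)%R => v.
apply: (mulIf kn); rewrite mulrAC divfK //.
have := geom_refl v k rc; rewrite !geomM.
have -> : geom t (geom u v) =
    (fun k => geom u v k + (- froot t (geom u v)) * vroot t k)%R.
  by apply/funext => j; rewrite geom_refl //; ring.
by rewrite geom_lin -[geom u (geom u v)]geomM refl_sqr // geom1; lra.
Qed.

Lemma plane_conj_closed t1 t2 : conj_closed (plane t1 t2).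
Proof.
move=> t u [rt [p [q tE]]] [ru [p' [q' uE]]]; split.
  by have := refl_conj u rt; rewrite reflV.
have [c cE] := froot_conj rt ru; set d := froot t (vroot u).
exists (c * (p - p' * d))%R, (c * (q - q' * d))%R => v.
by rewrite cE froot_refl // tE uE -/d; ring.
Qed.

(** Otherwise the root of t would be negative at u t rho, so tu would invert t and t would invert
    utu. Canonicity of t gives utu = t, so u fixes the root of t up to a scalar; comparing values at
    rho and at t rho contradicts positivity. *)
Lemma canonical_obtuse (D : set W) t u : D `<=` refl -> conj_closed D ->
  canonical D t -> canonical D u -> t <> u -> (froot t (vroot u) <= 0)%R.
Proof.
move=> Dr Dc [Dt tc] [Du uc] tu; have rt := Dr _ Dt; have ru := Dr _ Du.
have [//|c0] := leP (froot t (vroot u)) 0%R.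
have iut : inversion u t = false by apply/negP => /(uc _ Dt).
have itu : inversion t u = false by apply/negP => /(tc _ Du) /esym.
have pos_t : (0 < froot t (@rho C))%R.
  by have := froot_sign 1 rt; rewrite inversion1 invg1 geom1.
have pos_u : (0 < froot u (geom t (@rho C)))%R.
  by have := froot_sign t ru; rewrite itu reflV.
have neg : (froot t (geom u (geom t (@rho C))) < 0)%R.
  rewrite (froot_refl t _ ru) (froot_refl t _ rt) froot_vroot //.
  by have := mulr_gt0 c0 pos_u; lra.
have := froot_sign (t * u) rt; rewrite invwM !reflV // geomM inversionM iut /=.
case: ifP => [|_]; last by lra.
move=> /tc; rewrite reflV // => /(_ (Dc _ _ Dt Du)) utu _.
have [c cE] := froot_conj rt ru; rewrite utu in cE.
have pos_u1 : (0 < froot u (@rho C))%R.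
  by have := froot_sign 1 ru; rewrite inversion1 invg1 geom1.
have h1 := cE (@rho C); rewrite (froot_refl _ _ ru) in h1.
have h2 := cE (geom t (@rho C)).
rewrite (froot_refl _ (geom _ _) ru) (froot_refl t _ rt) froot_vroot // in h2.
move: h1 h2 pos_t pos_u pos_u1 c0 {cE neg utu tu}.
move: (froot t (vroot u)) (froot u (@rho C)) (froot u (geom t (@rho C)))
  (froot t (@rho C)) => d b b' a h1 h2 d0 b0 b0' a0.
have cn : c != 0%R by apply/eqP => e; rewrite e in h1; lra.
have : (a - b * d = a + b' * d)%R by apply: (mulfI cn); rewrite -h1; lra.
by have := mulr_gt0 b0 a0; have := mulr_gt0 b0' a0; lra.
Qed.

(** Here y collects the values of three linear forms at one point, c their values at the coroots,
    and a the coefficients of a linear relation between them. As for pairwise obtuse vectors in an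
    open half-space, the relation has to be trivial; c may be non-symmetric, so the signs of the
    coefficients are discussed directly. *)
Lemma pos_comb3_le (a1 a2 a3 y1 y2 y3 c12 c13 c21 c23 c31 c32 : rat) :
  (0 < y1 -> 0 < y2 -> 0 < y3 ->
   c12 <= 0 -> c13 <= 0 -> c21 <= 0 -> c23 <= 0 -> c31 <= 0 -> c32 <= 0 ->
   a1 * y1 + a2 * y2 + a3 * y3 = 0 ->
   a1 * 2 + a2 * c21 + a3 * c31 = 0 ->
   a1 * c12 + a2 * 2 + a3 * c32 = 0 ->
   a1 * c13 + a2 * c23 + a3 * 2 = 0 -> a1 <= 0)%R.
Proof.
move=> p1 p2 p3 n12 n13 n21 n23 n31 n32 e e1 e2 e3.
rewrite leNgt; apply/negP => s1; have A := mulr_gt0 s1 p1.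
have [s2|s2] := leP a2 0%R; have [s3|s3] := leP a3 0%R.
- have B := mulr_le0 s2 n21; have D := mulr_le0 s3 n31; clear -s1 B D e1; lra.
- have := mulr_ge0_le0 (ltW s1) n12; have := mulr_ge0_le0 (ltW s3) n32 => B D.
  have a20 : a2 = 0%R by lra.
  by have := mulr_gt0 s3 p3; rewrite a20 in e *; lra.
- have := mulr_ge0_le0 (ltW s1) n13; have := mulr_ge0_le0 (ltW s2) n23 => B D.
  have a30 : a3 = 0%R by lra.
  by have := mulr_gt0 s2 p2; rewrite a30 in e *; lra.
- by have := mulr_gt0 s2 p2; have := mulr_gt0 s3 p3; lra.
Qed.

Lemma pos_comb3 (a1 a2 a3 y1 y2 y3 c12 c13 c21 c23 c31 c32 : rat) :
  (0 < y1 -> 0 < y2 -> 0 < y3 ->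
   c12 <= 0 -> c13 <= 0 -> c21 <= 0 -> c23 <= 0 -> c31 <= 0 -> c32 <= 0 ->
   a1 * y1 + a2 * y2 + a3 * y3 = 0 ->
   a1 * 2 + a2 * c21 + a3 * c31 = 0 ->
   a1 * c12 + a2 * 2 + a3 * c32 = 0 ->
   a1 * c13 + a2 * c23 + a3 * 2 = 0 -> a3 = 0)%R.
Proof.
move=> p1 p2 p3 n12 n13 n21 n23 n31 n32 e e1 e2 e3.
have E : (a3 * y3 + a1 * y1 + a2 * y2 = 0)%R by lra.
have E3 : (a3 * 2 + a1 * c13 + a2 * c23 = 0)%R by lra.
have E1 : (a3 * c31 + a1 * 2 + a2 * c21 = 0)%R by lra.
have E2 : (a3 * c32 + a1 * c12 + a2 * 2 = 0)%R by lra.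
have h := pos_comb3_le p3 p1 p2 n31 n32 n13 n12 n23 n21 E E3 E1 E2.
have F : ((- a3) * y3 + (- a1) * y1 + (- a2) * y2 = 0)%R by lra.
have F3 : ((- a3) * 2 + (- a1) * c13 + (- a2) * c23 = 0)%R by lra.
have F1 : ((- a3) * c31 + (- a1) * 2 + (- a2) * c21 = 0)%R by lra.
have F2 : ((- a3) * c32 + (- a1) * c12 + (- a2) * 2 = 0)%R by lra.
have h' := pos_comb3_le p3 p1 p2 n31 n32 n13 n12 n23 n21 F F3 F1 F2.
by clear -h h'; lra.
Qed.

(** Three forms in the span of two satisfy a relation whose coefficients are 2 x 2 minors.
    [pos_comb3] makes a minor vanish, so two of the forms are proportional, which obtuseness and
    positivity at [rho] exclude as well. *)
Lemma plane_canonical t1 t2 u1 u2 u3 :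
  let D := plane t1 t2 in canonical D u1 -> canonical D u2 -> canonical D u3 ->
  [\/ u1 = u2, u2 = u3 | u1 = u3].
Proof.
move=> D c1 c2 c3.
have Dr : D `<=` refl by move=> t [].
have Dc : conj_closed D by apply: plane_conj_closed.
have [/eqP e12|/eqP n12] := boolP (u1 == u2); first by constructor 1.
have [/eqP e23|/eqP n23] := boolP (u2 == u3); first by constructor 2.
have [/eqP e13|/eqP n13] := boolP (u1 == u3); first by constructor 3.
have ob := canonical_obtuse Dr Dc.
have [[r1 [p1 [q1 E1]]] _] := c1; have [[r2 [p2 [q2 E2]]] _] := c2.
have [[r3 [p3 [q3 E3]]] _] := c3.
have pos u : refl u -> (0 < froot u (@rho C))%R.
  by move=> ru; have := froot_sign 1 ru; rewrite inversion1 invg1 geom1.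
have comb v : ((p2 * q3 - p3 * q2) * froot u1 v + (p3 * q1 - p1 * q3) * froot u2 v
    + (p1 * q2 - p2 * q1) * froot u3 v = 0)%R by rewrite E1 E2 E3; ring.
have := pos_comb3 (pos _ r1) (pos _ r2) (pos _ r3)
  (ob _ _ c1 c2 n12) (ob _ _ c1 c3 n13) (ob _ _ c2 c1 (nesym n12)) (ob _ _ c2 c3 n23)
  (ob _ _ c3 c1 (nesym n13)) (ob _ _ c3 c2 (nesym n23)) (comb _).
have h1 := comb (vroot u1); have h2 := comb (vroot u2); have h3 := comb (vroot u3).
rewrite !froot_vroot // in h1 h2 h3.
move=> /(_ h1 h2 h3) z.
exfalso; have y1 := pos _ r1; have y2 := pos _ r2.
have l1 v : (p1 * froot u2 v = p2 * froot u1 v)%R.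
  apply/eqP; rewrite -subr_eq0; apply/eqP; rewrite E1 E2.
  by rewrite -[RHS](mul0r (froot t2 v)) -z; ring.
have l2 v : (q1 * froot u2 v = q2 * froot u1 v)%R.
  apply/eqP; rewrite -subr_eq0; apply/eqP; rewrite E1 E2.
  by rewrite -[RHS](mul0r (- froot t1 v)%R) -z; ring.
have par (x y : rat) : (forall v, x * froot u2 v = y * froot u1 v)%R -> x = 0%R.
  move=> l; have a1 := l (@rho C); have a2 := l (vroot u1).
  have o := ob _ _ c2 c1 (nesym n12); rewrite froot_vroot // in a2.
  have [x0|x0|//] := ltgtP x 0%R; exfalso.
    have y0 : (y < 0)%R by rewrite -(pmulr_llt0 _ y1) -a1 pmulr_llt0.
    by have := mulr_le0 (ltW x0) o; rewrite a2; lra.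
  have y0 : (0 < y)%R by rewrite -(pmulr_lgt0 _ y1) -a1; apply: mulr_gt0.
  by have := mulr_ge0_le0 (ltW x0) o; rewrite a2; lra.
have p0 := par _ _ l1; have q0 := par _ _ l2.
by move: y1; rewrite E1 p0 q0 !mul0r addr0 ltxx.
Qed.

Lemma plane_dihedral t1 t2 : refl t1 -> refl t2 ->
  exists p q, [/\ refl p, refl q & forall t, plane t1 t2 t ->
    exists a, [/\ word_in [set p; q] a, odd (size a) & word_prod a = t]].
Proof.
move=> r1 r2; set D := plane t1 t2.
have Dr : D `<=` refl by move=> t [].
have Dc : conj_closed D by apply: plane_conj_closed.
have gen t : D t -> exists a, [/\ word_in (canonical D) a, odd (size a) & word_prod a = t].
  move=> Dt; have [w [s [Ss tE]]] := Dr _ Dt; rewrite tE in Dt *.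
  exact: canonical_generate Ss Dr Dc (leqnn _) Dt.
have D1 : D t1 by split=> //; exists 1%R, 0%R => v; ring.
have [[|p a] [aD oa _]] := gen _ D1; first by [].
have cp : canonical D p by apply: aD; rewrite inE eqxx.
have rp := Dr _ cp.1.
have [[q [cq qp]]|no] := pselect (exists q, canonical D q /\ q <> p).
  exists p, q; split=> // [|t /gen[a' [a'D oa' <-]]]; first exact: Dr _ cq.1.
  exists a'; split=> // x /a'D cx.
  by case: (plane_canonical cp cq cx) => [e|<-|<-]; [case: qp|right|left].
exists p, p; split=> // t /gen[a' [a'D oa' <-]].
exists a'; split=> // x /a'D cx; left; apply: contrapT => xp.
by apply: no; exists x.
Qed.

(** Write z = b tau and rb = b rh with rh = b^-1 r b. The two ways up from b to g and to u factor rh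
    tau into reflections, so by [planar] the labels s2 and p2 of the covers of rb lie in the plane
    of tau and rh, hence in a dihedral reflection subgroup. There the odd product s2 rh p2 is a
    reflection, and it carries rg to u. So u <= rg, and as u rises under r, u <= g. *)
Lemma rising_unique r b z g u : S r ->
  (len b < len (r * b))%N -> (len z < len (r * z))%N ->
  (len g < len (r * g))%N -> (len u < len (r * u))%N ->
  len z = (len b).+1 -> len g = (len b).+2 -> len u = (len b).+2 ->
  b <=b z -> z <=b g -> z <=b u -> r * b <=b g -> r * b <=b u -> g = u.
Proof.
move=> Sr rb rz rg ru lz lg lu bz zg zu rbg rbu.
have lrb : len (r * b) = (len b).+1 by apply: len_asc => //; rewrite -len_mul_lt.
have [tau rtau zE] := cover_refl bz lz.
have [s1 rs1 gE1] : exists2 t, refl t & g = z * t by apply: cover_refl => //; lia.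
have [s2 rs2 gE2] : exists2 t, refl t & g = r * b * t by apply: cover_refl => //; lia.
have [p1 rp1 uE1] : exists2 t, refl t & u = z * t by apply: cover_refl => //; lia.
have [p2 rp2 uE2] : exists2 t, refl t & u = r * b * t by apply: cover_refl => //; lia.
pose rh := b^-1 * r * b.
have rrh : refl rh by apply/refl_conjV/refl_simple.
have rbE : r * b = b * rh by rewrite /rh !mulwA mulgV mul1g.
have zrb : z <> r * b by move=> e; move: rz; rewrite e simpleK //; lia.
have rel t t' : r * b * t' = z * t -> refl t -> t' * t = rh * tau.
  move=> E rt; apply: (mulgI (r * b)); rewrite mulwA E zE rbE.
  rewrite -(mulwA _ t t) refl_sqr // mulg1 -(mulwA b rh (rh * tau)).
  by rewrite (mulwA rh rh) refl_sqr // mul1g.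
have diff t t' : r * b * t' = z * t -> t <> t'.
  by move=> E e; apply: zrb; rewrite -e in E; apply: (mulIg t); rewrite E.
have R1 : s2 * s1 = rh * tau by apply: rel; rewrite // -gE1.
have R2 : p2 * p1 = rh * tau by apply: rel; rewrite // -uE1.
have inpl t t' : refl t -> refl t' -> t' * t = rh * tau -> t <> t' -> plane tau rh t'.
  move=> rt rt' E ne; split=> //.
  have Ei : t * t' = tau * rh.
    by rewrite -(reflV rt) -(reflV rt') -invwM E invwM !reflV.
  have [p [q h]] := planar rt' rt rrh rtau Ei (nesym ne).
  by exists q, p => v; rewrite h addrC.
have [p [q [rp rq gen]]] := plane_dihedral rtau rrh.
have [|a1 [aw1 ao1 aE1]] := gen s2.
  by apply: (inpl s1) => //; apply: diff; rewrite -gE1.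
have [|a2 [aw2 ao2 aE2]] := gen p2.
  by apply: (inpl p1) => //; apply: diff; rewrite -uE1.
have [|a3 [aw3 ao3 aE3]] := gen rh.
  by split=> //; exists 0%R, 1%R => v; ring.
have rx : refl (s2 * rh * p2).
  rewrite -aE1 -aE2 -aE3 -!word_prod_cat; apply: (odd_word_refl rp rq).
    by do 2 (apply/word_in_cat; split=> //).
  by rewrite !size_cat !oddD ao1 ao2 ao3.
have uE : r * g * (s2 * rh * p2) = u.
  rewrite uE2 gE2 (mulwA r (r * b)) (simpleK b Sr) rbE !mulwA.
  by rewrite -(mulwA b s2 s2) refl_sqr // mulg1.
have urg : u <=b r * g.
  rewrite -(reflK (r * g) rx) uE; apply: bruhat_mulr => //.
  by rewrite -[X in (_ < len (X * _))%N]uE reflK // lu -lg.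
apply/esym/bruhat_len_eq; last by rewrite lg lu.
by have := lift_ascl Sr urg ru; rewrite simpleK.
Qed.

End Planes.

(** * Special matchings *)

Section SpecialMatchings.
Variable C : coxSystem.
Local Notation W := (cx_group C).
Local Notation S := (@cx_gens C).
Local Notation len := (length S).
Local Notation "u <=b v" := (bruhat_le S u v) (at level 70).
Implicit Types (s t u v w x y z : W) (M N : W -> W).

(* Only the values of M on [1,w] matter. *)
Definition special w M : Prop :=
  [/\ forall v, v <=b w -> M v <=b w /\ M (M v) = v,
      forall v, v <=b w -> (v <=b M v /\ len (M v) = (len v).+1) \/
                           (M v <=b v /\ len v = (len (M v)).+1) &
      forall u v, u <=b v -> v <=b w -> len v = (len u).+1 -> M u <> v ->
        M u <=b M v].

Definition falls M v : bool := (len (M v) < len v)%N.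

Section OneMatching.
Variables (w : W) (M : W -> W).
Hypothesis sM : special w M.

Lemma special_le v : v <=b w -> M v <=b w.
Proof. by move=> vw; have [h _ _] := sM; have [] := h v vw. Qed.

Lemma specialK v : v <=b w -> M (M v) = v.
Proof. by move=> vw; have [h _ _] := sM; have [] := h v vw. Qed.

Lemma special_fall v : v <=b w -> falls M v -> M v <=b v /\ len v = (len (M v)).+1.
Proof. by move=> vw; have [_ h _] := sM; rewrite /falls; case: (h v vw) => -[] //; lia. Qed.

Lemma special_rise v : v <=b w -> ~~ falls M v -> v <=b M v /\ len (M v) = (len v).+1.
Proof. by move=> vw; have [_ h _] := sM; rewrite /falls; case: (h v vw) => -[] //; lia. Qed.

Lemma special_fallsM v : v <=b w -> falls M (M v) = ~~ falls M v.
Proof.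
move=> vw; rewrite /falls specialK //.
by have [_ h _] := sM; case: (h v vw) => -[]; lia.
Qed.

Lemma special_cover u v : u <=b v -> v <=b w -> len v = (len u).+1 -> M u <> v ->
  M u <=b M v.
Proof. by have [_ _ h] := sM; apply: h. Qed.

Lemma special_lift n u v : (len v - len u <= n)%N ->
  u <=b v -> v <=b w -> falls M v -> M u <=b v.
Proof.
elim: n u => [|n IH] u hn uv vw fv.
  have -> : u = v by apply: bruhat_len_eq uv _; lia.
  by have [] := special_fall vw fv.
have uw := bruhat_trans uv vw.
have [fu|ru] := boolP (falls M u).
  by apply: bruhat_trans uv; have [] := special_fall uw fu.
have [/eqP->|/eqP nuv] := boolP (u == v); first by have [] := special_fall vw fv.
have [z [uz zv lz]] := exists_atom uv nuv.
have [/eqP->//|/eqP nz] := boolP (M u == z).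
have zw := bruhat_trans zv vw.
apply: bruhat_trans (special_cover uz zw lz nz) _.
by apply: IH => //; have := bruhat_len zv; lia.
Qed.

Lemma special_falls_le u v : u <=b v -> v <=b w -> falls M v -> M u <=b v.
Proof. exact: special_lift. Qed.

(** An atom z of [u,v] other than Mu must rise, since Mu <= Mz, so induction applies to it. If the
    atom found is Mu and differs from v, thinness provides another one. *)
Lemma special_rise_below n u v : (len v - len u <= n)%N ->
  u <=b v -> v <=b w -> falls M v -> ~~ falls M u -> u <=b M v.
Proof.
elim: n u => [|n IH] u hn uv vw fv ru.
  by move: fv ru; have -> : u = v by [apply: bruhat_len_eq uv _; lia]; move=> ->.
have uw := bruhat_trans uv vw.
have nuv : u <> v by move=> e; move: ru; rewrite e fv.
have step z : u <=b z -> z <=b v -> len z = (len u).+1 -> M u <> z -> u <=b M v.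
  move=> uz zv lz nz; have zw := bruhat_trans zv vw.
  apply: (bruhat_trans uz); apply: IH => //; first by have := bruhat_len zv; lia.
  apply/negP => fz; have := bruhat_len (special_cover uz zw lz nz).
  have [_] := special_fall zw fz; have [_] := special_rise uw ru; lia.
have [z [uz zv lz]] := exists_atom uv nuv.
have [/eqP zE|/eqP nz] := boolP (M u == z); last exact: step nz.
have [/eqP zv'|/eqP nzv] := boolP (z == v).
  by rewrite -zv' -zE specialK //; apply: bruhat_refl.
have [y [zy yv ly]] := exists_atom zv nzv.
have [|a [b [[nab ua ay ub bv] [la lb]]]] := bruhat_thin (bruhat_trans uz zy).
  by rewrite ly lz.
have [/eqP e|/eqP na] := boolP (M u == a).
  by apply: (step b) => //; [apply: bruhat_trans yv|rewrite e].
by apply: (step a) => //; apply: bruhat_trans yv.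
Qed.

Lemma special_le_falls u v : u <=b v -> v <=b w -> falls M v -> ~~ falls M u -> u <=b M v.
Proof. exact: special_rise_below. Qed.

Lemma special_falls2 u v : u <=b v -> v <=b w -> falls M v -> falls M u -> M u <=b M v.
Proof.
move=> uv vw fv fu; have uw := bruhat_trans uv vw.
have [Muu _] := special_fall uw fu.
by apply: special_le_falls; rewrite ?special_fallsM ?fu //; apply: bruhat_trans uv.
Qed.

Lemma special_restrict v : v <=b w -> falls M v -> special v M.
Proof.
move=> vw fv; have [h1 h2 h3] := sM; split=> [u uv|u uv|u y uy yv].
- by split; [apply: special_falls_le|apply/specialK/(bruhat_trans uv)].
- exact/h2/(bruhat_trans uv).
- exact/h3/(bruhat_trans yv).
Qed.

End OneMatching.

Lemma special_left r w : S r -> (len (r * w) < len w)%N -> special w (fun v => r * v).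
Proof.
move=> Sr rw; split=> [v vw|v vw|u v uv vw lv ne].
- by rewrite simpleK //; split=> //; apply: lift_descl.
- have [h|h] := boolP (len (r * v) < len v)%N; [right|left]; split.
  + exact: bruhat_descl.
  + exact: len_desc.
  + by apply: bruhat_ascl; rewrite // len_mul_lt.
  + exact: len_asc.
- have [ru|ru] := boolP (len (r * u) < len u)%N; first exact: lift_bothl.
  have [rv|rv] := boolP (len (r * v) < len v)%N; last first.
    by apply: lift_monol => //; rewrite len_mul_lt.
  case: ne; apply: bruhat_len_eq; first exact: lift_descl.
  by rewrite lv len_asc.
Qed.

(** Conjugation by inversion exchanges left and right multiplications, so only left ones have to be
    studied against an arbitrary matching. *)
Definition inv_map M : W -> W := fun v => (M v^-1)^-1.

Lemma special_inv w M : special w M -> special w^-1 (inv_map M).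
Proof.
have flip u v : u <=b v^-1 -> u^-1 <=b v by move=> /bruhatV; rewrite invgK.
move=> [h1 h2 h3]; split=> [v /flip vw|v /flip vw|u v uv /flip vw].
- have [a b] := h1 _ vw; rewrite /inv_map invgK b invgK; split=> //.
  exact: bruhatV.
- rewrite /inv_map !lenV -(lenV v).
  case: (h2 _ vw) => -[/bruhatV a b]; [left|right]; split=> //.
    by move: a; rewrite invgK.
  by move: a; rewrite invgK.
- rewrite /inv_map -(lenV v) -(lenV u) => lv ne; apply: bruhatV.
  apply: h3 => //; first exact: bruhatV.
  by move=> e; apply: ne; rewrite e invgK.
Qed.

Lemma special_right r w : S r -> (len (w * r) < len w)%N -> special w (fun v => v * r).
Proof.
move=> Sr wr; have := @special_left r w^-1 Sr; rewrite -len_mulr_inv // lenV => /(_ wr).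
move=> /special_inv; rewrite invgK; congr special.
by apply/funext => v; rewrite /inv_map invwM invgK simpleV.
Qed.

Fixpoint alt M N i x : W :=
  if i is j.+1 then (if odd j then N else M) (alt M N j x) else x.

Definition is_top w M N x := [/\ x <=b w, falls M x & falls N x].

(** For a top x the orbit is a 2k-gon: two descending paths from x, one starting with M and one with
    N, meet for the first time k levels down. The value k = 1 means an orbit with two elements. *)
Definition is_rank M N x k := [/\ (0 < k)%N, alt M N k x = alt N M k x &
  forall j, (0 < j < k)%N -> alt M N j x <> alt N M j x].

Lemma is_rankC M N x k : is_rank M N x k -> is_rank N M x k.
Proof. by move=> [h1 h2 h3]; split=> // j hj /esym; apply: h3. Qed.

Lemma is_rank_uniq M N x k k' : is_rank M N x k -> is_rank M N x k' -> k = k'.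
Proof.
move=> [h1 h2 h3] [h1' h2' h3']; case: (ltngtP k k') => // h.
- by case: (h3' k) => //; rewrite h1.
- by case: (h3 k') => //; rewrite h1'.
Qed.

Section TwoMatchings.
Variables (w : W) (M N : W -> W).
Hypotheses (sM : special w M) (sN : special w N).

Lemma special_if (b : bool) : special w (if b then N else M).
Proof. by case: b. Qed.

Lemma special_if' (b : bool) : special w (if b then M else N).
Proof. by case: b. Qed.

(** Let y and y' be the distinct elements at one level, z an element above y with Az = y', where A
    is the next letter for y. As z covers y, the covering axiom gives Ay <= y', so y falls under A;
    the same argument applies to y'. *)
Lemma orbit_chain x i : is_top w M N x ->
  (forall j, (0 < j < i)%N -> alt M N j x <> alt N M j x) ->
  [/\ forall j, (j <= i)%N -> alt M N j x <=b w /\ (len (alt M N j x) + j)%N = len x,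
      forall j, (j <= i)%N -> alt N M j x <=b w /\ (len (alt N M j x) + j)%N = len x &
      forall j, (j < i)%N ->
        [/\ alt M N j.+1 x <=b alt M N j x, alt M N j.+1 x <=b alt N M j x,
            alt N M j.+1 x <=b alt M N j x & alt N M j.+1 x <=b alt N M j x]].
Proof.
move=> [xw fM fN]; elim: i => [|i IH] ne.
  by split=> // j; rewrite leqn0 => /eqP-> /=; rewrite addn0.
have [|h1 h2 h3] := IH; first by move=> j hj; apply: ne; lia.
have [yw ly] := h1 i (leqnn i); have [y'w ly'] := h2 i (leqnn i).
suff [[a1 a2 a3] [b1 b2 b3]] :
  [/\ alt M N i.+1 x <=b alt M N i x, alt M N i.+1 x <=b alt N M i x &
      (len (alt M N i.+1 x) + i.+1)%N = len x] /\
  [/\ alt N M i.+1 x <=b alt M N i x, alt N M i.+1 x <=b alt N M i x &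
      (len (alt N M i.+1 x) + i.+1)%N = len x].
  split=> j; rewrite leq_eqVlt => /orP[/eqP e|].
  - by rewrite e; split=> //; apply: bruhat_trans yw.
  - by rewrite ltnS => /h1.
  - by rewrite e; split=> //; apply: bruhat_trans y'w.
  - by rewrite ltnS => /h2.
  - by case: e => ->; split.
  - by rewrite ltnS => /h3.
case: i ne {IH} h1 h2 h3 yw ly y'w ly' => [|i] ne h1 h2 h3 yw ly y'w ly'.
  rewrite /=; have [a b] := special_fall sM xw fM; have [c d] := special_fall sN xw fN.
  by split; split=> //; rewrite addn1.
have nei : alt M N i.+1 x <> alt N M i.+1 x by apply: ne; rewrite /= ltnSn.
have [_ c1 c2 _] := h3 i (ltnSn i).
have [zw lz] := h1 i (leqnSn i); have [z'w lz'] := h2 i (leqnSn i).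
have half A z y y' : special w A -> y <=b z -> z <=b w -> len z = (len y).+1 ->
    len y' = len y -> A z = y' -> y <> y' -> [/\ A y <=b y, A y <=b y' & len y = (len (A y)).+1].
  move=> sA yz zw' lzy le Az ne'; have yw' := bruhat_trans yz zw'.
  have Ayy' : A y <=b y'.
    rewrite -Az; apply: (special_cover sA) => // e; apply: ne'.
    by rewrite -Az -e (specialK sA).
  have fy : falls A y.
    apply/negPn/negP => /(special_rise sA yw')[_]; have := bruhat_len Ayy'; lia.
  by have [] := special_fall sA yw' fy.
have E1 : (if odd i.+1 then N else M) = (if odd i then M else N) by rewrite /=; case: (odd i).
have E2 : (if odd i.+1 then M else N) = (if odd i then N else M) by rewrite /=; case: (odd i).
have [|||||||p1 p2 p3] := half (if odd i then M else N) (alt N M i x) (alt M N i.+1 x) (alt N M i.+1 x).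
- by case: (odd i).
- exact: c1.
- exact: z'w.
- lia.
- lia.
- by [].
- exact: nei.
have [|||||||q1 q2 q3] := half (if odd i then N else M) (alt M N i x) (alt N M i.+1 x) (alt M N i.+1 x).
- by case: (odd i).
- exact: c2.
- exact: zw.
- lia.
- lia.
- by [].
- exact: nesym.
have F1 : alt M N i.+2 x = (if odd i then M else N) (alt M N i.+1 x) by rewrite -E1.
have F2 : alt N M i.+2 x = (if odd i then N else M) (alt N M i.+1 x) by rewrite -E2.
rewrite F1 F2; split; split=> //; lia.
Qed.

Lemma exists_rank x : is_top w M N x -> exists k, is_rank M N x k.
Proof.
move=> tx; have ex : exists k, (0 < k)%N && (alt M N k x == alt N M k x).
  apply: contrapT => no; have [|h _ _] := @orbit_chain x (len x).+1 tx.
    move=> j /andP[j0 _] e; apply: no; exists j; by rewrite j0 e eqxx.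
  by have [_] := h (len x).+1 (leqnn _); lia.
have [k /andP[k0 /eqP e] kmin] := find_ex_minn ex.
exists k; split=> // j /andP[j0 jk] e'.
by have := kmin j; rewrite j0 e' eqxx => /(_ isT); lia.
Qed.

Definition orbit_of x k : set W :=
  [set v | exists2 j, (j <= k)%N & v = alt M N j x \/ v = alt N M j x].

Lemma orbit_closed x k v : is_top w M N x -> is_rank M N x k ->
  orbit_of x k v -> orbit_of x k (M v) /\ orbit_of x k (N v).
Proof.
move=> tx [k0 ek nek]; have [h1 h2 _] := orbit_chain tx nek.
have up j : (j < k)%N -> let A := if odd j then N else M in
    A (alt M N j.+1 x) = alt M N j x.
  by move=> jk /=; apply: (specialK (special_if _)); case: (h1 j (ltnW jk)).
have up' j : (j < k)%N -> let A := if odd j then M else N in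
    A (alt N M j.+1 x) = alt N M j x.
  by move=> jk /=; apply: (specialK (special_if' _)); case: (h2 j (ltnW jk)).
have inO j : (j <= k)%N -> orbit_of x k (alt M N j x) by move=> jk; exists j => //; left.
have inO' j : (j <= k)%N -> orbit_of x k (alt N M j x) by move=> jk; exists j => //; right.
(* at the bottom both letters go up, one along each path *)
have bot : orbit_of x k (M (alt M N k x)) /\ orbit_of x k (N (alt M N k x)).
  have k1 : k = k.-1.+1 by rewrite prednK.
  have a := up k.-1; have b := up' k.-1.
  rewrite -k1 -ek in a b; move: (a (leqnn k)) (b (leqnn k)) => /=.
  by case: (odd k.-1) => -> ->; split; [apply: inO'|apply: inO|apply: inO|apply: inO'];
    rewrite leq_pred.
move=> [j jk [->|->]].
- have [/eqP->//|nk] := boolP (j == k).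
  have jk' : (j < k)%N by rewrite ltn_neqAle nk.
  case: j jk nk jk' => [|j] jk nk jk'.
    by split; [exact: (inO 1%N)|exact: (inO' 1%N)].
  have a := up j jk; have b := inO j.+2 jk'; move: a b => /=.
  by case: (odd j) => /= a b; split=> //; rewrite a; apply: inO; apply: ltnW.
- have [/eqP->|nk] := boolP (j == k); first by rewrite -ek.
  have jk' : (j < k)%N by rewrite ltn_neqAle nk.
  case: j jk nk jk' => [|j] jk nk jk'.
    by split; [exact: (inO 1%N)|exact: (inO' 1%N)].
  have a := up' j jk; have b := inO' j.+2 jk'; move: a b => /=.
  by case: (odd j) => /= a b; split=> //; rewrite a; apply: inO'; apply: ltnW.
Qed.

End TwoMatchings.
End SpecialMatchings.

(** * Pushing orbits down to dihedral parabolic subgroups *)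

Section RankDescent.
Variable C : coxSystem.
Local Notation W := (cx_group C).
Local Notation S := (@cx_gens C).
Local Notation len := (length S).
Local Notation "u <=b v" := (bruhat_le S u v) (at level 70).
Implicit Types (s t u v w x y z : W) (M N : W -> W).
Variable m : W -> W -> option nat.
Hypotheses (hm : coxeter_system S m) (dl : doubly_laced S m).

Section Pair.
Variables (w : W) (M N : W -> W).
Hypotheses (sM : special w M) (sN : special w N).

Lemma alt_fixO (O : set W) c : (forall v, O v -> O (M v) /\ O (N v)) ->
  c <=b w -> ~ O c -> forall i, alt M N i c <=b w /\ ~ O (alt M N i c).
Proof.
move=> Oc cw nOc; elim=> [//|i [iw nO]] /=.
split; first exact: (special_le (special_if sM sN _)).
move=> h; apply: nO.
rewrite -(specialK (special_if sM sN (odd i)) iw).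
by case: (odd i) h => /Oc[].
Qed.

Lemma coatom_path x k c : is_top w M N x -> is_rank M N x k ->
  c <=b x -> len x = (len c).+1 -> ~ orbit_of M N x k c ->
  forall i, (i <= k)%N -> [/\ alt M N i c <=b alt M N i x,
    len (alt M N i x) = (len (alt M N i c)).+1 & (len (alt M N i c) + i)%N = len c].
Proof.
move=> tx rx cx lc nO; have [xw fM fN] := tx; have [k0 ek nek] := rx.
have [h1 h2 h3] := orbit_chain sM sN tx nek.
have cw := bruhat_trans cx xw.
have Oc v : orbit_of M N x k v -> orbit_of M N x k (M v) /\ orbit_of M N x k (N v).
  exact: (orbit_closed sM sN).
have cO := alt_fixO Oc cw nO.
elim=> [|i IH] ik; first by rewrite /= addn0.
have [iw nOi] := cO i; have [p1 p2 p3] := IH (ltnW ik).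
have [xiw lxi] := h1 i (ltnW ik); have [xiw' lxi'] := h1 i.+1 ik.
have sA := special_if sM sN (odd i).
have q1 : alt M N i.+1 c <=b alt M N i.+1 x.
  apply: (special_cover sA) => // e.
  have [_] := cO i.+1; apply; rewrite /= e.
  by exists i; [apply: ltnW|left].
have l1 := bruhat_len q1.
have : falls (if odd i then N else M) (alt M N i c).
  by apply/negPn/negP => /(special_rise sA iw)[_]; move: l1 lxi' => /=; lia.
move=> /(special_fall sA iw)[_ l2]; split=> //=; move: lxi' => /=; lia.
Qed.

(** If the paths from c met at a level k' < k, the next step would lead upwards, against
    [coatom_path]. *)
Lemma coatom_rank_ge x k c k' : is_top w M N x -> is_rank M N x k ->
  c <=b x -> len x = (len c).+1 -> ~ orbit_of M N x k c ->
  is_top w M N c -> is_rank M N c k' -> (k <= k')%N.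
Proof.
move=> tx rx cx lc nO tc rc; rewrite leqNgt; apply/negP => lt.
have path := coatom_path tx rx cx lc nO.
have [_ _ l1] := path k' (ltnW lt); have [_ _ l2] := path k'.+1 lt.
have [k0 ek nek] := rc; have [h1 h2 _] := orbit_chain sM sN tc nek.
have e : k' = k'.-1.+1 by rewrite prednK.
have [w1 l3] := h2 k'.-1 (leq_pred _).
have E : alt M N k'.+1 c = alt N M k'.-1 c.
  rewrite /= ek {2}e /= {1}e /=.
  by case: (odd k'.-1) => /=; [apply: (specialK sM)|apply: (specialK sN)].
by move: l2; rewrite E; lia.
Qed.

End Pair.

Section Left.
Variables (w r : W) (M : W -> W).
Hypotheses (Sr : S r) (rw : (len (r * w) < len w)%N) (sM : special w M).
Local Notation N := (fun v => r * v).

Let sN : special w N := special_left Sr rw.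

(* If k < k', then rising_unique identifies an element of the orbit of c with the
   bottom of the orbit of x: both lie two levels above a common element. *)
Lemma coatom_rank_core P Q x k c k' : special w P -> special w Q ->
  is_top w P Q x -> is_rank P Q x k -> (1 < k)%N ->
  c <=b x -> len x = (len c).+1 -> ~ orbit_of P Q x k c ->
  is_top w P Q c -> is_rank P Q c k' ->
  (if odd k then P else Q) = N -> (k' <= k)%N.
Proof.
move=> sP sQ tx rx k1 cx lc nO tc rc eN; rewrite leqNgt; apply/negP => lt.
have path := coatom_path sP sQ tx rx cx lc nO.
have rxC := is_rankC rx.
have txC : is_top w Q P x by case: tx => *; split.
have path' := coatom_path sQ sP txC rxC cx lc _.
have [k0 ek nek] := rx; have [k0' ek' nek'] := rc.
have [h1 h2 h3] := orbit_chain sP sQ tc nek'.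
have [g1 g2 g3] := orbit_chain sP sQ tx nek.
(* The roles in [rising_unique]: b is at level k + 1 below c and rb = z; z' is the other element at
   level k; g is at level k - 1; u is the bottom of the orbit of x. The condition on the parity of k
   makes N the letter that leads up from each of b, z', g and u. *)
set z' := alt P Q k c; set z := alt Q P k c; set b := alt Q P k.+1 c.
set g := alt Q P k.-1 c; set u := alt P Q k x.
have kE : k = k.-1.+1 by lia.
have kE' : k.-1 = k.-2.+1 by lia.
have [zw lz] := h2 k (ltnW lt); have [zw' lz'] := h1 k (ltnW lt).
have [bw lb] := h2 k.+1 lt; have [gw lg] := h2 k.-1 (leq_trans (leq_pred _) (ltnW lt)).
have bE : b = r * z by rewrite /b /= eN.
have [d1 d2 d3 d4] := h3 k lt.
have [|e1 e2 e3 e4] := h3 k.-1; first by lia.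
rewrite -kE in e1 e2 e3 e4.
have [p1 p2 p3] := path k (leqnn k).
have [|q1 q2 q3] := path' _ k (leqnn k).
  by move=> [j jk h]; apply: nO; exists j => //; case: h; [right|left].
have rb : r * b = z by rewrite bE simpleK.
have NE v : r * v = (if odd k then P else Q) v by rewrite eN.
have ok : odd k = ~~ odd k.-1 by rewrite {1}kE.
have ok' : odd k = odd k.-2 by rewrite {1}kE {1}kE' /= negbK.
have akE v : alt P Q k v = (if odd k.-1 then Q else P) (alt P Q k.-1 v) by rewrite {1}kE.
have agE v : alt Q P k.-1 v = (if odd k.-2 then P else Q) (alt Q P k.-2 v).
  by rewrite {1}kE'.
have rz' : r * z' = alt P Q k.-1 c.
  have [cw1 _] := h1 k.-1 (leq_trans (leq_pred _) (ltnW lt)).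
  by rewrite NE ok /z' akE; case: (odd k.-1) => /=; [apply: (specialK sQ)|apply: (specialK sP)].
have rg : r * g = alt Q P k.-2 c.
  have [|cw1 _] := h2 k.-2; first by lia.
  by rewrite NE ok' /g agE; case: (odd k.-2) => /=; [apply: (specialK sP)|apply: (specialK sQ)].
have ru : (len u < len (r * u))%N.
  have [cw1 l1] := g1 k.-1 (leq_pred _); have [uw lu] := g1 k (leqnn k).
  suff -> : r * u = alt P Q k.-1 x by rewrite /u; lia.
  by rewrite NE ok /u akE; case: (odd k.-1) => /=; [apply: (specialK sQ)|apply: (specialK sP)].
have [gw1 lg1] : alt P Q k.-1 c <=b w /\ (len (alt P Q k.-1 c) + k.-1)%N = len c by apply: h1; lia.
have [gw2 lg2] : alt Q P k.-2 c <=b w /\ (len (alt Q P k.-2 c) + k.-2)%N = len c by apply: h2; lia.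
have gu : g = u.
  apply: (rising_unique hm dl Sr (b := b) (z := z')) => //.
  - by rewrite rb; rewrite /z /b; lia.
  - by rewrite rz' /z'; lia.
  - by rewrite rg /g; lia.
  - by rewrite /z' /b; lia.
  - by rewrite /g /b; lia.
  - by rewrite /u p2 /b; lia.
  - by rewrite rb.
  - by rewrite rb /u ek.
have cO := @alt_fixO w Q P sQ sP (orbit_of P Q x k) c.
have [||_] := cO _ _ nO k.-1.
- by move=> v /(orbit_closed sP sQ tx rx)[].
- by case: tc.
by apply; rewrite -/g gu; exists k => //; left.
Qed.

Lemma coatom_rank x k c : is_top w M N x -> is_rank M N x k -> (1 < k)%N ->
  c <=b x -> len x = (len c).+1 -> ~ orbit_of M N x k c ->
  is_top w M N c -> is_rank M N c k.
Proof.
move=> tx rx k1 cx lc nO tc; have [k' rc] := exists_rank sM sN tc.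
suff -> : k = k' by [].
apply/eqP; rewrite eqn_leq (coatom_rank_ge sM sN tx rx cx lc nO tc rc) /=.
have [ok|ok] := boolP (odd k).
  apply: (@coatom_rank_core N M x k c k') => //; try exact: is_rankC; rewrite ?ok //.
  - by case: tx => *; split.
  - by move=> [j jk h]; apply: nO; exists j => //; case: h; [right|left].
  - by case: tc => *; split.
by apply: (@coatom_rank_core M N x k c k'); rewrite ?(negbTE ok).
Qed.

(** A coatom of x other than Mx and rx is off the orbit, and by the covering axiom it is again a
    top, of the same rank; the descent stops only where [third_coatom] does not apply. *)
Lemma dihedral_top n x k : (len x <= n)%N -> is_top w M N x -> is_rank M N x k ->
  (1 < k)%N -> exists y s t, [/\ S s, S t, dih s t y, is_top w M N y & is_rank M N y k].
Proof.
elim: n x => [|n IH] x xn tx rx k1.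
  have [xw fM _] := tx; have [_] := special_fall sM xw fM; lia.
have [[s [t [Ss St d]]]|nd] := pselect (exists s t, [/\ S s, S t & dih s t x]).
  by exists x, s, t.
have [xw fM fN] := tx; have [k0 ek nek] := rx.
have [h1 h2 h3] := orbit_chain sM sN tx nek.
have [|s t Ss St d|c [cx lc cM cN]] := @third_coatom C x (M x) (r * x).
- by have [_] := h1 k (leqnn k); lia.
- by apply: nd; exists s, t.
have cw := bruhat_trans cx xw.
have nO : ~ orbit_of M N x k c.
  move=> [j jk e]; have j1 : j = 1%N.
    by have [_ a] := h1 j jk; have [_ b] := h2 j jk; case: e => e; move: lc; rewrite e; lia.
  by move: e; rewrite j1 /=; case.
have fall A : special w A -> falls A x -> c <> A x -> falls A c.
  move=> sA fA ne; have [_ l] := special_fall sA xw fA.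
  have cA : A c <=b A x.
    by apply: (special_cover sA) => // e; apply: ne; rewrite -e (specialK sA).
  by apply/negPn/negP => /(special_rise sA cw)[_]; have := bruhat_len cA; lia.
have tc : is_top w M N c by split=> //; [apply: fall|apply: (fall N)].
apply: (IH c) => //; first by lia.
exact: coatom_rank rx k1 cx lc nO tc.
Qed.

End Left.
End RankDescent.

(** * Orbits of two special matchings *)

Section ReducedWords.
Variable C : coxSystem.
Local Notation W := (cx_group C).
Local Notation S := (@cx_gens C).
Local Notation len := (length S).
Local Notation "u <=b v" := (bruhat_le S u v) (at level 70).
Implicit Types (s t p q u v w x y z : W) (a b : seq W).

Definition reduced a : Prop := word_in S a /\ size a = len (word_prod a).

Lemma reduced_catl a b : reduced (a ++ b) -> reduced a.
Proof.
move=> [/word_in_cat[Sa Sb] sz]; split=> //; apply/eqP; rewrite eqn_leq len_le // andbT.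
have [c [Sc cs cp]] := lenP (word_prod a); rewrite -cs leqNgt; apply/negP => lt.
have : (len (word_prod (c ++ b)) <= size (c ++ b))%N by apply/len_le/word_in_cat.
by move: sz; rewrite !word_prod_cat cp !size_cat; lia.
Qed.

Lemma reduced_catr a b : reduced (a ++ b) -> reduced b.
Proof.
move=> [/word_in_cat[Sa Sb] sz]; split=> //; apply/eqP; rewrite eqn_leq len_le // andbT.
have [c [Sc cs cp]] := lenP (word_prod b); rewrite -cs leqNgt; apply/negP => lt.
have : (len (word_prod (a ++ c)) <= size (a ++ c))%N by apply/len_le/word_in_cat.
by move: sz; rewrite !word_prod_cat cp !size_cat; lia.
Qed.

Lemma reduced_cons x a : reduced (x :: a) ->
  [/\ S x, reduced a & (len (word_prod a) < len (x * word_prod a))%N].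
Proof.
move=> h; have [_ sa] := h; have ra : reduced a by apply: (@reduced_catr [:: x]).
have [/word_in_cons[Sx _] _] := h; have [_ sa'] := ra.
by split=> //; move: sa; rewrite word_prod_cons /= -sa' => <-.
Qed.

Lemma reduced_subseq_le b : reduced b -> forall a, subseq a b -> word_prod a <=b word_prod b.
Proof.
elim: b => [_ a|x b IH].
  by rewrite subseq0 => /eqP->; apply: bruhat_refl.
move=> /reduced_cons[Sx rb lt] [|y a] h; first by rewrite word_prod_nil; apply: bruhat1.
rewrite [in X in _ <=b X]word_prod_cons; move: h => /=; case: eqP => [->|_] h.
  by rewrite word_prod_cons; apply: lift_monol => //; apply: IH.
by apply: bruhat_trans (IH rb _ h) _; apply: bruhat_ascl.
Qed.

Lemma reduced_dih s t b : S s -> S t -> reduced b -> dih s t (word_prod b) ->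
  word_in [set s; t] b.
Proof.
move=> Ss St rb d x xb; have Sx : S x by have [h _] := rb; apply: h.
apply: dih_simple => //; apply: dih_down d => //.
rewrite -[x]mulg1 -(word_prod_nil W) -word_prod_cons.
by apply: reduced_subseq_le; rewrite ?sub1seq.
Qed.

Lemma reduced2 x y a : reduced (x :: y :: a) -> x <> y.
Proof.
move=> /reduced_cons[Sx /reduced_cons[_ _ lt'] lt] e; move: lt.
by rewrite -e in lt' *; rewrite word_prod_cons simpleK // ltnNge (ltnW lt').
Qed.

Lemma len_pair p q : S p -> S q -> p <> q -> len (p * q) = 2%N.
Proof.
move=> Sp Sq ne; have := len_mulS q Sp; rewrite (len_simple Sq).
case=> [//|[] /esym/len0 e]; case: ne.
by rewrite -(simpleV Sq); apply/esym/mulg1_eq; rewrite -(simpleV Sp) -(simpleV Sq) -invwM e invg1.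
Qed.

Lemma len1_simple x : len x = 1%N -> S x.
Proof.
have [[|y [|z a]] [Sa sa xE]] := lenP x; rewrite -sa // => _.
by rewrite -xE word_prod_cons word_prod_nil mulg1; apply: Sa; rewrite inE.
Qed.

Lemma rise_notin p x y z : S p -> S x -> S y -> p <> x -> p <> y -> dih x y z ->
  (len z < len (p * z))%N.
Proof.
move=> Sp Sx Sy px py d; rewrite len_mul_lt //; apply/negP => h.
have pz : p <=b z by rewrite -[p]mulg1; apply: lift_descl => //; apply: bruhat1.
by have [] := dih_simple Sx Sy Sp (dih_down Sx Sy pz d).
Qed.

Lemma dih_pair p q : dih p q (p * q).
Proof.
by apply: dih_mull; rewrite -[X in dih _ _ X]mulg1; apply: dih_mulr; apply: dih1.
Qed.

Lemma dih_gen p q : dih p q p.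
Proof. by rewrite -[X in dih _ _ X]mulg1; apply: dih_mull; apply: dih1. Qed.

(** Left descents of w other than p and q can be removed while p and q stay below. Once p, say, is a
    left descent, lifting puts pq below w. The purpose is a short common upper bound inside
    [1,w]. *)
Lemma two_below n p q w : (len w <= n)%N -> S p -> S q -> p <> q ->
  p <=b w -> q <=b w -> p * q <=b w \/ q * p <=b w.
Proof.
elim: n w => [|n IH] w wn Sp Sq pq pw qw.
  by have := bruhat_len pw; rewrite len_simple //; lia.
have w1 : w <> 1 by move=> e; have := bruhat_len pw; rewrite e len1 len_simple.
have [x Sx xw] := exists_left_descent w1.
have [/eqP e|/eqP xp] := boolP (x == p).
  by left; apply: lift_descl => //; rewrite -e.
have [/eqP e|/eqP xq] := boolP (x == q).
  by right; apply: lift_descl => //; rewrite -e.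
have h z : z = p \/ z = q -> z <=b w -> z <=b x * w.
  move=> zz zw; apply: lift_ascl => //.
  by case: zz => ->; apply: (@rise_notin x p q) => //; [|apply: dihC]; apply: dih_gen.
have [|e|e] := IH (x * w) _ Sp Sq pq (h p (or_introl erefl) pw) (h q (or_intror erefl) qw).
- by have := len_desc Sx xw; lia.
- by left; apply: bruhat_trans e (bruhat_descl Sx xw).
- by right; apply: bruhat_trans e (bruhat_descl Sx xw).
Qed.

(** The same removal of letters, where r can be removed too because pr and qr rise under r. *)
Lemma three_below n p q r w : (len w <= n)%N -> S p -> S q -> S r ->
  p <> q -> p <> r -> q <> r ->
  (len (p * r) < len (r * (p * r)))%N -> (len (q * r) < len (r * (q * r)))%N ->
  p * r <=b w -> q * r <=b w -> p * (q * r) <=b w \/ q * (p * r) <=b w.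
Proof.
elim: n w => [|n IH] w wn Sp Sq Sr pq pr qr rp rq pw qw.
  by have := bruhat_len pw; rewrite len_pair //; lia.
have w1 : w <> 1 by move=> e; have := bruhat_len pw; rewrite e len1 len_pair.
have [x Sx xw] := exists_left_descent w1.
have [/eqP e|/eqP xp] := boolP (x == p).
  by left; apply: lift_descl => //; rewrite -e.
have [/eqP e|/eqP xq] := boolP (x == q).
  by right; apply: lift_descl => //; rewrite -e.
have hp : p * r <=b x * w.
  apply: lift_ascl => //; have [/eqP->//|/eqP xr] := boolP (x == r).
  by apply: (@rise_notin x p r) => //; apply: dih_pair.
have hq : q * r <=b x * w.
  apply: lift_ascl => //; have [/eqP->//|/eqP xr] := boolP (x == r).
  by apply: (@rise_notin x q r) => //; apply: dih_pair.
have [|e|e] := IH (x * w) _ Sp Sq Sr pq pr qr rp rq hp hq.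
- by have := len_desc Sx xw; lia.
- by left; apply: bruhat_trans e (bruhat_descl Sx xw).
- by right; apply: bruhat_trans e (bruhat_descl Sx xw).
Qed.

Section DoublyLaced.
Variable m : W -> W -> option nat.
Hypotheses (hm : coxeter_system S m) (dl : doubly_laced S m).

Lemma braid p q : S p -> S q -> p <> q ->
  [\/ p * q = q * p, p * q * p = q * p * q | p * q * p * q = q * p * q * p].
Proof.
move=> Sp Sq pq; have [n [mst n24 _]] := cartan_pair hm dl Sp Sq pq.
have rel := coxeter_rel hm Sp Sq mst.
have inv (x y : W) : x * y = 1 -> x = y^-1 by move=> /mulg1_eq <-; rewrite invgK.
move: rel; case: n n24 {mst} => [|[|[|[|[|n]]]]] //= _; rewrite !expgS expg0 mulg1 => rel.
- by constructor 1; rewrite (inv _ _ rel) invwM !simpleV.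
- constructor 2; rewrite (inv (p * q * p) (q * p * q)); last by rewrite -rel !mulwA.
  by rewrite !invwM !simpleV // mulwA.
- constructor 3; rewrite (inv (p * q * p * q) (p * q * p * q)); last by rewrite -rel !mulwA.
  by rewrite !invwM !simpleV // !mulwA.
Qed.

Lemma reduced_not5 p q : S p -> S q -> p <> q -> ~ reduced [:: p; q; p; q; p].
Proof.
move=> Sp Sq pq [_ /=]; rewrite !word_prod_cons word_prod_nil mulg1 !mulwA => l5.
have : (len (p * q * p * q * p) <= 3)%N.
  case: (braid Sp Sq pq) => e.
  - have -> : p * q * p * q * p = p by rewrite e simpleKr // simple_sqr // mul1g.
    by rewrite len_simple.
  - by rewrite e simpleKr // simpleKr // len_simple.
  - rewrite e simpleKr //; have := @len_le C [:: q; p; q].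
    rewrite !word_prod_cons word_prod_nil mulg1 !mulwA; apply => x.
    by rewrite !inE => /or3P[] /eqP->.
by rewrite -l5.
Qed.

Lemma reduced_dih_alt p q b : S p -> S q -> p <> q -> reduced b -> word_in [set p; q] b ->
  b \in [:: [::]; [:: p]; [:: q]; [:: p; q]; [:: q; p]; [:: p; q; p]; [:: q; p; q];
         [:: p; q; p; q]; [:: q; p; q; p]].
Proof.
move=> Sp Sq pq rb bpq.
have next x y c : reduced (x :: y :: c) -> word_in [set p; q] [:: x, y & c] ->
    (x = p -> y = q) /\ (x = q -> y = p).
  by move=> /reduced2 xy /word_in_cons[_ /word_in_cons[[] /= yy _]]; split=> e; rewrite ?yy //; case: xy; rewrite yy.
case: b rb bpq => [|x1 b] //= rb bpq.
have tailr x c : reduced (x :: c) -> reduced c by case/reduced_cons.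
have tailw x c : word_in [set p; q] (x :: c) -> word_in [set p; q] c by case/word_in_cons.
have go x y c : (x = p /\ y = q) \/ (x = q /\ y = p) -> reduced (x :: c) ->
    word_in [set p; q] (x :: c) -> c = [::] \/ exists c', c = y :: c'.
  move=> xy; case: c => [|z c] rc wc; first by left.
  right; exists c; have [h1 h2] := next _ _ _ rc wc.
  by case: xy => -[xE ->]; rewrite ?(h1 xE) ?(h2 xE).
have main x y : (x = p /\ y = q) \/ (x = q /\ y = p) -> reduced (x :: b) ->
    word_in [set p; q] (x :: b) -> x :: b \in [:: [:: x]; [:: x; y]; [:: x; y; x]; [:: x; y; x; y]].
  move=> xy; have yx : (y = p /\ x = q) \/ (y = q /\ x = p) by case: xy => -[-> ->]; auto.
  move=> rc wc; have [->|[c1 cE1]] := go _ _ _ xy rc wc; first by rewrite !inE eqxx.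
  rewrite cE1 in rc wc *.
  have [->|[c2 cE]] := go _ _ _ yx (tailr _ _ rc) (tailw _ _ wc); first by rewrite !inE eqxx !orbT.
  rewrite cE in rc wc *.
  have [->|[c3 cE3]] := go _ _ _ xy (tailr _ _ (tailr _ _ rc)) (tailw _ _ (tailw _ _ wc)).
    by rewrite !inE eqxx !orbT.
  rewrite cE3 in rc wc *.
  have [->|[c4 cE4]] := go _ _ _ yx (tailr _ _ (tailr _ _ (tailr _ _ rc)))
    (tailw _ _ (tailw _ _ (tailw _ _ wc))); first by rewrite !inE eqxx !orbT.
  rewrite cE4 in rc wc *.
  have : reduced [:: x; y; x; y; x] by apply: (@reduced_catl _ c4).
  by case: xy => -[-> ->]; move=> /reduced_not5 []//; apply: nesym.
have [/= e|/= e] : [set p; q] x1 by case/word_in_cons: bpq.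
- have := main p q; rewrite e in rb bpq *; move=> /(_ (or_introl (conj erefl erefl)) rb bpq).
  by rewrite !inE => /or4P[] ->; rewrite ?orbT.
- have := main q p; rewrite e in rb bpq *; move=> /(_ (or_intror (conj erefl erefl)) rb bpq).
  by rewrite !inE => /or4P[] ->; rewrite ?orbT.
Qed.

End DoublyLaced.
End ReducedWords.

Section Tops.
Variable C : coxSystem.
Local Notation W := (cx_group C).
Local Notation S := (@cx_gens C).
Local Notation len := (length S).
Local Notation "u <=b v" := (bruhat_le S u v) (at level 70).
Implicit Types (s t p q u v w x y z : W) (a b : seq W) (M N A : W -> W).

Lemma close_fall w A x : special w A -> x <=b w ->
  exists x', [/\ x <=b x', x' <=b w, falls A x' & (len x' <= (len x).+1)%N].
Proof.
move=> sA xw; have [fx|rx] := boolP (falls A x).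
  by exists x; split=> //; apply: bruhat_refl.
have [h1 h2] := special_rise sA xw rx; exists (A x).
by rewrite h2 (special_fallsM sA xw); split=> //; apply: special_le.
Qed.

Section Pair.
Variables (w : W) (M N : W -> W).
Hypotheses (sM : special w M) (sN : special w N).

Lemma orbit_up O x k : is_top w M N x -> is_rank M N x k ->
  (forall v, O v -> O (M v) /\ O (N v)) ->
  forall v, orbit_of M N x k v -> O v -> O x.
Proof.
move=> tx [k0 ek nek] Oc v [j jk e] Ov; have [h1 h2 _] := orbit_chain sM sN tx nek.
case: e => e; rewrite {v}e in Ov; elim: j jk Ov => [//|j IH] jk Ov; apply: IH (ltnW jk) _.
- have [iw _] := h1 j (ltnW jk); rewrite -(specialK (special_if sM sN (odd j)) iw).
  by move: Ov => /=; case: (odd j) => /Oc[].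
- have [iw _] := h2 j (ltnW jk); rewrite -(specialK (special_if' sM sN (odd j)) iw).
  by move: Ov => /=; case: (odd j) => /Oc[].
Qed.

Lemma top_in_orbit x k v : is_top w M N x -> is_rank M N x k ->
  orbit_of M N x k v -> is_top w M N v -> v = x.
Proof.
move=> tx [k0 ek nek] [j jk e] [vw fM fN]; have [h1 h2 _] := orbit_chain sM sN tx nek.
case: j jk e => [|j] jk e; first by case: e.
have [iw li] := h1 j (ltnW jk); have [iw' li'] := h2 j (ltnW jk).
have [_ ki] := h1 j.+1 jk; have [_ ki'] := h2 j.+1 jk.
case: e => e.
- have l : falls (if odd j then N else M) v = false.
    by move: ki; rewrite /falls e /= (specialK (special_if sM sN (odd j)) iw); lia.
  by move: l; case: (odd j) => l; rewrite l in fM fN.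
- have l : falls (if odd j then M else N) v = false.
    by move: ki'; rewrite /falls e /= (specialK (special_if' sM sN (odd j)) iw'); lia.
  by move: l; case: (odd j) => l; rewrite l in fM fN.
Qed.

Lemma top_unique x y k l z : is_top w M N x -> is_rank M N x k ->
  is_top w M N y -> is_rank M N y l ->
  orbit_of M N x k z -> orbit_of M N y l z -> x = y.
Proof.
move=> tx rx ty ry zx zy; apply: (top_in_orbit ty ry) => //.
by apply: (orbit_up tx rx _ zx zy) => v; apply: (orbit_closed sM sN ty ry).
Qed.

(** Orbits with a common element have the same top; the comparisons of ranks below look for such an
    element. *)
Lemma rank_unique x y k l z : is_top w M N x -> is_rank M N x k ->
  is_top w M N y -> is_rank M N y l ->
  orbit_of M N x k z -> orbit_of M N y l z -> k = l.
Proof.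
move=> tx rx ty ry zx zy; apply: (is_rank_uniq rx).
by rewrite (top_unique tx rx ty ry zx zy).
Qed.

Lemma in_orbit x k j : (j <= k)%N -> orbit_of M N x k (alt M N j x).
Proof. by move=> jk; exists j => //; left. Qed.

Lemma in_orbit' x k j : (j <= k)%N -> orbit_of M N x k (alt N M j x).
Proof. by move=> jk; exists j => //; right. Qed.

Lemma bottom_rises x k : is_top w M N x -> is_rank M N x k ->
  ~~ falls M (alt M N k x) /\ ~~ falls N (alt M N k x).
Proof.
move=> tx rx; have [k0 ek nek] := rx; have [h1 h2 _] := orbit_chain sM sN tx nek.
have k1 : k = k.-1.+1 by rewrite prednK.
have [iw li] := h1 k.-1 (leq_pred _); have [iw' li'] := h2 k.-1 (leq_pred _).
have [uw lu] := h1 k (leqnn _); have [uw' lu'] := h2 k (leqnn _).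
have E : alt M N k x = (if odd k.-1 then N else M) (alt M N k.-1 x) by rewrite [in LHS]k1.
have E' : alt N M k x = (if odd k.-1 then M else N) (alt N M k.-1 x) by rewrite [in LHS]k1.
have a : ~~ falls (if odd k.-1 then N else M) (alt M N k x).
  by rewrite /falls {1}E (specialK (special_if sM sN (odd k.-1)) iw); lia.
have b : ~~ falls (if odd k.-1 then M else N) (alt M N k x).
  by rewrite /falls ek {1}E' (specialK (special_if' sM sN (odd k.-1)) iw'); lia.
by move: a b; case: (odd _) => a b; split.
Qed.

Lemma bottom_ne x k : is_top w M N x -> is_rank M N x k -> (1 < k)%N ->
  M (alt M N k x) <> N (alt M N k x).
Proof.
move=> tx rx kgt; have [k0 ek nek] := rx; have [h1 h2 _] := orbit_chain sM sN tx nek.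
have k1 : k = k.-1.+1 by rewrite prednK.
have [iw _] := h1 k.-1 (leq_pred _); have [iw' _] := h2 k.-1 (leq_pred _).
have a : (if odd k.-1 then N else M) (alt M N k x) = alt M N k.-1 x.
  by rewrite {2}k1 /= (specialK (special_if sM sN (odd k.-1)) iw).
have b : (if odd k.-1 then M else N) (alt M N k x) = alt N M k.-1 x.
  by rewrite ek {2}k1 /= (specialK (special_if' sM sN (odd k.-1)) iw').
have ne : alt M N k.-1 x <> alt N M k.-1 x by apply: nek; lia.
by move: ne; rewrite -a -b; case: (odd _) => // ne /esym.
Qed.

Lemma rank2_bottom y : is_top w M N y -> is_rank M N y 2 -> M (N (alt M N 2 y)) = y.
Proof.
move=> ty [_ _ nek]; have [h1 h2 _] := orbit_chain sM sN ty nek.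
have [yw _] := h1 0%N isT; have [y1w _] := h1 1%N isT.
by rewrite /= (specialK sN) // (specialK sM).
Qed.

Lemma rank3_bottom y : is_top w M N y -> is_rank M N y 3 -> let u := alt M N 3 y in
  [/\ N (M (N u)) = y, M (N (M u)) = y & M u <> N u].
Proof.
move=> ty [_ ek nek]; have [h1 h2 _] := orbit_chain sM sN ty nek.
have [yw _] := h1 0%N isT; have [y1w _] := h1 1%N isT; have [y2w _] := h1 2%N isT.
have [y1w' _] := h2 1%N isT; have [y2w' _] := h2 2%N isT.
have Mu : M (alt M N 3 y) = alt M N 2 y by apply: (specialK sM).
have Nu : N (alt M N 3 y) = alt N M 2 y by rewrite ek; apply: (specialK sN).
rewrite /= -[M (N (M y))]/(alt M N 3 y) Mu Nu /=; split; last exact: (nek 2%N isT).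
- by rewrite (specialK sM) // (specialK sN).
- by rewrite (specialK sN) // (specialK sM).
Qed.

End Pair.
End Tops.

(** * All orbits with more than two elements have the same size *)

Section UniformRanks.
Variable C : coxSystem.
Local Notation W := (cx_group C).
Local Notation S := (@cx_gens C).
Local Notation len := (length S).
Local Notation "u <=b v" := (bruhat_le S u v) (at level 70).
Implicit Types (s t p q u v w x y z : W) (a b : seq W) (M N A : W -> W).
Variable m : W -> W -> option nat.
Hypotheses (hm : coxeter_system S m) (dl : doubly_laced S m).

Lemma dih_cases p q y : S p -> S q -> p <> q -> dih p q y ->
  exists b, [/\ reduced b, word_prod b = y, size b = len y &
    b \in [:: [::]; [:: p]; [:: q]; [:: p; q]; [:: q; p]; [:: p; q; p]; [:: q; p; q];
         [:: p; q; p; q]; [:: q; p; q; p]]].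
Proof.
move=> Sp Sq pq /(dih_reduced Sp Sq)[b [bpq by_ sb]]; exists b.
have rb : reduced b by split; [apply: dihS bpq|rewrite by_].
by split=> //; apply: (reduced_dih_alt hm dl).
Qed.

Lemma dih_len4 p q y : S p -> S q -> p <> q -> dih p q y -> (len y <= 4)%N.
Proof.
move=> Sp Sq pq /(dih_cases Sp Sq pq)[b [_ _ <- +]].
by move: b; apply/(@allP _ (fun b => size b <= 4)%N).
Qed.

Lemma dih_len1 p q y : S p -> S q -> p <> q -> dih p q y -> (len y = 1)%N -> y = p \/ y = q.
Proof. by move=> Sp Sq pq dy /len1_simple Sy; apply: dih_simple dy. Qed.

Lemma dih_len2 p q y : S p -> S q -> p <> q -> dih p q y -> len y = 2%N ->
  y = p * q \/ y = q * p.
Proof.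
move=> Sp Sq pq /(dih_cases Sp Sq pq)[b [_ <- <- +]].
by rewrite !inE => /or3P[/eqP->|/eqP->|/or3P[/eqP->|/eqP->|/or3P[/eqP->|/eqP->|
   /or3P[/eqP->|/eqP->|/eqP->]]]] // _; rewrite !word_prod_cons word_prod_nil mulg1; auto.
Qed.

Lemma dih_len4_uniq p q y z : S p -> S q -> p <> q -> dih p q y -> dih p q z ->
  len y = 4%N -> len z = 4%N -> y = z.
Proof.
move=> Sp Sq pq; have cases x : dih p q x -> len x = 4%N -> x = p * q * p * q \/ x = q * p * q * p.
  move=> /(dih_cases Sp Sq pq)[b [_ <- <- +]].
  by rewrite !inE => /or3P[/eqP->|/eqP->|/or3P[/eqP->|/eqP->|/or3P[/eqP->|/eqP->|
   /or3P[/eqP->|/eqP->|/eqP->]]]] // _; rewrite !word_prod_cons word_prod_nil mulg1 !mulwA; auto.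
suff E : len (p * q * p * q) = 4%N -> p * q * p * q = q * p * q * p.
  move=> /cases cy /cases cz l4y l4z; move: (cy l4y) (cz l4z) => [yE|yE] [zE|zE]; rewrite yE zE //.
  - by apply: E; rewrite -yE.
  - case: (braid hm dl Sp Sq pq) => e //.
    + by move: l4y; rewrite yE -e simpleKr // simple_sqr // len1.
    + by move: l4y; rewrite yE -e simpleKr // len_pair.
move=> l4; case: (braid hm dl Sp Sq pq) => e //.
- by move: l4; rewrite e simpleKr // simple_sqr // len1.
- by move: l4; rewrite e simpleKr // len_pair //; apply: nesym.
Qed.

Section Left.
Variables (w r : W) (M : W -> W).
Hypotheses (Sr : S r) (rw : (len (r * w) < len w)%N) (sM : special w M).
Local Notation N := (fun v => r * v).

Let sN : special w N := special_left Sr rw.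

Lemma matching1 : S (M 1) /\ M (M 1) = 1.
Proof.
have w1 := bruhat1 w; split; last by rewrite (specialK sM).
have r1 : ~~ falls M 1 by rewrite /falls len1.
by apply: len1_simple; have [_ ->] := special_rise sM w1 r1; rewrite len1.
Qed.

Lemma top_gens y : is_top w M N y -> r <=b y /\ M 1 <=b y.
Proof.
move=> [yw fM fN]; split.
  by rewrite -[r]mulg1; apply: lift_descl => //; apply: bruhat1.
by apply: (special_falls_le sM _ yw fM); apply: bruhat1.
Qed.

Lemma bottom_neq y k : is_top w M N y -> is_rank M N y k ->
  let u := alt M N k y in [/\ u <> r, u <> M 1, u <=b y & (len u + k)%N = len y].
Proof.
move=> ty rk; have [a b] := bottom_rises sM sN ty rk.
have [k0 ek nek] := rk; have [h1 h2 h3] := orbit_chain sM sN ty nek.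
have [_ l] := h1 k (leqnn k); split=> //.
- by move=> e; move: b; rewrite e /falls simple_sqr // len1 len_simple.
- by move=> e; move: a; rewrite e /falls; have [? ->] := matching1; rewrite len1 len_simple.
have mono : forall j, (j <= k)%N -> alt M N j y <=b y.
  elim=> [_|j IH jk]; first exact: bruhat_refl.
  by apply: bruhat_trans (IH (ltnW jk)); have [] := h3 j jk.
exact: mono.
Qed.

Section DistinctAtOne.
Hypothesis rs : r <> M 1.

Lemma dihedral_top_distinct y s t : S s -> S t -> dih s t y -> is_top w M N y -> dih r (M 1) y.
Proof.
move=> Ss St d ty; have [ry sy] := top_gens ty; have [Ss' _] := matching1.
have [rE|rE] := dih_simple Ss St Sr (dih_down Ss St ry d);
have [sE|sE] := dih_simple Ss St Ss' (dih_down Ss St sy d).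
- by case: rs; rewrite rE sE.
- by rewrite rE sE.
- by rewrite rE sE; apply: dihC.
- by case: rs; rewrite rE sE.
Qed.

(** The bottom rises under M and N, so it is neither r nor M 1, and lengths in the dihedral subgroup
    are at most 4. With k > 1 this leaves length 0, or length 2 under a top of length 4. *)
Lemma bottom_distinct y k : dih r (M 1) y -> is_top w M N y -> is_rank M N y k -> (1 < k)%N ->
  (alt M N k y = 1 /\ len y = k) \/ [/\ k = 2%N, len y = 4%N & len (alt M N k y) = 2%N].
Proof.
move=> d ty rk k1; have [Ss _] := matching1; have [ur us uy lu] := bottom_neq ty rk.
have l4 := dih_len4 Sr Ss rs d; have du := dih_down Sr Ss uy d.
case E : (len (alt M N k y)) lu => [|[|n]] lu.
- by left; split; [apply: len0|lia].
- by have [] := dih_len1 Sr Ss rs du E.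
- by right; split; lia.
Qed.

(** Orbits with bottom 1 coincide. In the mixed case an orbit with bottom 1 and k = 4 has the same
    top as the other one; if k = 3, its two elements of length 2 are all those of the dihedral
    subgroup, so the other bottom is among them. *)
Lemma uniform_distinct y1 y2 k1 k2 : dih r (M 1) y1 -> dih r (M 1) y2 ->
  is_top w M N y1 -> is_rank M N y1 k1 -> (1 < k1)%N ->
  is_top w M N y2 -> is_rank M N y2 k2 -> (1 < k2)%N -> k1 = k2.
Proof.
have mixed z1 z2 l1 l2 : dih r (M 1) z1 -> dih r (M 1) z2 ->
    is_top w M N z1 -> is_rank M N z1 l1 -> (1 < l1)%N ->
    is_top w M N z2 -> is_rank M N z2 l2 ->
    len z1 = l1 -> l2 = 2%N -> len z2 = 4%N -> len (alt M N l2 z2) = 2%N -> l1 = l2.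
  move=> d1 d2 t1 r1 l11 t2 r2 len1 l22 len2 lu; have [Ss _] := matching1.
  have l4 := dih_len4 Sr Ss rs d1.
  have [e|n4] := eqVneq (len z1) 4%N.
    have zz := dih_len4_uniq Sr Ss rs d1 d2 e len2; rewrite zz in r1.
    exact: is_rank_uniq r1 r2.
  have [e|n3] := eqVneq (len z1) 3%N; last by lia.
  have [k0 ek nek] := r1; have [h1 h2 h3] := orbit_chain sM sN t1 nek.
  have [_ b1] := h1 1%N k0; have [_ b2] := h2 1%N k0; have [c1 _ c2 _] := h3 0%N k0.
  have ne := nek 1%N l11.
  have [_ _ uz2 _] := bottom_neq t2 r2.
  have two z : dih r (M 1) z -> len z = 2%N -> z = r * M 1 \/ z = M 1 * r by apply: dih_len2.
  have [f1 f2 f3] : [/\ alt M N 1 z1 = r * M 1 \/ alt M N 1 z1 = M 1 * r,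
      alt N M 1 z1 = r * M 1 \/ alt N M 1 z1 = M 1 * r &
      alt M N l2 z2 = r * M 1 \/ alt M N l2 z2 = M 1 * r].
    split; apply: two => //; [exact: (dih_down Sr Ss c1 d1)|lia|
      exact: (dih_down Sr Ss c2 d1)|lia|exact: (dih_down Sr Ss uz2 d2)].
  have : alt M N l2 z2 = alt M N 1 z1 \/ alt M N l2 z2 = alt N M 1 z1.
    by move: ne; case: f1 => ->; case: f2 => ->; case: f3 => ->; auto; case.
  have inO2 := @in_orbit _ M N z2 l2 l2 (leqnn _).
  move=> [E|E]; apply: (rank_unique sM sN t1 r1 t2 r2 (z := alt M N l2 z2)) => //; rewrite E.
  - exact: in_orbit.
  - exact: in_orbit'.
move=> d1 d2 t1 r1 l1 t2 r2 l2.
have inO y k : orbit_of M N y k (alt M N k y) by apply: in_orbit.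
have [[u1 e1]|[e1 e1' e1'']] := bottom_distinct d1 t1 r1 l1;
have [[u2 e2]|[e2 e2' e2'']] := bottom_distinct d2 t2 r2 l2.
- by apply: (rank_unique sM sN t1 r1 t2 r2 (z := 1)); [rewrite -u1|rewrite -u2].
- exact: (mixed y1 y2).
- by apply/esym/(mixed y2 y1).
- by rewrite e1 e2.
Qed.

End DistinctAtOne.

Section SameAtOne.
Hypothesis rs : M 1 = r.

(** If y lay in the subgroup generated by r alone, it would be r itself, where both matchings have
    the value 1. *)
Lemma dihedral_top_same y s t k : S s -> S t -> dih s t y -> is_top w M N y -> is_rank M N y k ->
  (1 < k)%N -> exists t', [/\ S t', t' <> r & dih r t' y].
Proof.
move=> Ss St d ty rk k1; have [ry _] := top_gens ty.
have [p Sp dp] : exists2 p, S p & dih r p y.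
  case: (dih_simple Ss St Sr (dih_down Ss St ry d)) => ->; first by exists t.
  by exists s => //; apply: dihC.
exists p; split=> // pr; rewrite pr in dp.
have [a [ha ya sa]] := dih_reduced Sr Sr dp.
have ra : reduced a by split; [apply: dihS ha|rewrite ya].
have yr : y = r.
  have [_ _ fN] := ty; case: a ha ya ra sa => [|x [|z a]] ha ya ra sa.
  - by move: fN; rewrite -ya word_prod_nil /falls len1.
  - have := ha x; rewrite inE eqxx => /(_ isT) xr.
    by rewrite -ya word_prod_cons word_prod_nil mulg1; case: xr.
  - have := ha x; have := ha z; rewrite !inE !eqxx orbT => /(_ isT) zr /(_ isT) xr.
    by case: (reduced2 ra); case: zr => /= ->; case: xr => /= ->.
have [_ _ /(_ 1%N k1)] := rk; case; rewrite /= yr simple_sqr //.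
by have [_ <-] := matching1; rewrite rs.
Qed.

(** M and N agree at 1, so the bottom is not 1 when k > 1; being different from r and rising under
    r, it is t or tr. *)
Lemma bottom_same t y k : S t -> t <> r -> dih r t y -> is_top w M N y -> is_rank M N y k ->
  (1 < k)%N -> let u := alt M N k y in
  [\/ [/\ k = 3%N, len y = 4%N & u = t], [/\ k = 2%N, len y = 3%N & u = t] |
      [/\ k = 2%N, len y = 4%N & u = t * r]].
Proof.
move=> St tr d ty rk k1; have rt := nesym tr; have [ur us uy lu] := bottom_neq ty rk.
have l4 := dih_len4 Sr St rt d; have du := dih_down Sr St uy d.
have ne := bottom_ne sM sN ty rk k1; have [_ ri] := bottom_rises sM sN ty rk.
have u1 : alt M N k y <> 1 by move=> e; move: ne; rewrite e rs mulg1.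
have [l0|[l1|l2]] : len (alt M N k y) = 0%N \/ len (alt M N k y) = 1%N \/
  len (alt M N k y) = 2%N by lia.
- by case: u1; apply: len0.
- have ut : alt M N k y = t by have [] := dih_len1 Sr St rt du l1.
  by have [k2|k3] := eqVneq k 2%N; [constructor 2|constructor 1]; split=> //; lia.
- constructor 3; split; try lia; case: (dih_len2 Sr St rt du l2) => // e.
  by move: ri; rewrite /falls e simpleK // len_simple // len_pair.
Qed.

(** A reduced word of x contains a reduced word of z2, which is free of t, and also at least two
    letters t, coming from a reduced word of z1. *)
Lemma letters_bound t t2 z1 z2 x : S t -> S t2 -> t <> r -> t <> t2 ->
  z1 <=b x -> z2 <=b x -> dih r t2 z2 ->
  (forall b, reduced b -> word_prod b = z1 -> (1 < count_mem t b)%N) ->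
  (len z2 + 2 <= len x)%N.
Proof.
move=> St St2 tr tt2 z1x z2x d two; have [a [Sa <- ax]] := lenP x.
have [b [ba bz sb]] := subword z1x Sa ax; have [c [ca cz sc]] := subword z2x Sa ax.
have rb : reduced b by split; [apply: word_in_subseq Sa|rewrite bz].
have rc : reduced c by split; [apply: word_in_subseq Sa|rewrite cz].
have c2 : word_in [set r; t2] c by apply: reduced_dih; rewrite ?cz.
rewrite -(count_predC (pred1 t) a) -sc addnC leq_add //.
  exact: leq_trans (two _ rb bz) (leq_count_subseq _ ba).
apply: leq_trans (leq_count_subseq _ ca).
suff: all (predC (pred1 t)) c by rewrite all_count => /eqP->.
by apply/allP => y /c2[] /= ->; apply/eqP; apply: nesym.
Qed.

(** Among the alternating words of length three only rtr has a single t, and it falls under r. *)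
Lemma two_letters t z b : S t -> t <> r -> dih r t z ->
  (len z = 3%N /\ ~~ falls N z) \/ len z = 4%N -> reduced b -> word_prod b = z ->
  (1 < count_mem t b)%N.
Proof.
move=> St tr d hz rb bz; have rt := nesym tr.
have sz : size b = len z by have [_ ->] := rb; rewrite bz.
have : word_in [set r; t] b by apply: reduced_dih; rewrite ?bz.
move=> /(reduced_dih_alt hm dl Sr St rt rb).
have [e1 e2] : (r == t) = false /\ (t == r) = false by split; apply/eqP.
rewrite !inE => /or3P[/eqP e|/eqP e|/or3P[/eqP e|/eqP e|/or3P[/eqP e|/eqP e|
   /or3P[/eqP e|/eqP e|/eqP e]]]]; rewrite e /= ?eqxx ?e1 //; rewrite e /= in sz;
  rewrite -sz in hz; try by case: hz => [[]|].
have zE : z = r * (t * r) by rewrite -bz e !word_prod_cons word_prod_nil mulg1.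
by case: hz => [[_]|//]; rewrite /falls -sz zE simpleK // len_pair.
Qed.

(** Here t and t2 differ, as otherwise the second bottom, t or tr, would lie in the first orbit. If
    the second bottom is t2, a common upper bound of t and t2 of length at most 2, closed under r
    and M, has length at most 4 and lies above [M (r * t)] and y2; [letters_bound] asks for length
    5. If it is t2 r, the same argument with tr and t2 r has 5 against 6. *)
Lemma rank3_rank2_absurd y1 y2 t t2 : S t -> S t2 -> t <> r -> t2 <> r ->
  dih r t y1 -> dih r t2 y2 ->
  is_top w M N y1 -> is_rank M N y1 3 -> is_top w M N y2 -> is_rank M N y2 2 -> False.
Proof.
move=> St St2 tr t2r d1 d2 ty1 r1 ty2 r2; have rt := nesym tr; have rt2 := nesym t2r.
have [[_ l1 u1]|[]|[]] // := bottom_same St tr d1 ty1 r1 isT.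
have [f1 f2 f3] := rank3_bottom sM sN ty1 r1; rewrite u1 in f1 f2 f3.
have g := rank2_bottom sM sN ty2 r2.
have [h1 h2 h3] := orbit_chain sM sN ty1 (let: And3 _ _ h := r1 in h).
have [yw1 _] := h1 0%N isT; have [_ b2] := h2 1%N isT; have [a1w a1] := h1 1%N isT.
have [a2w a2] := h1 2%N isT; have [b2w b22] := h2 2%N isT.
have [p1 _ p2 _] := h3 0%N isT; have [q1 _ q2 _] := h3 1%N isT; have [v1 _ _ _] := h3 2%N isT.
have tE : alt M N 3 y1 = t by [].
have tw : t <=b w.
  by rewrite -tE; have [] := h1 3%N isT.
have Mt : M t = alt M N 2 y1 by rewrite -tE; apply: (specialK sM).
have Nt : r * t = alt N M 2 y1.
  have [_ ek _] := r1; rewrite -tE ek; exact: (specialK sN b2w).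
have Mtr : M t = t * r.
  have [||e|//] := dih_len2 Sr St rt (y := M t).
  - rewrite Mt; apply: (dih_down Sr St _ d1); apply: bruhat_trans p1.
    exact: q1.
  - by rewrite Mt; lia.
  - by case: f3.
have rise p q : S p -> S q -> p <> q -> (len q < len (p * q))%N.
  by move=> Sp Sq pq; rewrite len_pair // len_simple.
have inO y k : orbit_of M N y k (alt M N k y) by apply: in_orbit.
have tt2 : t <> t2.
  move=> e; have : 3%N = 2%N; last by [].
  apply: (rank_unique sM sN ty1 r1 ty2 r2 (z := alt M N 2 y2)) => //.
  have [[]|[_ _ ->]|[_ _ ->]] // := bottom_same St2 t2r d2 ty2 r2 isT; rewrite -e.
  - by rewrite -tE; apply: inO.
  - by rewrite -Mtr Mt; apply: in_orbit.
have [u2w _] := orbit_chain sM sN ty2 (let: And3 _ _ h := r2 in h).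
have [{}u2w lu2] := u2w 2%N isT.
(* Closing x under r and then under M costs at most two letters. *)
have bound x : x <=b w -> exists x2, (len x2 <= (len x).+2)%N /\
    forall z, z <=b x -> M (r * z) <=b x2.
  move=> xw; have [x1 [xx1 x1w fN1 lx1]] := close_fall sN xw.
  have [x2 [xx2 x2w fM2 lx2]] := close_fall sM x1w.
  exists x2; split=> [|z zx]; first by lia.
  apply: (special_falls_le sM _ x2w fM2); apply: bruhat_trans xx2.
  by apply: lift_descl => //; apply: bruhat_trans xx1.
have [[]|[_ l2 u2]|[_ l2 u2]] // := bottom_same St2 t2r d2 ty2 r2 isT; rewrite u2 in g u2w.
- have Mrt : M (r * t) = alt N M 1 y1.
    by rewrite Nt; apply: (specialK sM); have [] := h2 1%N isT.
  have dN1 : dih r t (M (r * t)) by rewrite Mrt; apply: (dih_down Sr St p2 d1).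
  have lN1 : len (M (r * t)) = 3%N by rewrite Mrt; lia.
  have riN1 : ~~ falls N (M (r * t)) by rewrite /falls [r * M (r * t)]f1 lN1 l1.
  have [x [x3 xw tx t2x]] : exists x, [/\ (len x <= 2)%N, x <=b w, t <=b x & t2 <=b x].
    have [h|h] := two_below (leqnn _) St St2 tt2 tw u2w; [exists (t * t2)|exists (t2 * t)];
      rewrite len_pair //; try exact: nesym; split=> //.
    + by rewrite -{1}[t]mulg1; apply: lift_monol => //; [apply: bruhat1|apply: rise].
    + by apply: bruhat_ascl => //; apply: rise.
    + by apply: bruhat_ascl => //; apply: rise => //; apply: nesym.
    + by rewrite -{1}[t2]mulg1; apply: lift_monol => //; [apply: bruhat1|apply: rise => //; apply: nesym].
  have [x2 [lx2 up]] := bound x xw.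
  have := letters_bound St St2 tr tt2 (up _ tx) (up _ t2x); rewrite g l2 => bd.
  have {}bd := bd d2 (fun b => two_letters St tr dN1 (or_introl (conj lN1 riN1))).
  by lia.
- have x3E p q : S p -> S q -> p <> q -> p <> r -> q <> r ->
      [/\ (len (p * (q * r)) <= 3)%N, p * r <=b p * (q * r) & q * r <=b p * (q * r)].
    move=> Sp Sq pq pr qr.
    have ri : (len (q * r) < len (p * (q * r)))%N by apply: (@rise_notin C p q r) => //; apply: dih_pair.
    split; last exact: bruhat_ascl.
      by have := len_pair Sq Sr qr; case: (len_mulS (q * r) Sp) => e; move: ri; rewrite ?e; lia.
    by apply: lift_monol => //; apply: bruhat_ascl => //; apply: rise.
  have ri1 : (len (t * r) < len (r * (t * r)))%N.
    have -> : r * (t * r) = alt M N 1 y1 by rewrite -Mtr Mt /= simpleK.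
    by rewrite len_pair //; lia.
  have ri2 : (len (t2 * r) < len (r * (t2 * r)))%N.
    by rewrite -u2; have [_] := bottom_rises sM sN ty2 r2; rewrite /falls => h; rewrite len_mul_lt.
  have trw : t * r <=b w by rewrite -Mtr; apply: (special_le sM).
  have [x [x3 xw tx t2x]] :
      exists x, [/\ (len x <= 3)%N, x <=b w, t * r <=b x & t2 * r <=b x].
    have [h|h] := three_below (leqnn _) St St2 Sr tt2 tr t2r ri1 ri2 trw u2w.
    + by exists (t * (t2 * r)); have [] := x3E t t2 St St2 tt2 tr t2r.
    + by exists (t2 * (t * r)); have [] := x3E t2 t St2 St (nesym tt2) t2r tr.
  have [x2 [lx2 up]] := bound x xw.
  have := letters_bound St St2 tr tt2 (up _ tx) (up _ t2x); rewrite g l2 => bd.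
  have dy1 : dih r t (M (r * (t * r))) by rewrite -Mtr f2.
  have ly1 : len (M (r * (t * r))) = 4%N by rewrite -Mtr f2.
  have {}bd := bd d2 (fun b => two_letters St tr dy1 (or_intror ly1)).
  by lia.
Qed.

End SameAtOne.

Lemma uniform_left x1 x2 k1 k2 : is_top w M N x1 -> is_rank M N x1 k1 -> (1 < k1)%N ->
  is_top w M N x2 -> is_rank M N x2 k2 -> (1 < k2)%N -> k1 = k2 /\ (k1 <= 4)%N.
Proof.
move=> tx1 rx1 l1 tx2 rx2 l2.
have [y1 [s1 [t1 [Ss1 St1 d1 ty1 r1]]]] := dihedral_top hm dl Sr rw sM (leqnn _) tx1 rx1 l1.
have [y2 [s2 [t2 [Ss2 St2 d2 ty2 r2]]]] := dihedral_top hm dl Sr rw sM (leqnn _) tx2 rx2 l2.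
have [_ _ _ b1] := bottom_neq ty1 r1.
have [rs|/eqP rs] := eqVneq (M 1) r.
  have [p1 [Sp1 pr1 {}d1]] := dihedral_top_same rs Ss1 St1 d1 ty1 r1 l1.
  have [p2 [Sp2 pr2 {}d2]] := dihedral_top_same rs Ss2 St2 d2 ty2 r2 l2.
  have l4 := dih_len4 Sr Sp1 (nesym pr1) d1; split; last by lia.
  have c1 : k1 = 3%N \/ k1 = 2%N.
    by case: (bottom_same rs Sp1 pr1 d1 ty1 r1 l1) => -[]; auto.
  have c2 : k2 = 3%N \/ k2 = 2%N.
    by case: (bottom_same rs Sp2 pr2 d2 ty2 r2 l2) => -[]; auto.
  case: c1 c2 => e1 [] e2; rewrite e1 e2 // in r1 r2 *.
  - by case: (rank3_rank2_absurd rs Sp1 Sp2 pr1 pr2 d1 d2 ty1 r1 ty2 r2).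
  - by case: (rank3_rank2_absurd rs Sp2 Sp1 pr2 pr1 d2 d1 ty2 r2 ty1 r1).
have {}d1 := dihedral_top_distinct (nesym rs) Ss1 St1 d1 ty1.
have {}d2 := dihedral_top_distinct (nesym rs) Ss2 St2 d2 ty2.
have [S1 _] := matching1; have l4 := dih_len4 Sr S1 (nesym rs) d1.
by split; [apply: (uniform_distinct (nesym rs) d1 d2 ty1 r1 l1 ty2 r2 l2)|lia].
Qed.

End Left.

Lemma alt_inv M N j x : alt (inv_map M) (inv_map N) j x^-1 = (alt M N j x)^-1.
Proof. by elim: j => //= j ->; case: (odd j); rewrite /inv_map invgK. Qed.

Lemma is_top_inv w M N x : is_top w M N x -> is_top w^-1 (inv_map M) (inv_map N) x^-1.
Proof.
by move=> [/bruhatV xw fM fN]; split=> //; rewrite /falls /inv_map invgK !lenV.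
Qed.

Lemma is_rank_inv M N x k : is_rank M N x k -> is_rank (inv_map M) (inv_map N) x^-1 k.
Proof.
move=> [k0 ek nek]; split=> // [|j jk]; rewrite !alt_inv; first by rewrite ek.
by move=> e; apply: (nek j jk); apply: (@invg_inj W).
Qed.

Lemma uniform_right w p M x1 x2 k1 k2 : S p -> (len (w * p) < len w)%N -> special w M ->
  let N := (fun v => v * p) in
  is_top w M N x1 -> is_rank M N x1 k1 -> (1 < k1)%N ->
  is_top w M N x2 -> is_rank M N x2 k2 -> (1 < k2)%N -> k1 = k2 /\ (k1 <= 4)%N.
Proof.
move=> Sp wp sM N /is_top_inv t1 /is_rank_inv r1 l1 /is_top_inv t2 /is_rank_inv r2 l2.
have NE : inv_map N = fun v => p * v.
  by apply/funext => v; rewrite /inv_map /N invwM invgK (simpleV Sp).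
rewrite NE in t1 r1 t2 r2.
apply: (@uniform_left w^-1 p (inv_map M) Sp _ (special_inv sM) _ _ _ _ t1 r1 l1 t2 r2 l2).
by rewrite -len_mulr_inv // lenV.
Qed.

End UniformRanks.

(** * The recursion along special matchings *)

Section Braid.
Variable T : Type.
Local Notation fn := (T -> {poly int}).
Variables (X Y : fn -> fn).
Local Open Scope ring_scope.

(** Here and in the next two lemmas p is the top and z the bottom of a 2k-gon, and X, Y act along
    its edges like generators of the Hecke algebra of a dihedral group of order 2k; the braid
    relation is checked vertex by vertex. *)
Lemma braid2 p a b z (f : fn) :
  (forall g, X g p = g a) -> (forall g, X g a = ('X - 1) * g a + 'X * g p) ->
  (forall g, Y g p = g b) -> (forall g, Y g b = ('X - 1) * g b + 'X * g p) ->
  (forall g, Y g a = g z) -> (forall g, Y g z = ('X - 1) * g z + 'X * g a) ->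
  (forall g, X g b = g z) -> (forall g, X g z = ('X - 1) * g z + 'X * g b) ->
  forall v, v = p \/ v = a \/ v = b \/ v = z -> X (Y f) v = Y (X f) v.
Proof.
move=> h1 h2 h3 h4 h5 h6 h7 h8 v.
case=> [->|[->|[->|->]]]; rewrite !(h1, h2, h3, h4, h5, h6, h7, h8); ring.
Qed.

Lemma braid3 p a b c d z (f : fn) :
  (forall g, X g p = g a) -> (forall g, X g a = ('X - 1) * g a + 'X * g p) ->
  (forall g, Y g p = g b) -> (forall g, Y g b = ('X - 1) * g b + 'X * g p) ->
  (forall g, Y g a = g c) -> (forall g, Y g c = ('X - 1) * g c + 'X * g a) ->
  (forall g, X g b = g d) -> (forall g, X g d = ('X - 1) * g d + 'X * g b) ->
  (forall g, X g c = g z) -> (forall g, X g z = ('X - 1) * g z + 'X * g c) ->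
  (forall g, Y g d = g z) -> (forall g, Y g z = ('X - 1) * g z + 'X * g d) ->
  forall v, v = p \/ v = a \/ v = b \/ v = c \/ v = d \/ v = z ->
  X (Y (X f)) v = Y (X (Y f)) v.
Proof.
move=> h1 h2 h3 h4 h5 h6 h7 h8 h9 h10 h11 h12 v.
case=> [->|[->|[->|[->|[->|->]]]]];
  rewrite !(h1, h2, h3, h4, h5, h6, h7, h8, h9, h10, h11, h12); ring.
Qed.

Lemma braid4 p a b c d e i z (f : fn) :
  (forall g, X g p = g a) -> (forall g, X g a = ('X - 1) * g a + 'X * g p) ->
  (forall g, Y g p = g b) -> (forall g, Y g b = ('X - 1) * g b + 'X * g p) ->
  (forall g, Y g a = g c) -> (forall g, Y g c = ('X - 1) * g c + 'X * g a) ->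
  (forall g, X g b = g d) -> (forall g, X g d = ('X - 1) * g d + 'X * g b) ->
  (forall g, X g c = g e) -> (forall g, X g e = ('X - 1) * g e + 'X * g c) ->
  (forall g, Y g d = g i) -> (forall g, Y g i = ('X - 1) * g i + 'X * g d) ->
  (forall g, Y g e = g z) -> (forall g, Y g z = ('X - 1) * g z + 'X * g e) ->
  (forall g, X g i = g z) -> (forall g, X g z = ('X - 1) * g z + 'X * g i) ->
  forall v, v = p \/ v = a \/ v = b \/ v = c \/ v = d \/ v = e \/ v = i \/ v = z ->
  X (Y (X (Y f))) v = Y (X (Y (X f))) v.
Proof.
move=> h1 h2 h3 h4 h5 h6 h7 h8 h9 h10 h11 h12 h13 h14 h15 h16 v.
case=> [->|[->|[->|[->|[->|[->|[->|->]]]]]]];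
  rewrite !(h1, h2, h3, h4, h5, h6, h7, h8, h9, h10, h11, h12, h13, h14, h15, h16); ring.
Qed.

End Braid.

Section Matchings.
Variable C : coxSystem.
Local Notation W := (cx_group C).
Local Notation S := (@cx_gens C).
Local Notation len := (length S).
Local Notation "u <=b v" := (bruhat_le S u v) (at level 70).
Implicit Types (s t p q u v w x y z : W) (M N A : W -> W) (f g : W -> {poly int}).

(** With f = R(-, Mw) this is the right-hand side of the recursion for R(-, w), read as an operator
    so that recursions can be composed. *)
Definition hecke M f v : {poly int} :=
  (if falls M v then f (M v) else ('X - 1) * f v + 'X * f (M v))%R.

Fixpoint heckes M N k f : W -> {poly int} :=
  if k is j.+1 then hecke M (heckes N M j f) else f.

Definition matching_R (R : W -> W -> {poly int}) : Prop :=
  [/\ forall v w, ~ v <=b w -> R v w = 0%R,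
      forall w, R w w = 1%R &
      forall w M v, special w M -> v <=b w -> R v w = hecke M (R^~ (M w)) v].

Lemma special_falls_top w M : special w M -> falls M w.
Proof.
move=> sM; have ww := @bruhat_refl C w; apply/negPn/negP => h.
have [_] := special_rise sM ww h; have := bruhat_len (special_le sM ww); lia.
Qed.

Section Pair.
Variables (w : W) (M N : W -> W).
Hypotheses (sM : special w M) (sN : special w N).

Lemma hecke_ext A f g v : special w A -> (forall v, v <=b w -> f v = g v) -> v <=b w ->
  hecke A f v = hecke A g v.
Proof. by move=> sA fg vw; rewrite /hecke !fg //; apply: special_le. Qed.

Lemma exists_top n v : (len w - len v <= n)%N -> v <=b w ->
  exists x k, [/\ is_top w M N x, is_rank M N x k & orbit_of M N x k v].
Proof.
elim: n v => [|n IH] v hn vw; last first.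
  have step A : special w A -> (forall x k, is_top w M N x -> is_rank M N x k -> forall v,
      orbit_of M N x k v -> orbit_of M N x k (A v)) -> ~~ falls A v ->
      exists x k, [/\ is_top w M N x, is_rank M N x k & orbit_of M N x k v].
    move=> sA cl rv; have [_ l] := special_rise sA vw rv.
    have [|x [k [tx rx O]]] := IH (A v) _ (special_le sA vw); first by lia.
    by exists x, k; split=> //; rewrite -(specialK sA vw); apply: cl.
  have [fM|rM] := boolP (falls M v); last first.
    by apply: step rM => // x k tx rx u /(orbit_closed sM sN tx rx)[].
  have [fN|rN] := boolP (falls N v); last first.
    by apply: step rN => // x k tx rx u /(orbit_closed sM sN tx rx)[].
  have tv : is_top w M N v by split.
  by have [k rk] := exists_rank sM sN tv; exists v, k; split=> //; exists 0%N => //; left.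
have -> : v = w by apply: bruhat_len_eq => //; lia.
have tw : is_top w M N w.
  by split; [apply: bruhat_refl|apply: special_falls_top|apply: special_falls_top].
by have [k rk] := exists_rank sM sN tw; exists w, k; split=> //; exists 0%N => //; left.
Qed.

(** M and N coincide on a two-element orbit, so alternating products of any length agree there. *)
Lemma heckes_rank1 x f k v : is_top w M N x -> is_rank M N x 1 -> orbit_of M N x 1 v ->
  heckes M N k f v = heckes N M k f v.
Proof.
move=> tx rx; have [xw _ _] := tx; have [_ /= ek _] := rx.
have MN u : orbit_of M N x 1 u -> M u = N u.
  have eMN : M (M x) = N (M x) by rewrite {2}ek (specialK sM) // (specialK sN).
  by case=> -[|[|//]] _ [] -> //=; rewrite -ek.
elim: k v => [//|k IH] v Ov /=; have [OM _] := orbit_closed sM sN tx rx Ov.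
by rewrite /hecke /falls -(MN _ Ov) !IH.
Qed.

Lemma hecke_down x k j f : is_top w M N x -> is_rank M N x k -> (j < k)%N ->
  hecke (if odd j then N else M) f (alt M N j x) = f (alt M N j.+1 x) /\
  hecke (if odd j then N else M) f (alt M N j.+1 x) =
    (('X - 1) * f (alt M N j.+1 x) + 'X * f (alt M N j x))%R.
Proof.
move=> tx [k0 ek nek] jk; have [h1 h2 _] := orbit_chain sM sN tx nek.
have [jw lj] := h1 j (ltnW jk); have [jw' lj'] := h1 j.+1 jk.
have sA := special_if sM sN (odd j).
have e : alt M N j.+1 x = (if odd j then N else M) (alt M N j x) by [].
split; rewrite /hecke /falls.
  by rewrite -e ifT //; lia.
rewrite {1 4}e (specialK sA) // ifN //; lia.
Qed.

End Pair.

Lemma heckes_rank w M N x k f v : special w M -> special w N ->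
  is_top w M N x -> is_rank M N x k -> (1 < k <= 4)%N -> orbit_of M N x k v ->
  heckes M N k f v = heckes N M k f v.
Proof.
move=> sM sN tx rx k4 Ov; have txC : is_top w N M x by case: tx => *; split.
have dn j f' := @hecke_down w M N sM sN x k j f' tx rx.
have dn' j f' := @hecke_down w N M sN sM x k j f' txC (is_rankC rx).
have [_ ek _] := rx.
case: k k4 rx ek dn dn' Ov => [|[|[|[|[|k]]]]] // _ rx ek dn dn' [j jk vE].
- have l1 g : hecke M g (alt N M 1 x) = g (alt M N 2 x) by rewrite ek; apply: (dn' 1%N g isT).1.
  have l2 g : hecke M g (alt M N 2 x) = (('X - 1) * g (alt M N 2 x) + 'X * g (alt N M 1 x))%R.
    by rewrite ek; apply: (dn' 1%N g isT).2.
  apply: (@braid2 _ (hecke M) (hecke N) _ _ _ _ f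
    (fun g => (dn 0%N g isT).1) (fun g => (dn 0%N g isT).2) (fun g => (dn' 0%N g isT).1)
    (fun g => (dn' 0%N g isT).2) (fun g => (dn 1%N g isT).1) (fun g => (dn 1%N g isT).2) l1 l2).
  by move: vE; case: j jk => [|[|[]//]] _ [] ->; rewrite -?ek; tauto.
- have l1 g : hecke N g (alt N M 2 x) = g (alt M N 3 x) by rewrite ek; apply: (dn' 2%N g isT).1.
  have l2 g : hecke N g (alt M N 3 x) = (('X - 1) * g (alt M N 3 x) + 'X * g (alt N M 2 x))%R.
    by rewrite ek; apply: (dn' 2%N g isT).2.
  apply: (@braid3 _ (hecke M) (hecke N) _ _ _ _ _ _ f
    (fun g => (dn 0%N g isT).1) (fun g => (dn 0%N g isT).2) (fun g => (dn' 0%N g isT).1)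
    (fun g => (dn' 0%N g isT).2) (fun g => (dn 1%N g isT).1) (fun g => (dn 1%N g isT).2)
    (fun g => (dn' 1%N g isT).1) (fun g => (dn' 1%N g isT).2) (fun g => (dn 2%N g isT).1)
    (fun g => (dn 2%N g isT).2) l1 l2).
  by move: vE; case: j jk => [|[|[|[]//]]] _ [] ->; rewrite -?ek; tauto.
- have l1 g : hecke M g (alt N M 3 x) = g (alt M N 4 x) by rewrite ek; apply: (dn' 3%N g isT).1.
  have l2 g : hecke M g (alt M N 4 x) = (('X - 1) * g (alt M N 4 x) + 'X * g (alt N M 3 x))%R.
    by rewrite ek; apply: (dn' 3%N g isT).2.
  apply: (@braid4 _ (hecke M) (hecke N) _ _ _ _ _ _ _ _ f
    (fun g => (dn 0%N g isT).1) (fun g => (dn 0%N g isT).2) (fun g => (dn' 0%N g isT).1)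
    (fun g => (dn' 0%N g isT).2) (fun g => (dn 1%N g isT).1) (fun g => (dn 1%N g isT).2)
    (fun g => (dn' 1%N g isT).1) (fun g => (dn' 1%N g isT).2) (fun g => (dn 2%N g isT).1)
    (fun g => (dn 2%N g isT).2) (fun g => (dn' 2%N g isT).1) (fun g => (dn' 2%N g isT).2)
    (fun g => (dn 3%N g isT).1) (fun g => (dn 3%N g isT).2) l1 l2).
  by move: vE; case: j jk => [|[|[|[|[]//]]]] _ [] ->; rewrite -?ek; tauto.
Qed.

End Matchings.

(** * Construction of R-polynomials and independence of the matching *)

Section MatchingR.
Variable C : coxSystem.
Local Notation W := (cx_group C).
Local Notation S := (@cx_gens C).
Local Notation len := (length S).
Local Notation "u <=b v" := (bruhat_le S u v) (at level 70).
Implicit Types (s t p q u v w x y z : W) (M N A : W -> W) (f g : W -> {poly int}).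

(** R is defined along one chosen left descent [d w] of each w; independence of the choice is part
    of [good], proved below. *)
Lemma exists_R : exists (R : W -> W -> {poly int}) (d : W -> W),
  [/\ forall v, R v 1 = (if v == 1%g then 1 else 0)%R,
      forall w, w <> 1 -> S (d w) /\ (len (d w * w) < len w)%N &
      forall v w, w <> 1 -> R v w = hecke (fun x => d w * x) (R^~ (d w * w)) v].
Proof.
have /choice[d dP] : forall w, exists s, w <> 1 -> S s /\ (len (s * w) < len w)%N.
  move=> w; have [w1|/eqP/exists_left_descent[s Ss sw]] := eqVneq w 1; first by exists 1.
  by exists s.
pose fix F n w v {struct n} : {poly int} :=
  if n is j.+1 then hecke (fun x => d w * x) (F j (d w * w)) v
  else (if v == 1%g then 1 else 0)%R.
exists (fun v w => F (len w) w v), d; split=> [v||v w w1] //; first by rewrite len1.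
have [Sd dw] := dP w w1; rewrite (len_desc Sd dw) /=.
by [].
Qed.

Section Steps.
Variables (R : W -> W -> {poly int}) (d : W -> W).
Hypothesis R1 : forall v, R v 1 = (if v == 1%g then 1 else 0)%R.
Hypothesis dP : forall w, w <> 1 -> S (d w) /\ (len (d w * w) < len w)%N.
Hypothesis Rd : forall v w, w <> 1 -> R v w = hecke (fun x => d w * x) (R^~ (d w * w)) v.

Lemma R_out n v w : (len w <= n)%N -> ~ v <=b w -> R v w = 0%R.
Proof.
elim: n v w => [|n IH] v w wn vw.
  have w1 : w = 1 by apply: len0; lia.
  rewrite w1 R1; case: eqP => // v1; case: vw; rewrite v1 w1; exact: bruhat_refl.
have [w1|/eqP w1] := eqVneq w 1.
  rewrite w1 R1; case: eqP => // v1; case: vw; rewrite v1 w1; exact: bruhat_refl.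
have [Sd dw] := dP w1; rewrite Rd // /hecke.
have E1 : R (d w * v) (d w * w) = 0%R.
  apply: IH => [|h]; first by have := len_desc Sd dw; lia.
  apply: vw; rewrite -(simpleK v Sd); apply: lift_descl => //.
  exact: bruhat_trans h (bruhat_descl Sd dw).
case: ifP => // _; rewrite E1 (IH v) ?mulr0 ?addr0 //; first by have := len_desc Sd dw; lia.
by move=> h; apply: vw; apply: bruhat_trans h (bruhat_descl Sd dw).
Qed.

Lemma R_diag w : R w w = 1%R.
Proof.
elim: {w}(len w) {-2}w (leqnn (len w)) => [|n IH] w wn.
  by rewrite (len0 (w := w)) ?R1 ?eqxx //; lia.
have [->|/eqP w1] := eqVneq w 1; first by rewrite R1 eqxx.
have [Sd dw] := dP w1; rewrite Rd // /hecke /falls dw IH //.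
by have := len_desc Sd dw; lia.
Qed.

Definition good w := forall M v, special w M -> v <=b w -> R v w = hecke M (R^~ (M w)) v.

Definition uniform w M N := forall x1 x2 k1 k2,
  is_top w M N x1 -> is_rank M N x1 k1 -> (1 < k1)%N ->
  is_top w M N x2 -> is_rank M N x2 k2 -> (1 < k2)%N -> k1 = k2 /\ (k1 <= 4)%N.

Lemma hecke_zero w A y v : special w A -> y <=b w -> falls A y -> v <=b w ->
  ~ v <=b y -> hecke A (R^~ (A y)) v = 0%R.
Proof.
move=> sA yw fy vw vy; have [Ay _] := special_fall sA yw fy.
have E1 : R (A v) (A y) = 0%R.
  apply: (R_out (leqnn _)) => h; apply: vy; rewrite -(specialK sA vw).
  by apply: (special_falls_le sA) => //; apply: bruhat_trans h Ay.
rewrite /hecke; case: ifP => // _; rewrite E1 (R_out (leqnn _)) ?mulr0 ?addr0 //.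
by move=> h; apply: vy; apply: bruhat_trans h Ay.
Qed.

(** Orbits may leave [1,y], so the recursion for R(-, y) is needed on all of [1,w]; outside [1,y]
    both sides vanish. *)
Lemma good_extend w A y v : good y -> special w A -> y <=b w -> falls A y -> v <=b w ->
  R v y = hecke A (R^~ (A y)) v.
Proof.
move=> gy sA yw fy vw; have [vy|vy] := pselect (v <=b y).
  by apply: gy => //; apply: (special_restrict sA).
by rewrite (hecke_zero sA) // (R_out (leqnn _)).
Qed.

Section Pair.
Variables (w : W) (M N : W -> W).
Hypotheses (sM : special w M) (sN : special w N).
Hypothesis small : forall y, (len y < len w)%N -> good y.

Lemma R_heckes k i : is_top w M N w -> is_rank M N w k -> (0 < i)%N -> (i <= k)%N ->
  forall v, v <=b w -> R v (alt M N i w) =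
    heckes (if odd i then N else M) (if odd i then M else N) (k - i) (R^~ (alt M N k w)) v.
Proof.
move=> tw [k0 ek nek] i0 ik; have [h1 h2 _] := orbit_chain sM sN tw nek.
move: {2}(k - i)%N (erefl (k - i)%N) => n; elim: n i i0 ik => [|n IH] i i0 ik e v vw; rewrite e.
  by have -> : i = k by lia.
have ik' : (i < k)%N by lia.
have [iw li] := h1 i ik; have [iw' li'] := h1 i.+1 ik'.
have sA := special_if sM sN (odd i).
have Ai : (if odd i then N else M) (alt M N i w) = alt M N i.+1 w by [].
rewrite (good_extend _ sA) //; last 2 first.
- by apply: small; lia.
- by rewrite /falls Ai; lia.
rewrite /= Ai; apply: (hecke_ext sA) => // u uw.
have e' : (k - i.+1)%N = n by lia.
by rewrite (IH i.+1 _ ik' e') // e' /=; case: (odd i).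
Qed.

End Pair.

(** Following the two paths from w to the bottom of its orbit, both sides become alternating
    products of K operators applied to the same function R(-, bottom). The orbit of v has rank 1 or
    K, and in either case the two products agree at v. *)
Lemma hecke_step w M N v : special w M -> special w N ->
  (forall y, (len y < len w)%N -> good y) -> uniform w M N -> M w <> N w -> v <=b w ->
  hecke M (R^~ (M w)) v = hecke N (R^~ (N w)) v.
Proof.
move=> sM sN small un ne vw; have tw : is_top w M N w.
  by split; [apply: bruhat_refl|apply: special_falls_top|apply: special_falls_top].
have twC : is_top w N M w by case: tw => *; split.
have [K rw] := exists_rank sM sN tw; have [k0 ek nek] := rw.
have K1 : (1 < K)%N by move: k0 ek ne; case: (K) => [|[|k]].
have [_ K4] := un _ _ _ _ tw rw K1 tw rw K1.
have KE : K = K.-1.+1 by rewrite prednK.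
have a u : u <=b w -> R u (M w) = heckes N M K.-1 (R^~ (alt M N K w)) u.
  by move=> uw; have := R_heckes sM sN small tw rw (isT : 0 < 1)%N k0 uw; rewrite subn1.
have b u : u <=b w -> R u (N w) = heckes M N K.-1 (R^~ (alt M N K w)) u.
  move=> uw; have := R_heckes sN sM small twC (is_rankC rw) (isT : 0 < 1)%N k0 uw.
  by rewrite subn1 ek.
rewrite (hecke_ext sM a vw) (hecke_ext sN b vw).
rewrite -[LHS]/(heckes M N K.-1.+1 _ v) -[RHS]/(heckes N M K.-1.+1 _ v) -KE.
have [x [k [tx rx Ox]]] := exists_top sM sN (leqnn _) vw.
have [k1|k1] := boolP (1 < k)%N; last first.
  have k1' : k = 1%N by have [] := rx; lia.
  by rewrite k1' in rx Ox; apply: (heckes_rank1 sM sN _ _ tx).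
have [kK _] := un _ _ _ _ tx rx k1 tw rw K1; rewrite kK in rx Ox.
by apply: (heckes_rank _ sM sN tx rx) => //; rewrite K1.
Qed.

(** If wp = rw, a right descent q of this element serves instead: it is a right descent of w as
    well, and it differs from p. *)
Lemma exists_other w r : S r -> (len (r * w) < len w)%N -> (1 < len w)%N ->
  exists2 p, S p & (len (w * p) < len w)%N /\ w * p <> r * w.
Proof.
move=> Sr rw w2; have w1 : w <> 1 by move=> e; rewrite e len1 in w2.
have [p Sp wp] := exists_right_descent w1.
have [e|/eqP ne] := eqVneq (w * p) (r * w); last by exists p.
have y1 : r * w <> 1 by move=> y1; have := len_desc Sr rw; rewrite y1 len1; lia.
have [q Sq yq] := exists_right_descent y1; exists q => //; split.
  exact: desc_mull rw yq.
rewrite -e => /mulgI qp; move: yq; rewrite qp -e simpleKr //; lia.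
Qed.

End Steps.

Section DoublyLaced.
Variable m : W -> W -> option nat.
Hypotheses (hm : coxeter_system S m) (dl : doubly_laced S m).

Lemma matching_R_doubly_laced : exists R : W -> W -> {poly int}, matching_R R.
Proof.
have [R [d [R1 dP Rd]]] := exists_R; exists R.
split=> [v w|w|w M v sM vw]; [exact: (R_out R1 dP Rd (leqnn _))|exact: (R_diag R1 dP Rd)|].
suff: good R w by apply.
elim: {w}(len w) {-2}w (leqnn (len w)) {M v sM vw} => [|n IH] w wn M v sM vw.
  by have := special_falls_top sM; rewrite /falls; lia.
have small y : (len y < len w)%N -> good R y by move=> yw; apply: IH; lia.
have w1 : w <> 1 by move=> e; have := special_falls_top sM; rewrite /falls e len1.
have [Sr rw] := dP w w1; set r := d w in Sr rw; rewrite (Rd _ _ w1) -/r.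
have sr := special_left Sr rw.
have step A B u := hecke_step R1 dP Rd (v := u) (w := w) (M := A) (N := B).
have ul A : special w A -> uniform w A (fun x => r * x).
  by move=> sA x1 x2 k1 k2; apply: (uniform_left hm dl Sr rw sA).
have [e|/eqP ne] := eqVneq (M w) (r * w); last first.
  by apply/esym/step => //; apply: ul.
(* M and left multiplication by r have the same value at w, so both are compared with a right
   multiplication that has another value there. *)
have [w2|w2] := leqP 2 (len w).
  have [p Sp [wp ne]] := exists_other Sr rw w2; have sp := special_right Sp wp.
  have up A : special w A -> uniform w A (fun x => x * p).
    by move=> sA x1 x2 k1 k2; apply: (uniform_right hm dl Sp wp sA).
  rewrite (step _ (fun x => x * p)) //; [|exact: up|exact: nesym].
  by apply/esym/step => //; [apply: up|rewrite e; apply: nesym].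
(* Here [1,w] = {1, r}, on which M is left multiplication by r. *)
have lw : len w = 1%N by have := len_desc Sr rw; lia.
have rw1 : r * w = 1 by apply: len0; have := len_desc Sr rw; lia.
have wr : w = r by rewrite -(simpleK w Sr) rw1 mulg1.
have M1 : M 1 = r by rewrite -rw1 -e (specialK sM (bruhat_refl _)).
have Mr : M r = 1 by rewrite -M1 (specialK sM (bruhat1 _)).
have Mv : M v = r * v.
  case: (bruhat_eq_or_lt vw) => [->|]; first by rewrite e.
  by rewrite lw => lv; rewrite (len0 (w := v)) ?mulg1 //; lia.
by rewrite /hecke /falls Mv e.
Qed.

End DoublyLaced.
End MatchingR.

(** * Dihedral groups *)

Section Dihedral.
Variable C : coxSystem.
Local Notation W := (cx_group C).
Local Notation S := (@cx_gens C).
Local Notation len := (length S).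
Local Notation "u <=b v" := (bruhat_le S u v) (at level 70).
Implicit Types (s t p q u v w x y z : W) (M N A : W -> W) (f g : W -> {poly int}).
Hypothesis dihS2 : dihedral S.

Lemma dihedral_third a b c : S a -> S b -> S c -> b <> a -> c <> a -> b = c.
Proof.
have [s [t [_ ->]]] := dihS2.
by move=> [] /= -> [] /= -> [] /= ->.
Qed.

(** An element rising under a starts with the other generator, and so on alternately; its length
    then determines it. *)
Lemma dihedral_ascent_uniq n a x y : len x = n -> len y = n -> S a ->
  (len x < len (a * x))%N -> (len y < len (a * y))%N -> x = y.
Proof.
elim: n a x y => [|n IH] a x y lx ly Sa ax ay; first by rewrite (len0 lx) (len0 ly).
have x1 : x <> 1 by move=> e; rewrite e len1 in lx.
have y1 : y <> 1 by move=> e; rewrite e len1 in ly.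
have [b Sb bx] := exists_left_descent x1; have [c Sc cy] := exists_left_descent y1.
have ba : b <> a by move=> e; rewrite e in bx; lia.
have ca : c <> a by move=> e; rewrite e in cy; lia.
have bc := dihedral_third Sa Sb Sc ba ca; rewrite -bc in Sc cy.
rewrite -(simpleK x Sb) -(simpleK y Sb); congr (b * _).
have := len_desc Sb bx; have := len_desc Sb cy => e1 e2.
by apply: (IH b) => //; rewrite ?simpleK //; lia.
Qed.

Lemma dihedral_le u v : (len u < len v)%N -> u <=b v.
Proof.
elim: {v}(len v) {-2}v (leqnn (len v)) u => [|n IH] v vn u uv; first by lia.
have v1 : v <> 1 by move=> e; rewrite e len1 in uv.
have [a Sa av] := exists_left_descent v1; have l := len_desc Sa av.
have [au|au] := boolP (len (a * u) < len u)%N.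
  have := len_desc Sa au => l'; rewrite -(simpleK u Sa) -(simpleK v Sa).
  by apply: lift_monol => //; rewrite ?simpleK //; apply: IH; lia.
apply: bruhat_trans (bruhat_descl Sa av).
have [lt|ge] := ltnP (len u) (len (a * v)); first by apply: IH; lia.
rewrite (dihedral_ascent_uniq (n := len u) (a := a) (x := u) (y := a * v)) //; try lia.
- exact: bruhat_refl.
- by rewrite len_mul_lt.
- by rewrite simpleK.
Qed.

(** The value of R(v, w) for v <= w with l(w) - l(v) = n. At n = 2 the term with [dihedral_R 0] is
    absent, because Mv and Mw are then distinct elements of equal length. *)
Fixpoint dihedral_R n : {poly int} :=
  (if n is j.+1 then
     if j is i.+1 then ('X - 1) * dihedral_R j + (if i is _.+1 then 'X * dihedral_R i else 0)
     else 'X - 1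
   else 1)%R.

(** Elements of different lengths are always comparable, and a special matching changes lengths by
    one, so the recursion has the same form for every matching. *)
Lemma matching_R_dihedral : exists R : W -> W -> {poly int}, matching_R R.
Proof.
pose R v w := if `[< v <=b w >] then dihedral_R (len w - len v) else 0%R.
have Rle v w : v <=b w -> R v w = dihedral_R (len w - len v).
  by move=> vw; rewrite /R; case: asboolP.
have Rnle v w : ~ v <=b w -> R v w = 0%R by move=> vw; rewrite /R; case: asboolP.
exists R; split=> // [w|w M v sM vw].
  by rewrite Rle ?subnn //; apply: bruhat_refl.
have ww := bruhat_refl (C := C) w; have fw := special_falls_top sM.
have [Mww lw] := special_fall sM ww fw.
rewrite /hecke (Rle _ _ vw); case: ifP => [fv|/negbT rv].
  have [_ lv] := special_fall sM vw fv.
  by rewrite Rle; [congr dihedral_R; lia|apply: (special_falls2 sM)].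
have [_ lv] := special_rise sM vw rv.
have vMw : v <=b M w by apply: (special_le_falls sM).
rewrite (Rle v) //; have := bruhat_len vMw => l.
have -> : (len w - len v = (len (M w) - len v).+1)%N by lia.
case E : (len (M w) - len v)%N => [|[|k]] /=.
- rewrite Rnle ?mulr0 ?addr0 ?mulr1 // => /bruhat_len; lia.
- rewrite Rnle ?mulr0 // => h.
  have e : M v = M w by apply: bruhat_len_eq h _; lia.
  by move: rv; rewrite -(specialK sM vw) e (specialK sM ww) fw.
- rewrite (Rle (M v)); last by apply: dihedral_le; lia.
  by have -> : (len (M w) - len (M v) = k.+1)%N by lia.
Qed.

End Dihedral.

(** * Parabolic R-polynomials as sums of ordinary ones *)

Section Parabolic.
Variable C : coxSystem.
Local Notation W := (cx_group C).
Local Notation S := (@cx_gens C).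
Local Notation len := (length S).
Local Notation "u <=b v" := (bruhat_le S u v) (at level 70).
Implicit Types (s t p q u v w y z : W) (a b : seq W).
Variable H : set W.
Hypothesis HS : H `<=` S.
Local Notation WH := (min_coset_reps S H).

Lemma min_coset_repsP w : WH w <-> forall p, H p -> (len w < len (w * p))%N.
Proof.
split=> [h p Hp|h p [Sp wp]].
  have Sp := HS Hp; have := len_mulSr w Sp; case=> [->//|e].
  by have [|_ /(_ Hp)] := h p; [split=> //; rewrite e|].
by split=> // Hp; have := h p Hp; lia.
Qed.

Lemma WH_desc s u : S s -> WH u -> (len (s * u) < len u)%N -> WH (s * u).
Proof.
move=> Ss /min_coset_repsP hu su; apply/min_coset_repsP => p Hp; have Sp := HS Hp.
have [e|e] := len_mulSr (s * u) Sp; first by rewrite e.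
have h := hu p Hp; have l := len_desc Ss su.
by have [e'|e'] := len_mulS (u * p) Ss; move: e' e; rewrite mulwA; lia.
Qed.

(** For p in H with sup < su, lifting gives u <= sup, and the two lengths are equal. *)
Lemma WH_exit s u : S s -> WH u -> ~~ (len (s * u) < len u)%N -> ~ WH (s * u) ->
  exists2 p, H p & s * u = u * p.
Proof.
move=> Ss hu su nsu; have lsu := len_asc Ss su.
have [p Hp lp] : exists2 p, H p & ~~ (len (s * u) < len (s * u * p))%N.
  by apply: contrapT => no; apply/nsu/min_coset_repsP => p Hp; apply/negPn/negP => h; apply: no; exists p.
exists p => //; have Sp := HS Hp; have up := (min_coset_repsP u).1 hu p Hp.
have lup : len (u * p) = (len u).+1 by case: (len_mulSr u Sp) => e; lia.
have lsup : len (s * u * p) = len u.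
  by case: (len_mulSr (s * u) Sp) => e; move: lp; rewrite e; lia.
have le : u <=b s * (u * p).
  apply: lift_ascl => //; last by rewrite lsu.
  by apply: bruhat_mulr => //; apply: refl_simple.
have e : u = s * (u * p) by apply: bruhat_len_eq le _; rewrite mulwA lsup.
by rewrite {1}e simpleK.
Qed.

(* u is the minimal representative of the coset z W_H (proj_factor); described in
   this way, it is preserved by isomorphisms of posets. *)
Definition proj z u : Prop :=
  [/\ WH u, u <=b z & forall u', WH u' -> u' <=b z -> u' <=b u].

Lemma proj_uniq z u u' : proj z u -> proj z u' -> u = u'.
Proof.
by move=> [h1 h2 h3] [h1' h2' h3']; apply: bruhat_anti; [apply: h3'|apply: h3].
Qed.

Lemma proj_self u : WH u -> proj u u.
Proof. by move=> hu; split=> //; apply: bruhat_refl. Qed.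

Lemma proj_mulr z u p : H p -> (len (z * p) < len z)%N -> proj (z * p) u -> proj z u.
Proof.
move=> Hp zp [hu uz max]; have Sp := HS Hp; split=> //.
  exact: bruhat_trans uz (bruhat_descr Sp zp).
move=> u' hu' uz'; apply: max => //; apply: lift_ascr => //.
exact: (min_coset_repsP u').1.
Qed.

Lemma proj_factor n z : (len z <= n)%N ->
  exists u b, [/\ proj z u, word_in H b, z = u * word_prod b & (len u + size b)%N = len z].
Proof.
elim: n z => [|n IH] z zn.
  exists z, [::]; rewrite word_prod_nil mulg1 addn0; split=> //.
  apply: proj_self; apply/min_coset_repsP => p Hp; have Sp := HS Hp.
  by have := len_mulSr z Sp; lia.
have [hz|nz] := pselect (WH z).
  by exists z, [::]; rewrite word_prod_nil mulg1 addn0; split=> //; apply: proj_self.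
have [p Hp zp] : exists2 p, H p & ~~ (len z < len (z * p))%N.
  by apply: contrapT => no; apply/nz/min_coset_repsP => p Hp; apply/negPn/negP => h; apply: no; exists p.
have Sp := HS Hp; have l : len z = (len (z * p)).+1.
  by case: (len_mulSr z Sp) => e //; move: zp; rewrite e ltnSn.
have [|u [b [pu hb zE lb]]] := IH (z * p); first by lia.
exists u, (b ++ [:: p]); split.
- by apply: proj_mulr Hp _ pu; lia.
- by apply/word_in_cat; split=> // q; rewrite inE => /eqP->.
- by rewrite word_prod_cat word_prod_cons word_prod_nil mulg1 mulwA -zE simpleKr.
- by rewrite size_cat /=; lia.
Qed.

Lemma proj_word u b : WH u -> word_in H b -> len (u * word_prod b) = (len u + size b)%N ->
  proj (u * word_prod b) u.
Proof.
move=> hu; elim/last_ind: b => [|b p IH]; first by rewrite word_prod_nil mulg1 => *; apply: proj_self.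
rewrite -cats1 => /word_in_cat[hb /word_in_cons[Hp _]].
rewrite word_prod_cat word_prod_cons word_prod_nil mulg1 size_cat mulwA /= => l.
have Sp := HS Hp.
have lub : (len (u * word_prod b) <= len u + size b)%N.
  have [c [Sc cs cp]] := lenP u.
  have : (len (word_prod (c ++ b)) <= size (c ++ b))%N.
    by apply: len_le; apply/word_in_cat; split=> // q /hb /HS.
  by rewrite word_prod_cat cp size_cat cs.
have l2 := len_mulSr (u * word_prod b) Sp.
by apply: proj_mulr Hp _ _; rewrite simpleKr //; [lia|apply: IH => //; lia].
Qed.

(** The cases of the parabolic recursion are the three ways in which s acts on the cosets z W_H: it
    lowers the representative (here), raises it ([proj_asc]) or fixes the coset ([proj_stay]). As z
    = u b with lengths adding up, a left descent of u is one of z. *)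
Lemma proj_desc s z u : S s -> proj z u -> (len (s * u) < len u)%N ->
  (len (s * z) < len z)%N /\ proj (s * z) (s * u).
Proof.
move=> Ss pu su; have [u' [b [pu' hb zE lb]]] := proj_factor (leqnn (len z)).
rewrite -(proj_uniq pu pu') in zE lb; have [hu uz max] := pu.
have lsu := len_desc Ss su.
have lsz : (len (s * z) < len z)%N.
  have [c [Sc cs cp]] := lenP (s * u).
  have : (len (word_prod (c ++ b)) <= size (c ++ b))%N.
    by apply: len_le; apply/word_in_cat; split=> // q /hb /HS.
  by rewrite word_prod_cat cp -mulwA -zE size_cat; lia.
split=> //; rewrite zE mulwA; apply: proj_word; [exact: WH_desc|by []|].
by rewrite -mulwA -zE; have := len_desc Ss lsz; lia.
Qed.

Lemma proj_asc s z u : S s -> proj z u -> ~~ (len (s * u) < len u)%N -> WH (s * u) ->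
  (len z < len (s * z))%N /\ proj (s * z) (s * u).
Proof.
move=> Ss [hu uz max] su hsu; have lsu := len_asc Ss su.
have sz : (len z < len (s * z))%N.
  rewrite len_mul_lt //; apply/negP => sz.
  by have := bruhat_len (max _ hsu (lift_descl Ss uz sz)); lia.
split=> //; split=> // [|v hv vz]; first exact: lift_monol.
have [sv|sv] := boolP (len (s * v) < len v)%N.
  rewrite -(simpleK v Ss); apply: lift_monol => //; last by rewrite lsu.
  by apply: max; [apply: WH_desc|rewrite -(simpleK z Ss); apply: lift_bothl].
apply: bruhat_trans (bruhat_ascl Ss _); last by rewrite lsu.
apply: max => //; rewrite -(simpleK z Ss); apply: lift_ascl => //.
by rewrite len_mul_lt.
Qed.

(** By [WH_exit], su = up with p in H, so that every element of W^H below up is below u. *)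
Lemma proj_stay s z u : S s -> proj z u -> ~~ (len (s * u) < len u)%N -> ~ WH (s * u) ->
  proj (s * z) u.
Proof.
move=> Ss [hu uz max] su nsu; have lsu := len_asc Ss su.
have [sz|sz] := boolP (len (s * z) < len z)%N.
  split=> // [|v hv vz]; first by apply: lift_ascl; rewrite // lsu.
  by apply: max => //; apply: bruhat_trans (bruhat_descl Ss sz).
have zsz : (len z < len (s * z))%N by rewrite len_mul_lt.
split=> // [|v hv vz]; first exact: bruhat_trans (bruhat_ascl Ss zsz).
have [sv|sv] := boolP (len (s * v) < len v)%N; last first.
  apply: max => //; rewrite -(simpleK z Ss); apply: lift_ascl => //.
    by rewrite len_mul_lt.
have [p Hp e] := WH_exit Ss hu su nsu; have Sp := HS Hp.
have vup : v <=b u * p.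
  rewrite -e -(simpleK v Ss); apply: lift_monol; rewrite // ?lsu //.
  by apply: max; [apply: WH_desc|rewrite -(simpleK z Ss); apply: lift_bothl].
rewrite -(simpleKr u Sp); apply: lift_ascr => //; exact: (min_coset_repsP v).1.
Qed.

Section Deodhar.
Variables (R : W -> W -> {poly int}) (x : {poly int}).
Hypothesis mR : matching_R R.
Hypothesis hx : x = (-1)%R \/ x = ('X)%R.

Definition fiber v u : set W := [set z | z <=b v /\ proj z u].

Definition weight z u : {poly int} := ((- x) ^+ (len z - len u))%R.

Definition deodhar u v : {poly int} := (\sum_(z \in fiber v u) weight z u * R z v)%R.

Lemma fiber_finite v u : finite_set (fiber v u).
Proof. by apply: sub_finite_set (interval_finite v) => z []. Qed.

Lemma deodhar_out u v : ~ u <=b v -> deodhar u v = 0%R.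
Proof.
move=> uv; apply: fsbig1 => z [zv [_ uz _]].
by case: uv; apply: bruhat_trans uz zv.
Qed.

Lemma deodhar_diag u : WH u -> deodhar u u = 1%R.
Proof.
move=> hu; have [_ R1 _] := mR; have E : fiber u u = [set u].
  apply/seteqP; split=> z; first by move=> [zu [_ uz _]]; apply: bruhat_anti.
  by move=> ->; split; [apply: bruhat_refl|apply: proj_self].
by rewrite /deodhar E fsbig_set1 /weight subnn expr0 mul1r R1.
Qed.

Section Descent.
Variables (s v : W).
Hypotheses (Ss : S s) (sv : (len (s * v) < len v)%N).

Lemma R_left z : z <=b v -> R z v = (if (len (s * z) < len z)%N then R (s * z) (s * v)
  else ('X - 1) * R z (s * v)%g + 'X * R (s * z)%g (s * v)%g)%R.
Proof. by have [_ _ h] := mR; move=> zv; rewrite (h _ _ _ (special_left Ss sv) zv). Qed.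

Lemma deodhar_widen u : deodhar u (s * v) = (\sum_(z \in fiber v u) weight z u * R z (s * v)%g)%R.
Proof.
have [R0 _ _] := mR; apply: fsbig_widen => z.
  by move=> [zv pz]; split=> //; apply: bruhat_trans zv (bruhat_descl Ss sv).
by move=> [[_ pz] nz] /=; rewrite R0 ?mulr0 // => h; apply: nz.
Qed.

Lemma fiber_shift u : WH u -> WH (s * u) ->
  (forall z, proj z u -> proj (s * z) (s * u)) -> (forall z, proj z (s * u) -> proj (s * z) u) ->
  set_bij (fiber v u) (fiber v (s * u)) (fun z => s * z).
Proof.
move=> hu hsu h1 h2; split.
- by move=> z [zv pz]; split; [apply: lift_descl|apply: h1].
- by move=> y z _ _; apply: mulgI.
- move=> z [zv pz]; exists (s * z); last by rewrite simpleK.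
  by split; [apply: lift_descl|apply: h2].
Qed.

Lemma proj_shift u : WH u -> ~~ (len (s * u) < len u)%N -> WH (s * u) ->
  forall z, proj z (s * u) -> proj (s * z) u.
Proof.
move=> hu su hsu z pz; have [|_] := proj_desc Ss pz; last by rewrite simpleK.
by rewrite simpleK // (len_asc Ss su).
Qed.

Lemma deodhar_desc u : WH u -> (len (s * u) < len u)%N -> deodhar u v = deodhar (s * u) (s * v).
Proof.
move=> hu su; have hsu := WH_desc Ss hu su; have lsu := len_desc Ss su.
rewrite deodhar_widen (reindex_fsbig (fun z => s * z) (fiber v u)); last first.
  apply: fiber_shift => // z pz; first by have [] := proj_desc Ss pz su.
  have [||_] := proj_asc Ss pz; rewrite simpleK //; lia.
apply: eq_fsbigr => z /set_mem[zv pz]; have [sz _] := proj_desc Ss pz su.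
have := len_desc Ss sz => lsz; rewrite R_left // sz; congr (_ * _)%R.
by rewrite /weight; congr (_ ^+ _)%R; lia.
Qed.

Lemma deodhar_asc u : WH u -> ~~ (len (s * u) < len u)%N -> WH (s * u) ->
  deodhar u v = (('X - 1) * deodhar u (s * v)%g + 'X * deodhar (s * u)%g (s * v)%g)%R.
Proof.
move=> hu su hsu; have lsu := len_asc Ss su.
rewrite !deodhar_widen (reindex_fsbig (fun z => s * z) (fiber v u) (fiber v (s * u))); last first.
  apply: fiber_shift => // z pz; first by have [] := proj_asc Ss pz su hsu.
  exact: proj_shift.
rewrite !mulr_fsumr -fsbig_split /=; last exact: fiber_finite.
apply: eq_fsbigr => z /set_mem[zv pz]; have [sz _] := proj_asc Ss pz su hsu.
have e : weight (s * z)%g (s * u)%g = weight z u.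
  by rewrite /weight lsu (len_asc Ss (w := z)) ?subSS // -len_mul_lt.
by rewrite R_left // ifN ?e; [ring|rewrite -len_mul_lt].
Qed.

(** Multiplication by s permutes the fiber of u, so the sum is taken over pairs z < sz, whose
    weights are in the ratio 1 : -x. *)
Lemma deodhar_stay u : WH u -> ~~ (len (s * u) < len u)%N -> ~ WH (s * u) ->
  deodhar u v = (('X - 1 - x) * deodhar u (s * v)%g)%R.
Proof.
move=> hu su nsu; have lsu := len_asc Ss su.
pose A : set W := [set z | (len (s * z) < len z)%N].
have split (g : W -> {poly int}) : (\sum_(z \in fiber v u) g z =
    \sum_(z \in fiber v u `&` ~` A) (g z + g (s * z)%g))%R.
  rewrite (fsbigID A) /=; last exact: fiber_finite.
  rewrite fsbig_split /=; last by apply: finite_setIl; apply: fiber_finite.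
  rewrite addrC; congr (_ + _)%R; apply: reindex_fsbig; split.
  - move=> z [[zv pz] /negP sz]; split; last by rewrite /A /= simpleK // len_mul_lt.
    by split; [apply: lift_descl|apply: proj_stay].
  - by move=> y z _ _; apply: mulgI.
  - move=> z [[zv pz] sz]; exists (s * z); last by rewrite simpleK.
    split; last by apply/negP; rewrite -len_mul_lt ?simpleK.
    by split; [apply: lift_descl|apply: proj_stay].
rewrite deodhar_widen {1}/deodhar !split mulr_fsumr.
apply: eq_fsbigr => z /set_mem[[zv [_ uz _]] /negP sz].
have lz := len_asc Ss sz; have := bruhat_len uz => luz.
have e : weight (s * z)%g u = (- x * weight z u)%R by rewrite /weight lz subSn // exprS.
rewrite e (R_left zv) (negbTE sz) R_left ?simpleK //; last exact: lift_descl.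
rewrite ifT; last by rewrite lz.
(* This is where x = -1 or x = q enters: the identity says (x + 1)(x - q) = 0. *)
have q : ('X = x * x - ('X - 1) * x :> {poly int})%R by case: hx => ->; ring.
by rewrite [X in (X * R (s * z)%g _)%R]q; ring.
Qed.

End Descent.

Lemma parabolic_R_deodhar R' u v : parabolic_R_family S H x R' -> WH u -> WH v ->
  R' u v = deodhar u v.
Proof.
move=> fam; elim: {v}(len v) {-2}v (leqnn (len v)) u => [|n IH] v vn u hu hv.
  have v1 : v = 1 by apply: len0; lia.
  have [h1 h2 _] := fam u v hu hv; have [uv|uv] := pselect (u <=b v); last first.
    by rewrite h1 // deodhar_out.
  have -> : v = u by apply/esym; apply: (bruhat_len_eq uv); lia.
  by rewrite h2 deodhar_diag.
have [h1 h2 h3] := fam u v hu hv; have [uv|uv] := pselect (u <=b v); last first.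
  by rewrite h1 // deodhar_out.
have [e|/eqP ne] := eqVneq u v; first by rewrite -e h2 deodhar_diag.
have v1 : v <> 1.
  by move=> v1; apply: ne; apply: (bruhat_len_eq uv); rewrite v1 len1.
have [s Ss sv] := exists_left_descent v1; have lsv := len_desc Ss sv.
have [g1 g2 g3] := h3 (conj uv ne) s (conj Ss sv).
have hsv := WH_desc Ss hv sv.
have [su|su] := boolP (len (s * u) < len u)%N.
  by rewrite g1 // IH ?(deodhar_desc Ss sv) //; [lia|apply: WH_desc].
have nsu : ~ left_descents S u s by move=> [_]; apply/negP.
have [hsu|hsu] := pselect (WH (s * u)).
  by rewrite g2 // !IH ?(deodhar_asc Ss sv hu su hsu) //; lia.
by rewrite g3 // IH ?(deodhar_stay Ss sv hu su hsu) //; lia.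
Qed.

End Deodhar.
End Parabolic.

(** * Transport along an isomorphism *)

Section Transport.
Variables C1 C2 : coxSystem.
Local Notation W1 := (cx_group C1).
Local Notation S1 := (@cx_gens C1).
Local Notation W2 := (cx_group C2).
Local Notation S2 := (@cx_gens C2).
Variables (v1 : W1) (v2 : W2) (psi : W1 -> W2).
Hypothesis iso : poset_iso (bruhat_le S1) (bruhat_le S2)
  (bruhat_interval S1 1%g v1) (bruhat_interval S2 1%g v2) psi.
Local Notation "u <=1 v" := (bruhat_le S1 u v) (at level 70).
Local Notation "u <=2 v" := (bruhat_le S2 u v) (at level 70).

Lemma psi_below u : u <=1 v1 -> psi u <=2 v2.
Proof. by move=> uv; have [[f _ _] _] := iso; have [] := f u (conj (bruhat1 u) uv). Qed.

Lemma psi_le u v : u <=1 v1 -> v <=1 v1 -> (u <=1 v <-> psi u <=2 psi v).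
Proof.
by move=> uv vv; have [_] := iso; apply; split=> //; apply: bruhat1.
Qed.

Lemma psi_inj u v : u <=1 v1 -> v <=1 v1 -> psi u = psi v -> u = v.
Proof.
move=> uv vv; have [[_ inj _] _] := iso.
by apply: inj; rewrite inE; split=> //; apply: bruhat1.
Qed.

Lemma psi_onto y : y <=2 v2 -> exists2 u, u <=1 v1 & psi u = y.
Proof.
move=> yv; have [[_ _ onto] _] := iso; have [u [_ uv] uy] := onto y (conj (bruhat1 y) yv).
by exists u.
Qed.

(** A coatom of psi u comes from an element strictly below u, so the gradedness of the second
    interval bounds the length; [psi_len_ge] uses that of the first. *)
Lemma psi_len_le n u : (length S2 (psi u) <= n)%N -> u <=1 v1 ->
  (length S2 (psi u) <= length S1 u)%N.
Proof.
elim: n u => [|n IH] u un uv; first exact: leq_trans un _.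
have [e|/eqP ne] := eqVneq (psi u) 1; first by rewrite e len1.
have [y [_ yu ly]] := exists_coatom (bruhat1 (psi u)) (nesym ne).
have [z zv zy] := psi_onto (bruhat_trans yu (psi_below uv)); rewrite -zy in yu ly.
have [|zu|zu] := bruhat_eq_or_lt (u := z) (v := u); first exact/(psi_le zv uv).
  by rewrite zu in ly; lia.
by have := IH z _ zv; rewrite ly => /(_ _)/leq_ltn_trans; apply=> //; lia.
Qed.

Lemma psi_len_ge n u : (length S1 u <= n)%N -> u <=1 v1 ->
  (length S1 u <= length S2 (psi u))%N.
Proof.
elim: n u => [|n IH] u un uv; first exact: leq_trans un _.
have [->|/eqP ne] := eqVneq u 1; first by rewrite len1.
have [z [_ zu lz]] := exists_coatom (bruhat1 u) (nesym ne).
have zv := bruhat_trans zu uv; rewrite lz.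
have [e|] := bruhat_eq_or_lt ((psi_le zv uv).1 zu).
  by have := psi_inj zv uv e => e'; rewrite e' in lz; lia.
by apply: leq_ltn_trans; apply: IH => //; lia.
Qed.

Lemma psi_len u : u <=1 v1 -> length S2 (psi u) = length S1 u.
Proof.
move=> uv; apply/eqP.
by rewrite eqn_leq (psi_len_le (leqnn _) uv) (psi_len_ge (leqnn _) uv).
Qed.

Lemma exists_psi_inv : exists phi : W2 -> W1,
  (forall y, y <=2 v2 -> phi y <=1 v1 /\ psi (phi y) = y) /\
  (forall u, u <=1 v1 -> phi (psi u) = u).
Proof.
have /choice[phi h] : forall y, exists u, y <=2 v2 -> u <=1 v1 /\ psi u = y.
  move=> y; have [yv|] := pselect (y <=2 v2); last by exists 1.
  by have [u uv uy] := psi_onto yv; exists u.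
exists phi; split=> // u uv; have [h1 h2] := h _ (psi_below uv).
exact: psi_inj.
Qed.

Lemma special_transport (phi : W2 -> W1) w M :
  (forall y, y <=2 v2 -> phi y <=1 v1 /\ psi (phi y) = y) ->
  (forall u, u <=1 v1 -> phi (psi u) = u) ->
  w <=1 v1 -> special w M -> special (psi w) (fun y => psi (M (phi y))).
Proof.
move=> h1 h2 wv sM; have [m1 m2 m3] := sM.
have down y : y <=2 psi w -> [/\ phi y <=1 w, phi y <=1 v1, psi (phi y) = y,
    M (phi y) <=1 w & M (phi y) <=1 v1].
  move=> yw; have [py e] := h1 _ (bruhat_trans yw (psi_below wv)).
  have pw : phi y <=1 w by apply/(psi_le py wv); rewrite e.
  have [Mw _] := m1 _ pw; split=> //; exact: bruhat_trans wv.
split=> [y yw|y yw|x y xy yw ly ne].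
- have [a b e c d] := down y yw; have [_ K] := m1 _ a.
  by rewrite (h2 _ d) K e; split=> //; apply/(psi_le d wv).
- have [a b e c d] := down y yw; have ly : length S2 y = length S1 (phi y).
    by rewrite -(psi_len b) e.
  rewrite psi_len // ly; case: (m2 _ a) => -[l ->]; [left|right]; split=> //.
    by move/(psi_le b d): l; rewrite e.
  by move/(psi_le d b): l; rewrite e.
- have [a b e c d] := down y yw; have [a' b' e' c' d'] := down x (bruhat_trans xy yw).
  apply/(psi_le d' d); apply: m3 => //.
  + by apply/(psi_le b' b); rewrite e e'.
  + by rewrite -(psi_len b) -(psi_len b') e e'.
  + by move=> h; apply: ne; rewrite h e.
Qed.

Section R.
Variables (R1 : W1 -> W1 -> {poly int}) (R2 : W2 -> W2 -> {poly int}).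
Hypotheses (mR1 : matching_R R1) (mR2 : matching_R R2).

Lemma R_transport n z y : (length S1 y <= n)%N -> z <=1 v1 -> y <=1 v1 ->
  R1 z y = R2 (psi z) (psi y).
Proof.
have [R10 R11 R1h] := mR1; have [R20 R21 R2h] := mR2.
have [phi [h1 h2]] := exists_psi_inv.
elim: n z y => [|n IH] z y yn zv yv.
  have y1 : y = 1 by apply: len0; lia.
  have [zy|zy] := pselect (z <=1 y); last first.
    by rewrite R10 // R20 // => /(psi_le zv yv).
  have -> : z = y by apply: (bruhat_len_eq zy); rewrite y1 len1.
  by rewrite R11 R21.
have [zy|zy] := pselect (z <=1 y); last first.
    by rewrite R10 // R20 // => /(psi_le zv yv).
have [y1|/eqP y1] := eqVneq y 1.
  have -> : z = y by apply: (bruhat_len_eq zy); rewrite y1 len1.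
  by rewrite R11 R21.
have [s Ss sy] := exists_left_descent y1; have ls := len_desc Ss sy.
have sM := special_left Ss sy; have sM' := special_transport h1 h2 yv sM.
rewrite (R1h _ _ _ sM zy) (R2h _ _ _ sM'); last exact/psi_le.
have syv : s * y <=1 v1 by apply: bruhat_trans (bruhat_descl Ss sy) yv.
have szv : s * z <=1 v1 by apply: bruhat_trans (lift_descl Ss zy sy) yv.
rewrite /hecke /falls !h2 // !psi_len //.
by rewrite -!IH //; lia.
Qed.

End R.

Variables (H1 : set W1) (H2 : set W2).
Hypotheses (HS1 : H1 `<=` S1) (HS2 : H2 `<=` S2).
Hypothesis isoH : poset_iso (bruhat_le S1) (bruhat_le S2)
  (parabolic_interval S1 H1 1%g v1) (parabolic_interval S2 H2 1%g v2) psi.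
Local Notation WH1 := (min_coset_reps S1 H1).
Local Notation WH2 := (min_coset_reps S2 H2).

Lemma psi_WH u : u <=1 v1 -> (WH1 u <-> WH2 (psi u)).
Proof.
move=> uv; have [[f _ onto] _] := isoH; split=> hu.
  by have [|_] := f u; [split=> //; split=> //; apply: bruhat1|].
have [|u' [[_ u'v] hu'] e] := onto (psi u).
  by split=> //; split; [apply: bruhat1|apply: psi_below].
by rewrite -(psi_inj u'v uv e).
Qed.

Lemma psi_proj z u : z <=1 v1 -> u <=1 v1 -> (proj H1 z u <-> proj H2 (psi z) (psi u)).
Proof.
move=> zv uv; split=> -[hu uz max]; split.
- exact/psi_WH.
- exact/psi_le.
- move=> u' hu' u'z; have [y yv yu'] := psi_onto (bruhat_trans u'z (psi_below zv)).
  rewrite -yu' in hu' u'z *; apply/psi_le => //; apply: max; first exact/psi_WH.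
  exact/psi_le.
- exact/psi_WH.
- exact/psi_le.
- move=> u' hu' u'z; have u'v := bruhat_trans u'z zv.
  by apply/psi_le => //; apply: max; [apply/psi_WH|apply/psi_le].
Qed.

Lemma deodhar_transport R1 R2 x u w : matching_R R1 -> matching_R R2 ->
  u <=1 v1 -> w <=1 v1 -> deodhar H1 R1 x u w = deodhar H2 R2 x (psi u) (psi w).
Proof.
move=> mR1 mR2 uv wv; rewrite [RHS](reindex_fsbig psi (fiber H1 w u)); last first.
  split=> [z [zw pz]|y z /set_mem[yw _] /set_mem[zw _]|y [yw py]].
  - have zv := bruhat_trans zw wv; split; first exact/psi_le.
    exact/psi_proj.
  - by apply: psi_inj; apply: bruhat_trans wv.
  - have [z zv e] := psi_onto (bruhat_trans yw (psi_below wv)); rewrite -e in yw py *.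
    by exists z => //; split; [apply/psi_le|apply/psi_proj].
apply: eq_fsbigr => z /set_mem[zw _]; have zv := bruhat_trans zw wv.
by rewrite /weight !psi_len // (R_transport mR1 mR2 (leqnn _)).
Qed.

End Transport.

(** * Kazhdan-Lusztig polynomials are determined by the R-polynomials *)

Section KL.
Local Open Scope ring_scope.

Lemma eval_inv_qB (a b : {poly int}) : eval_inv_q (a - b) = eval_inv_q a - eval_inv_q b.
Proof. by rewrite /eval_inv_q rmorphB hornerD hornerN. Qed.

Lemma expr_invB (F : fieldType) (y : F) n i : y != 0 -> (i <= n)%N ->
  y ^+ n * y^-1 ^+ i = y ^+ (n - i).
Proof. by move=> y0 iN; rewrite exprVn expfB_cond // (negbTE y0). Qed.

(** Clearing denominators turns the identity in the fraction field into one between polynomials,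
    where coefficients can be compared. *)
Lemma eval_inv_qE (d : {poly int}) n : (size d <= n.+1)%N ->
  q_frac ^+ n * eval_inv_q d = tofrac (\sum_(i < size d) (d`_i)%:P * 'X^(n - i)).
Proof.
move=> dn; have q0 : q_frac != 0 by rewrite tofrac_eq0 polyX_eq0.
rewrite /eval_inv_q (horner_coef_wide _ (size_poly _ _)) mulr_sumr rmorph_sum /=.
apply: eq_bigr => i _; rewrite coef_map /= rmorphM rmorphXn /= -/q_frac.
have iN : (i <= n)%N by rewrite -ltnS; apply: leq_trans (ltn_ord i) dn.
have -> : tofrac (d`_i)%:P = (d`_i)%:~R by rewrite -[X in X%:P]intz !rmorph_int.
rewrite mulrCA; congr (_ * _); exact: expr_invB.
Qed.

(** The left-hand side involves only exponents from n - deg d upwards, and these exceed deg d; so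
    the leading coefficient of d is 0. *)
Lemma self_dual_eq0 (d : {poly int}) n : (0 < n)%N -> (2 * (size d).-1 <= n - 1)%N ->
  q_frac ^+ n * eval_inv_q d = tofrac d -> d = 0.
Proof.
move=> n0 dn.
have aux k j : (2 * k <= n - 1)%N -> k = (n - j)%N -> (j <= k)%N -> False by lia.
rewrite eval_inv_qE; last by lia.
move=> /eqP; rewrite tofrac_eq => /eqP e; apply/eqP; rewrite -lead_coef_eq0 lead_coefE.
have /= <- := congr1 (fun p : {poly int} => p`_(size d).-1) e.
rewrite coef_sum big1 // => i _; rewrite coefCM coefXn.
case: eqP => [h|]; rewrite ?mulr0 //; case: (aux _ _ dn h).
by rewrite -ltnS; apply: leq_trans (ltn_ord i) (leqSpred _).
Qed.

End KL.

Section TransportKL.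
Variables C1 C2 : coxSystem.
Local Notation W1 := (cx_group C1).
Local Notation S1 := (@cx_gens C1).
Local Notation W2 := (cx_group C2).
Local Notation S2 := (@cx_gens C2).
Variables (v1 : W1) (v2 : W2) (psi : W1 -> W2).
Hypothesis iso : poset_iso (bruhat_le S1) (bruhat_le S2)
  (bruhat_interval S1 1%g v1) (bruhat_interval S2 1%g v2) psi.
Variables (H1 : set W1) (H2 : set W2).
Hypothesis isoH : poset_iso (bruhat_le S1) (bruhat_le S2)
  (parabolic_interval S1 H1 1%g v1) (parabolic_interval S2 H2 1%g v2) psi.
Local Notation "u <=1 v" := (bruhat_le S1 u v) (at level 70).
Local Notation WH1 := (min_coset_reps S1 H1).
Variables (R1 P1 : W1 -> W1 -> {poly int}) (R2 P2 : W2 -> W2 -> {poly int}).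
Hypotheses (hP1 : parabolic_KL_family S1 H1 R1 P1) (hP2 : parabolic_KL_family S2 H2 R2 P2).
Hypothesis R12 : forall u w, u <=1 v1 -> w <=1 v1 -> WH1 u -> WH1 w ->
  R1 u w = R2 (psi u) (psi w).
Hypothesis R11 : forall u, WH1 u -> R1 u u = 1%R.

Lemma KL_transport n u w : (length S1 w - length S1 u <= n)%N ->
  u <=1 v1 -> w <=1 v1 -> WH1 u -> WH1 w -> P1 u w = P2 (psi u) (psi w).
Proof.
elim/ltn_ind: n u w => n IH u w hn uv wv hu hw.
have hu2 := (psi_WH iso isoH uv).1 hu; have hw2 := (psi_WH iso isoH wv).1 hw.
have [a1 a2 a3 a4] := hP1 hu hw; have [b1 b2 b3 b4] := hP2 hu2 hw2.
have [uw|uw] := pselect (u <=1 w); last first.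
  by rewrite a1 // b1 // => /(psi_le iso uv wv).
have [e|/eqP ne] := eqVneq u w; first by rewrite -e in a2 b2 *; rewrite a2 b2.
have [//|luw] := bruhat_eq_or_lt uw.
have uw2 := (psi_le iso uv wv).1 uw.
have ne2 : psi u <> psi w by move=> /(psi_inj iso uv wv).
have := a3 (conj uw ne); have := b3 (conj uw2 ne2).
move: a4 b4; rewrite !(psi_len iso) //; set l := (length S1 w - length S1 u)%N.
rewrite subzn ?(ltnW luw) // -/l -!exprnP => a4 b4 d2 d1.
have fin : finite_set (parabolic_interval S1 H1 u w).
  by apply: sub_finite_set (interval_finite w) => z [[]].
have uin : parabolic_interval S1 H1 u w u by split=> //; split=> //; apply: bruhat_refl.
(* Both candidates satisfy the same degree bound, hence so does their difference, and it remains to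
   see that the difference is self-dual. *)
apply/eqP; rewrite -subr_eq0; apply/eqP; apply: (@self_dual_eq0 _ l); first by lia.
  apply: leq_trans (_ : (maxn (2 * (size (P1 u w)).-1)
    (2 * (size (P2 (psi u) (psi w))).-1) <= _)%N); last by rewrite geq_max d1 d2.
  have := size_polyD (P1 u w) (- P2 (psi u) (psi w))%R; rewrite size_polyN.
  by move: (size _) (size _) (size _) => x y z; lia.
rewrite eval_inv_qB mulrBr a4 b4 -rmorphB; congr tofrac.
pose I := parabolic_interval S1 H1 u w.
have bij : set_bij I (parabolic_interval S2 H2 (psi u) (psi w)) psi.
  split=> [z [[uz zw] hz]|y z /set_mem[[_ yw] _] /set_mem[[_ zw] _]|y [[uy yw] hy]].
  - have zv := bruhat_trans zw wv; split; last exact/(psi_WH iso isoH zv).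
    by split; apply/(psi_le iso).
  - by apply: (psi_inj iso); apply: bruhat_trans wv.
  - have [z zv e] := psi_onto iso (bruhat_trans yw (psi_below iso wv)).
    rewrite -e in uy yw hy *; exists z => //; split; last exact/(psi_WH iso isoH zv).
    by split; apply/(psi_le iso).
have -> : (\sum_(z \in parabolic_interval S2 H2 (psi u) (psi w)) R2 (psi u) z * P2 z (psi w) =
    \sum_(z \in I) R2 (psi u) (psi z) * P2 (psi z) (psi w))%R by apply: reindex_fsbig.
(* The terms with z different from u agree by induction on l(w) - l(z). The term z = u has
   coefficient 1 on both sides, so the difference of the sums is the difference of the two
   polynomials. *)
have split (g : W1 -> {poly int}) : (\sum_(z \in I) g z = g u + \sum_(z \in I `\ u) g z)%R.
  exact: fsbigD1.
rewrite !split R11 // -R12 // R11 // !mul1r.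
have -> : (\sum_(z \in I `\ u) R1 u z * P1 z w =
    \sum_(z \in I `\ u) R2 (psi u) (psi z) * P2 (psi z) (psi w))%R.
  apply: eq_fsbigr => z /set_mem[[[uz zw] hz] zu].
  have zv := bruhat_trans zw wv; rewrite R12 //; congr (_ * _)%R.
  have [e|lz] := bruhat_eq_or_lt uz; first by case: zu.
  by apply: (IH (length S1 w - length S1 z)%N) => //; lia.
by rewrite opprD addrACA subrr addr0.
Qed.

End TransportKL.

Local Open Scope ring_scope.

Theorem corollary5p1
  (W1 W2 : groupType)
  (S1 : set W1) (S2 : set W2)
  (m1 : W1 -> W1 -> option nat) (m2 : W2 -> W2 -> option nat)
  (cox1 : coxeter_system S1 m1) (cox2 : coxeter_system S2 m2)
  (type1 : doubly_laced S1 m1 \/ dihedral S1)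
  (type2 : doubly_laced S2 m2 \/ dihedral S2)
  (H1 : set W1) (H2 : set W2)
  (subH1 : H1 `<=` S1) (subH2 : H2 `<=` S2)
  (v1 : W1) (v2 : W2)
  (v1_min : min_coset_reps S1 H1 v1) (v2_min : min_coset_reps S2 H2 v2)
  (psi : W1 -> W2)
  (psi_iso : poset_iso (bruhat_le S1) (bruhat_le S2)
     (bruhat_interval S1 1%g v1) (bruhat_interval S2 1%g v2) psi)
  (psi_iso_H : poset_iso (bruhat_le S1) (bruhat_le S2)
     (parabolic_interval S1 H1 1%g v1) (parabolic_interval S2 H2 1%g v2) psi)
  (x : {poly int}) (hx : x = -1 \/ x = 'X)
  (R1 P1 : W1 -> W1 -> {poly int}) (R2 P2 : W2 -> W2 -> {poly int})
  (hR1 : parabolic_R_family S1 H1 x R1)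
  (hP1 : parabolic_KL_family S1 H1 R1 P1)
  (hR2 : parabolic_R_family S2 H2 x R2)
  (hP2 : parabolic_KL_family S2 H2 R2 P2) :
  (forall u w : W1,
     parabolic_interval S1 H1 1%g v1 u -> parabolic_interval S1 H1 1%g v1 w ->
     P1 u w = P2 (psi u) (psi w)) /\
  (forall u w : W1,
     parabolic_interval S1 H1 1%g v1 u -> parabolic_interval S1 H1 1%g v1 w ->
     R1 u w = R2 (psi u) (psi w)).
Proof.
pose C1 := CoxSystem (ex_intro _ m1 cox1); pose C2 := CoxSystem (ex_intro _ m2 cox2).
have matching (C : coxSystem) (m : cx_group C -> cx_group C -> option nat) :
    coxeter_system (@cx_gens C) m -> doubly_laced (@cx_gens C) m \/ dihedral (@cx_gens C) ->
    exists R : cx_group C -> cx_group C -> {poly int}, matching_R R.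
  by move=> cox [dl|di]; [apply: matching_R_doubly_laced cox dl|apply: matching_R_dihedral di].
have [Q1 mQ1] := matching C1 m1 cox1 type1; have [Q2 mQ2] := matching C2 m2 cox2 type2.
have R12 u w : bruhat_le S1 u v1 -> bruhat_le S1 w v1 -> min_coset_reps S1 H1 u ->
    min_coset_reps S1 H1 w -> R1 u w = R2 (psi u) (psi w).
  move=> uv wv hu hw.
  rewrite (@parabolic_R_deodhar C1 H1 subH1 Q1 x mQ1 hx R1 u w hR1 hu hw).
  rewrite (@parabolic_R_deodhar C2 H2 subH2 Q2 x mQ2 hx R2 (psi u) (psi w) hR2).
  - exact: (@deodhar_transport C1 C2 v1 v2 psi psi_iso H1 H2 psi_iso_H).
  - exact/(@psi_WH C1 C2 v1 v2 psi psi_iso H1 H2 psi_iso_H u uv).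
  - exact/(@psi_WH C1 C2 v1 v2 psi psi_iso H1 H2 psi_iso_H w wv).
split=> u w [[_ uv] hu] [[_ wv] hw]; last exact: R12.
apply: (@KL_transport C1 C2 v1 v2 psi psi_iso H1 H2 psi_iso_H R1 P1 R2 P2 hP1 hP2 R12 _
  _ u w (leqnn _) uv wv hu hw).
by move=> z hz; have [_ ->] := hR1 z z hz hz.
Qed.
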